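(* Let $S\in\mathcal{B}(\mathcal{K})$ be an analytic Brownian unitary acting on a complex Hilbert space $\mathcal{K}$. Let $\mathcal{E}=\mathcal{N}(S^* )$ and let $\mu$ be the positive $\mathcal{B}(\mathcal{E})$-valued measure defined on the $\sigma$-algebra ${\rm Bor}(\mathbb{T})$ of all Borel subsets of the unit circle $\mathbb{T}$ by $$\mu(\sigma)=P_{\mathcal{E}}F(\sigma)\Delta_S|_{\mathcal{E}},\qquad \sigma\in{\rm Bor}(\mathbb{T}),$$ where $F$ is the $\mathcal{B}(\mathcal{R}(\Delta_S))$-valued spectral measure on $\mathbb{T}$ of the unitary operator $U$ on $\mathcal{R}(\Delta_S)$ with $U^*=S^*|_{\mathcal{R}(\Delta_S)}$. Then $S$ is unitarily equivalent to the forward shift on the Dirichlet space $\mathcal{D}(\mu)=\{\Theta k:k\in\mathcal{K}\}$ of $\mathcal{E}$-valued analytic functions on the open unit disk $\mathbb{D}$, where $$(\Theta k)(z)=\sum_{n\ge0}(P_{\mathcal{E}}S'^{*n}k)z^n,\qquad z\in\mathbb{D},$$ $S'$ being the Cauchy dual operator of $S$, and the norm on $\mathcal{D}(\mu)$ is the one induced by $\mu$. Moreover, if $\delta={\rm cov}(S)$ and $E_0=\delta^{-1}P_{\mathcal{N}(\Delta_S)}S|_{\mathcal{R}(\Delta_S)}$, then $$\mathcal{E}=\{-\delta^{-1}E_0U^*d\oplus d:\ d\in\mathcal{R}(\Delta_S)\}\subset\mathcal{N}(\Delta_S)\oplus\mathcal{R}(\Delta_S)$$ and $(1+\delta^2)\delta^{-4}\mu(\sigma)$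 is an orthogonal projection for every $\sigma\in{\rm Bor}(\mathbb{T})$.
   Context: All Hilbert spaces are complex and operators are bounded and linear; $\mathcal{R}(\cdot)$, $\mathcal{N}(\cdot)$ denote range and kernel, $P_{\mathcal{M}}$ the orthogonal projection onto $\mathcal{M}$. Put $\Delta_S=S^*S-I$. $S\in\mathcal{B}(\mathcal{K})$ is a $2$-isometry if $S^*\Delta_SS=\Delta_S$; then $\Delta_S\ge0$ and ${\rm cov}(S)=\|\Delta_S\|^{1/2}$ is the covariance of $S$. A $2$-isometry has the canonical matrix $S=\begin{pmatrix}V&E\\0&Y\end{pmatrix}$ on $\mathcal{K}=\mathcal{N}(\Delta_S)\oplus\overline{\mathcal{R}(\Delta_S)}$, with $V$ an isometry and $V^*E=0$. $S$ is a Brownian unitary if $E=\delta E_0$ with $\delta={\rm cov}(S)$, $E_0$ an isometry from $\overline{\mathcal{R}(\Delta_S)}$ with $\mathcal{R}(E_0)=\mathcal{N}(V^* )$, and $Y$ is unitary; in this case $\Delta_S=0\oplus\delta^2I$, so $\mathcal{R}(\Delta_S)$ is closed. $S$ is analytic if $\bigcap_{n\ge1}S^n\mathcal{K}=\{0\}$. The Cauchy dual of a left invertible operator $S$ is $S'=S(S^*S)^{-1}$. For a positive $\mathcal{B}(\mathcal{E})$-valued operator measure $\mu$ on $\mathbb{T}$, the Dirichlet space $\mathcal{D}(\mu)$ is the Hilbert space of $\mathcal{E}$-valued analytic functions $f(z)=\sum_{n\ge0}a_nz^n$ on $\mathbb{D}$ with $$\|f\|_\mu^2=\sum_{n\ge0}\|a_n\|^2+\int_{\mathbb{D}}\langle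 P[\mu](z)f'(z),f'(z)\rangle\,dA(z)<\infty,$$ where $P[\mu](z)=\int_{\mathbb{T}}\frac{1-|z|^2}{|\zeta-z|^2}\,d\mu(\zeta)$ and $dA$ is area measure on $\mathbb{D}$ normalized to have total mass $1$. The forward shift on $\mathcal{D}(\mu)$ is $(Mf)(z)=zf(z)$. *)

(* Defs.v *)
From HB Require Import structures.
From mathcomp Require Import all_boot all_order all_algebra.
From mathcomp Require Import sesquilinear complex.
From mathcomp Require Import all_classical all_reals all_analysis.

Set Implicit Arguments.
Unset Strict Implicit.
Unset Printing Implicit Defensive.

Import Order.TTheory GRing.Theory Num.Theory.
Import numFieldNormedType.Exports.

Local Open Scope classical_set_scope.
Local Open Scope ring_scope.
Local Open Scope complex_scope.

(* The form is linear in the first variable, conjugate-linear in the second.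
   The norm takes its values in R[i], as for any normed module over R[i];
   [rnorm] is the same norm as an element of R. *)
HB.mixin Record hasInner (R : realType) K of CompleteNormedModule R[i] K := {
  inner : {dot K for (@Num.conj R[i])} ;
  innerE : forall x : K, inner x x = `|x| ^+ 2 }.

#[short(type="hilbertType")]
HB.structure Definition Hilbert (R : realType) :=
  { K of CompleteNormedModule R[i] K & hasInner R K }.

Definition rnorm (R : realType) (V : normedModType R[i]) (x : V) : R :=
  complex.Re `|x|.

(* A closed subspace of K is a set, and an operator defined on a subspace M is
   a total function K -> K of which only the values on M are relevant. *)
Section Operators.
Context {R : realType} {K : hilbertType R}.
Implicit Types (M H N : set K) (T : K -> K).

Definition closed_subspace M :=
  [/\ M 0, (forall (a : R[i]) x y, M x -> M y -> M (a *: x + y)) & closed M].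

Definition linear_on M T :=
  forall (a : R[i]) x y, M x -> M y -> T (a *: x + y) = a *: T x + T y.

Definition bounded_operator_on M T :=
  [/\ linear_on M T, (forall x, M x -> M (T x)) &
      exists c : R, forall x, M x -> rnorm (T x) <= c * rnorm x].

Definition isometry_on M T :=
  linear_on M T /\ forall x, M x -> rnorm (T x) = rnorm x.

Definition unitary_on M T := isometry_on M T /\ T @` M = M.

Definition opnorm T : R := sup [set rnorm (T x) | x in [set x | rnorm x <= 1]].

Definition nullspace T : set K := [set x | T x = 0].

(* [orthoproj M x] is the point of M nearest to x when M is a closed subspace. *)
Definition orthoproj M (x : K) : K :=
  xget 0 [set y | M y /\ forall m, M m -> inner (x - y) m = 0].

(* The adjoint of the bounded operator T|_M from the closed subspace M to K:
   its value at y is the Riesz representative in M of m |-> <T m, y>. If T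
   maps M into a closed subspace N then, on N, this is also the adjoint of T as
   an operator from M to N. *)
Definition adj_on M T (y : K) : K :=
  xget 0 [set x | M x /\ forall m, M m -> inner (T m) y = inner m x].

Definition adj T : K -> K := adj_on setT T.

Definition orthogonal_projection_on H T :=
  exists M, [/\ closed_subspace M, M `<=` H & forall x, H x -> T x = orthoproj M x].

Definition Delta T (x : K) : K := adj T (T x) - x.

Definition cov T : R := Num.sqrt (opnorm (Delta T)).

Definition two_isometry T :=
  forall x, adj T (Delta T (T x)) = Delta T x.

Definition brownian_unitary T :=
  let N := nullspace (Delta T) in
  let D := closure (range (Delta T)) in
  two_isometry T /\
  exists E0 : K -> K,
    [/\ isometry_on D E0,
        E0 @` D = [set y | N y /\ adj_on N T y = 0],
        (forall x, D x -> orthoproj N (T x) = (cov T)%:C *: E0 x) &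
        unitary_on D (fun x => orthoproj D (T x))].

Definition analytic_operator T :=
  \bigcap_(n in [set n | (1 <= n)%N]) range (iter n T) = [set 0].

Definition cauchy_dual T : K -> K :=
  T \o 'pinv_(fun=> 0) [set: K] (adj T \o T).

End Operators.

Section Measures.
Context {R : realType} {K : hilbertType R}.
Implicit Types (E H : set K) (mu F : set R[i] -> K -> K).

Definition unit_disk : set R[i] := [set z | `|z| < 1].
Definition unit_circle : set R[i] := [set z | `|z| = 1].

Definition borelC := g_sigma_algebraType (@open R[i]^o).

(* The circle being closed, its Borel subsets are the Borel subsets of the
   plane that it contains. *)
Definition borelT (s : set R[i]) : Prop :=
  s `<=` unit_circle /\ measurable (s : set borelC).

Definition weakly_additive E mu :=
  forall A : nat -> set R[i], (forall n, borelT (A n)) -> trivIset setT A ->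
  forall x y, E x -> E y ->
  (fun n => \sum_(0 <= k < n) inner (mu (A k) x) y : R[i]^o) @ \oo -->
    (inner (mu (\bigcup_k A k) x) y : R[i]^o).

Definition positive_operator_measure E mu :=
  [/\ (forall s, borelT s -> bounded_operator_on E (mu s)),
      (forall s x, borelT s -> E x -> 0 <= inner (mu s x) x) &
      weakly_additive E mu].

(* The scalar measure s |-> <mu(s) x, x>, extended to the Borel subsets of the
   plane by 0 off the circle. *)
Definition quadratic_measure mu (x : K) (s : set borelC) : \bar R :=
  (complex.Re (inner (mu (s `&` unit_circle) x) x))%:E.

Definition circle_integral mu (x : K) (g : R[i] -> R) : \bar R :=
  (\int[quadratic_measure mu x]_(z in (unit_circle : set borelC)) (g z)%:E)%E.

(* F is the spectral measure of the operator T on H. The identity T = int z dF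
   is read weakly; the diagonal entries <T x, x> = int z d<F(z) x, x> give all
   the entries <T x, y> by polarization. *)
Definition spectral_measure_of H T F :=
  [/\ (forall s, borelT s -> orthogonal_projection_on H (F s)),
      (forall x, H x -> F unit_circle x = x),
      weakly_additive H F &
      forall x, H x -> inner (T x) x =
        fine (circle_integral F x (@complex.Re R)) +i*
        fine (circle_integral F x (@complex.Im R))].

(* The quadratic form a |-> <P[mu](z) a, a> of the operator integral P[mu](z),
   that is the Poisson integral of s |-> <mu(s) a, a>. *)
Definition poisson_form mu (z : R[i]) (a : K) : \bar R :=
  circle_integral mu a (fun zeta =>
    (1 - rnorm (z : R[i]^o) ^+ 2) / rnorm (zeta - z : R[i]^o) ^+ 2).

End Measures.

(* A function on the open unit disk is represented by the function on R[i]
   that extends it by 0, so that equality is equality on the disk. *)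
Section Dirichlet.
Context {R : realType} {K : hilbertType R}.
Implicit Types (E : set K) (mu : set R[i] -> K -> K) (f : R[i] -> K).

Definition power_series (a : nat -> K) f :=
  forall z, unit_disk z -> series (fun n => z ^+ n *: a n) @ \oo --> f z.

Definition coefficients f : nat -> K :=
  xget (fun=> 0) [set a | power_series a f].

Definition plane_point (p : measurableTypeR R * measurableTypeR R) : R[i] :=
  (p.1 : R) +i* (p.2 : R).

(* Area measure on the disk has total mass 1, whence the factor 1/pi. *)
Definition dirichlet_norm2 mu f : \bar R :=
  (\sum_(0 <= n <oo) ((rnorm (coefficients f n) ^+ 2)%R)%:E
   + ((pi^-1)%R)%:E *
     \int[(lebesgue_measure \x lebesgue_measure)%E]_(p in
         plane_point @^-1` unit_disk)
       poisson_form mu (plane_point p) (derive1 f (plane_point p)))%E.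

Definition dirichlet_space E mu : set (R[i] -> K) :=
  [set f | [/\ (exists a, (forall n, E (a n)) /\ power_series a f),
               (forall z, ~ unit_disk z -> f z = 0) &
               (dirichlet_norm2 mu f < +oo)%E]].

Definition forward_shift f : R[i] -> K := fun z => z *: f z.

(* By polarization, a linear bijection that preserves norms is unitary. *)
Definition unitary_onto_dirichlet E mu (W : K -> R[i] -> K) :=
  [/\ linear W, range W = dirichlet_space E mu &
      forall k, dirichlet_norm2 mu (W k) = (rnorm k ^+ 2)%:E].

Definition equivalent_to_shift E mu (T : K -> K) :=
  exists2 W, unitary_onto_dirichlet E mu W &
    forall k, W (T k) = forward_shift (W k).

Definition Theta (T : K -> K) (k : K) : R[i] -> K :=
  patch (fun=> 0) unit_disk (fun z =>
    lim (series (fun n =>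
      z ^+ n *: orthoproj (nullspace (adj T)) (iter n (adj (cauchy_dual T)) k)) @ \oo)).

End Dirichlet.

(* Main.v *)
Require Import Defs.
From HB Require Import structures.
From mathcomp Require Import all_boot all_order all_algebra.
From mathcomp Require Import sesquilinear complex.
From mathcomp Require Import all_classical all_reals all_analysis.
From mathcomp Require Import measurable_realfun.
From mathcomp Require Import ring lra.

Set Implicit Arguments.
Unset Strict Implicit.
Unset Printing Implicit Defensive.

Import Order.TTheory GRing.Theory Num.Theory.
Import numFieldNormedType.Exports.

Local Open Scope classical_set_scope.
Local Open Scope ring_scope.
Local Open Scope complex_scope.

(** Let [D] be the range of [Delta S], [P] the projection onto it, [E] the kernel of
    the adjoint and [delta] the covariance, which is positive unless the space is
    trivial ([brownian_trivial]). Since [Delta S] is [delta ^+ 2] times [P]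
    ([Delta_scalar]), the structure of [S] is explicit, and [brownian_data] records
    it: [P S = U P], the adjoint of [S] restricts to the inverse of [U] on [D], and
    [E] is a graph over [D], on which [P] is a multiple of an isometry. The graph
    map [J] from [D] to [E] carries the spectral measure of [U] to a multiple of
    [mu], which gives the description of [E] ([range_ker]), and makes [mu] a positive
    operator measure ([dirichlet_measure_positive]) and a multiple of a projection
    measure ([scaled_measure_projection]).

    The adjoint [L] of the Cauchy dual is a left inverse of [S] with
    [k - S L k = P_E k], so that [Theta S k] has the Taylor coefficients
    [a n = P_E L^n k], and [Theta S] intertwines [S] with the shift. What has to be
    shown is that it is a norm-preserving bijection onto the Dirichlet space, and
    for this both norms are computed from the coefficients.

    The Dirichlet norm. The scalar spectral measure of [U x - z *: x] has density
    [|zeta - z|^2] with respect to that of [x], so that the Poisson integral of the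
    former at [z] is [1 - |z|^2] times the squared norm of [x] ([poisson_identity]).
    Hence, if [h] is the function with values in [D] such that
    [(U - z) h(z) = P f'(z)], the integrand of the Dirichlet integral of [f] is
    [delta ^+ 2 * (1 - |z|^2)] times the squared norm of [h(z)], and the integral is
    a weighted sum of squared norms of the coefficients of [h]
    ([disk_norm_power_series]). These coefficients are sums of the [(m + 1) P a_{m+1}]
    rotated by powers of [U], whence [dirichlet_normE], with summands [deviation].

    The norm of [k]. Iterating the orthogonal decomposition of [k] into [P_E k] and
    [S L k] gives the sum of the squared norms of the [a n], and [delta ^+ 2] times
    the sum of the squared norms of the [P L^n k] with [n] positive
    ([rnorm_split_iter]); the remainder tends to zero because [S] is analytic
    ([iter_L_cvg0]). Rotated by powers of [U], the [P L^n k] become a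
    square-summable sequence in [D] whose successive differences are the rotated
    [P a n]. The sum of squares of a sequence is the sum of the weighted deviations
    of its terms from the means of the earlier ones, up to a multiple of the last
    mean ([variance_telescope]), and these deviations only depend on the differences,
    by summation by parts: they are the summands [deviation] above. This is
    [norm_identity].

    For surjectivity, given coefficients with finite Dirichlet norm, the same
    differences determine a sequence in [D] up to a constant, and summability of
    the deviations provides the constant that makes it square-summable
    ([deviation_summable]). It plays the role of the [P L^n k], and the component of
    [k] outside [D] is an orthogonal series built from it ([realization]). *)

(** * Inner products *)

Section InnerProduct.
Context {R : realType} {K : hilbertType R}.
Implicit Types (x y z : K) (a b : R[i]).

(** The modulus as an element of [R], in the way [rnorm] is the norm. *)
Definition cabs (a : R[i]) : R := complex.Re `|a|.

Lemma normE (V : normedModType R[i]) (x : V) : `|x| = (rnorm x)%:C.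
Proof. by rewrite /rnorm RRe_real // normr_real. Qed.

Lemma cabsE a : `|a| = (cabs a)%:C.
Proof. by rewrite /cabs RRe_real // normr_real. Qed.

Lemma conj0 : Num.conj (0 : R[i]) = 0.
Proof. exact: rmorph0. Qed.

Lemma innerDl x y z : inner (x + y) z = inner x z + inner y z.
Proof. exact: linearDl. Qed.
Lemma innerBl x y z : inner (x - y) z = inner x z - inner y z.
Proof. exact: linearBl. Qed.
Lemma inner0l z : inner 0 z = 0.
Proof. exact: linear0l. Qed.
Lemma innerZl a x z : inner (a *: x) z = a * inner x z.
Proof. exact: linearZl_LR. Qed.
Lemma innerC x y : inner x y = Num.conj (inner y x).
Proof. by rewrite hermC expr0 mul1r. Qed.
Lemma innerDr x y z : inner z (x + y) = inner z x + inner z y.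
Proof. exact: linearDr. Qed.
Lemma innerBr x y z : inner z (x - y) = inner z x - inner z y.
Proof. exact: linearBr. Qed.
Lemma innerNr x z : inner z (- x) = - inner z x.
Proof. exact: linearNr. Qed.
Lemma inner0r z : inner z 0 = 0.
Proof. exact: linear0r. Qed.
Lemma innerZr a x z : inner z (a *: x) = Num.conj a * inner z x.
Proof. by rewrite linearZr_LR. Qed.

Lemma conjR (r : R) : Num.conj (r%:C) = r%:C.
Proof. exact: conjc_real. Qed.

Lemma inner_norm x : inner x x = (rnorm x ^+ 2)%:C.
Proof. by rewrite innerE normE rmorphXn. Qed.

Lemma rnorm_ge0 (V : normedModType R[i]) (x : V) : 0 <= rnorm x.
Proof. by rewrite -lecR -normE normr_ge0. Qed.
Lemma rnorm0 (V : normedModType R[i]) : rnorm (0 : V) = 0.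
Proof. by rewrite /rnorm normr0. Qed.
Lemma rnormN (V : normedModType R[i]) (x : V) : rnorm (- x) = rnorm x.
Proof. by rewrite /rnorm normrN. Qed.
Lemma rnormD (V : normedModType R[i]) (x y : V) : rnorm (x + y) <= rnorm x + rnorm y.
Proof. by rewrite -lecR rmorphD /= -!normE ler_normD. Qed.
Lemma rnormB (V : normedModType R[i]) (x y : V) : rnorm (x - y) <= rnorm x + rnorm y.
Proof. by rewrite (le_trans (rnormD _ _))// rnormN. Qed.
Lemma rnormC (V : normedModType R[i]) (x y : V) : rnorm (x - y) = rnorm (y - x).
Proof. by rewrite -rnormN opprB. Qed.
Lemma rnormZ (V : normedModType R[i]) a (x : V) : rnorm (a *: x) = cabs a * rnorm x.
Proof. by apply: complexI; rewrite rmorphM /= -!normE -cabsE normrZ. Qed.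
Lemma rnorm_eq0 (V : normedModType R[i]) (x : V) : rnorm x = 0 -> x = 0.
Proof. by move=> x0; apply/normr0_eq0; rewrite normE x0. Qed.
Lemma rnorm_sum (V : normedModType R[i]) (I : Type) (r : seq I) (f : I -> V) :
  rnorm (\sum_(i <- r) f i) <= \sum_(i <- r) rnorm (f i).
Proof.
elim/big_ind2: _ => [|x a y b xa yb|//]; first by rewrite rnorm0.
by rewrite (le_trans (rnormD _ _))// lerD.
Qed.

Lemma cabs_ge0 a : 0 <= cabs a.
Proof. by rewrite -lecR -cabsE normr_ge0. Qed.
Lemma cabsM a b : cabs (a * b) = cabs a * cabs b.
Proof. by apply: complexI; rewrite rmorphM /= -!cabsE normrM. Qed.
Lemma cabsD a b : cabs (a + b) <= cabs a + cabs b.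
Proof. by rewrite -lecR rmorphD /= -!cabsE ler_normD. Qed.
Lemma cabsN a : cabs (- a) = cabs a.
Proof. by rewrite /cabs normrN. Qed.
Lemma cabsX a n : cabs (a ^+ n) = cabs a ^+ n.
Proof. by apply: complexI; rewrite rmorphXn /= -!cabsE normrX. Qed.
Lemma cabsR (r : R) : cabs r%:C = `|r|.
Proof.
by rewrite /cabs normc_def /= expr0n addr0 sqrtr_sqr.
Qed.
Lemma cabs_nat n : cabs n%:R = n%:R.
Proof. by rewrite /cabs normr_nat -(rmorph_nat (real_complex R)). Qed.
Lemma cabs_conj a : cabs (Num.conj a) = cabs a.
Proof. by apply: complexI; rewrite -!cabsE norm_conjC. Qed.
Lemma cabs_sqr a : cabs a ^+ 2 = complex.Re a ^+ 2 + complex.Im a ^+ 2.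
Proof. by apply: complexI; rewrite rmorphXn /= -cabsE -add_Re2_Im2. Qed.
Lemma le_Re_cabs a : `|complex.Re a| <= cabs a.
Proof.
rewrite -(ler_pXn2r (ltn0Sn 1)) ?nnegrE ?cabs_ge0 //.
by rewrite cabs_sqr -normrX ger0_norm ?sqr_ge0// lerDl sqr_ge0.
Qed.
Lemma le_Im_cabs a : `|complex.Im a| <= cabs a.
Proof.
rewrite -(ler_pXn2r (ltn0Sn 1)) ?nnegrE ?cabs_ge0 //.
by rewrite cabs_sqr -normrX ger0_norm ?sqr_ge0// lerDr sqr_ge0.
Qed.
Lemma ReD a b : complex.Re (a + b) = complex.Re a + complex.Re b.
Proof. by case: a b => ? ? []. Qed.
Lemma ReN a : complex.Re (- a) = - complex.Re a.
Proof. by case: a. Qed.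
Lemma Re_conj a : complex.Re (Num.conj a) = complex.Re a.
Proof. by case: a. Qed.
Lemma ReZ (r : R) a : complex.Re (r%:C * a) = r * complex.Re a.
Proof. by case: a => x y /=; rewrite mul0r subr0. Qed.
Lemma conj_nat n : Num.conj (n%:R : R[i]) = n%:R.
Proof. exact: rmorph_nat. Qed.
Lemma ReZ_nat n a : complex.Re (n%:R * a) = n%:R * complex.Re a.
Proof. by rewrite -(rmorph_nat (real_complex R)) ReZ. Qed.

Lemma rnorm_sqr x : rnorm x ^+ 2 = complex.Re (inner x x).
Proof. by rewrite inner_norm. Qed.

Lemma rnormD_sqr x y :
  rnorm (x + y) ^+ 2 = rnorm x ^+ 2 + 2 * complex.Re (inner x y) + rnorm y ^+ 2.
Proof.
rewrite !rnorm_sqr innerDl !innerDr !ReD [inner y x]innerC Re_conj; ring.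
Qed.

Lemma rnormB_sqr x y :
  rnorm (x - y) ^+ 2 = rnorm x ^+ 2 - 2 * complex.Re (inner x y) + rnorm y ^+ 2.
Proof. by rewrite rnormD_sqr rnormN innerNr ReN mulrN. Qed.

Lemma pythagoras x y : inner x y = 0 ->
  rnorm (x + y) ^+ 2 = rnorm x ^+ 2 + rnorm y ^+ 2.
Proof. by move=> xy; rewrite rnormD_sqr xy mulr0 addr0. Qed.

Lemma parallelogram x y : rnorm (x + y) ^+ 2 + rnorm (x - y) ^+ 2 =
  2 * rnorm x ^+ 2 + 2 * rnorm y ^+ 2.
Proof. rewrite rnormD_sqr rnormB_sqr; ring. Qed.

Lemma inner_eq0 x : inner x x = 0 -> x = 0.
Proof.
rewrite inner_norm => /(congr1 (@complex.Re R))/= /eqP.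
by rewrite sqrf_eq0 => /eqP /rnorm_eq0.
Qed.

(** Adjoints and projections are identified by this separation property. *)
Lemma inner_ext x y : (forall m, inner m x = inner m y) -> x = y.
Proof.
move=> h; apply/eqP; rewrite -subr_eq0; apply/eqP/inner_eq0.
by rewrite innerBr h subrr.
Qed.

(** Split [x] along [y] and its complement: only the component along [y] counts
    in [inner x y], and by Pythagoras it is shorter than [x]. *)
Lemma cauchy_schwarz x y : cabs (inner x y) <= rnorm x * rnorm y.
Proof.
have [->|y0] := eqVneq y 0; first by rewrite inner0r cabsR normr0 rnorm0 mulr0.
have ny : 0 < rnorm y ^+ 2.
  rewrite exprn_gt0// lt0r rnorm_ge0 andbT.
  by apply: contra y0 => /eqP/rnorm_eq0/eqP.
rewrite -(ler_pXn2r (ltn0Sn 1)) ?nnegrE ?cabs_ge0 ?mulr_ge0 ?rnorm_ge0//.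
have [u [v [ux uv]]] : exists u v, x = u + v /\ (inner u v = 0 /\ exists a, u = a *: y) /\ inner v y = 0.
  pose c := inner x y / inner y y; exists (c *: y), (x - c *: y).
  have vy : inner (x - c *: y) y = 0.
    rewrite innerBl innerZl /c divfK ?subrr // inner_norm.
    by apply/eqP => /complexI /eqP; rewrite gt_eqF.
  split; first by rewrite addrC subrK.
  split=> //; split; last by exists c.
  by rewrite innerZl innerC vy conj0 mulr0.
case: uv => -[uv [a ua]] vy.
rewrite ux innerDl vy addr0 exprMn (pythagoras uv) ua innerZl inner_norm.
rewrite cabsM cabsR ger0_norm ?sqr_ge0// rnormZ !exprMn.
rewrite mulrDl expr2 !mulrA -[X in X <= _]addr0 lerD//; last first.
  by rewrite mulr_ge0 ?mulr_ge0 ?rnorm_ge0 ?sqr_ge0 //.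
Qed.

(** Convergence for the complex-valued norm is convergence for its real part. *)
Lemma cvg_rnorm (V : normedModType R[i]) (T : Type) (F : set_system T)
    {FF : Filter F} (u : T -> V) (l : V) :
  u @ F --> l <-> forall e : R, 0 < e -> \forall t \near F, rnorm (u t - l) < e.
Proof.
split.
  move=> /cvgrPdist_lt ul e e0; have /ul : 0 < e%:C by rewrite ltcR.
  by apply: filterS => t; rewrite normE ltcR rnormC.
move=> h; apply/cvgrPdist_lt => -[e e'].
rewrite ltcE /= => /andP[/eqP -> e0].
by apply: filterS (h _ e0) => t; rewrite normE ltcR rnormC.
Qed.

Lemma cvg_seq (V : normedModType R[i]) (u : nat -> V) (l : V) :
  u @ \oo --> l <->
  forall e : R, 0 < e -> exists N, forall n, (N <= n)%N -> rnorm (u n - l) < e.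
Proof.
rewrite cvg_rnorm; split=> h e /h; first by move=> [N _ hN]; exists N.
by move=> [N hN]; exists N.
Qed.

Lemma cvg_seqR (u : nat -> R) (l : R) :
  u @ \oo --> l <->
  forall e : R, 0 < e -> exists N, forall n, (N <= n)%N -> `|u n - l| < e.
Proof.
split.
  move=> /cvgrPdist_lt h e /h [N _ hN]; exists N => n /hN /=.
  by rewrite distrC.
move=> h; apply/cvgrPdist_lt => e /h [N hN]; exists N => // n /hN.
by rewrite distrC.
Qed.

Lemma cauchy_cvg_seq (u : nat -> K) :
  (forall e : R, 0 < e -> exists N, forall m n, (N <= m)%N -> (N <= n)%N ->
     rnorm (u m - u n) < e) -> exists l : K, u @ \oo --> l.
Proof.
move=> h; exists (lim (u @ \oo : set_system K)).
apply: cauchy_cvg; apply/cauchy_exP => -[e e'].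
rewrite ltcE /= => /andP[/eqP -> e0].
have [N hN] := h _ e0; exists (u N); exists N => // n Nn.
rewrite /= -ball_normE /ball_ /= normE.
by rewrite ltcR; exact: hN.
Qed.

Lemma cvg_uniqK (u : nat -> K) (l l' : K) : u @ \oo --> l -> u @ \oo --> l' -> l = l'.
Proof. by move=> h1 h2; apply: (cvg_unique _ h1 h2); exact: norm_hausdorff. Qed.

End InnerProduct.

(** * Projections and adjoints *)

Section Projections.
Context {R : realType} {K : hilbertType R}.
Implicit Types (x y z : K) (a b : R[i]) (M : set K) (T : K -> K).

Lemma closed_seq M (u : nat -> K) (l : K) :
  closed M -> (forall n, M (u n)) -> u @ \oo --> l -> M l.
Proof.
move=> cM Mu ul; apply: (closed_cvg M cM) ul.
by apply: nearW => n; exact: Mu.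
Qed.

(** Balls of radius [1/(n+1)] form a base at each point, so that sequences detect
    closedness. *)
Lemma seq_closed M :
  (forall (u : nat -> K) (l : K), (forall n, M (u n)) -> u @ \oo --> l -> M l) ->
  closed M.
Proof.
move=> h l cl.
have ex n : exists m, M m /\ rnorm (m - l) < n.+1%:R^-1.
  have e0 : (0 : R[i]) < (n.+1%:R^-1 : R)%:C by rewrite ltcR invr_gt0 ltr0n.
  have [m [Mm lm]] := cl _ (nbhsx_ballx l _ e0).
  exists m; split=> //; move: lm.
  by rewrite -ball_normE /ball_ /= normE ltcR rnormC.
pose u n := projT1 (cid (ex n)).
have uP n : M (u n) /\ rnorm (u n - l) < n.+1%:R^-1 by exact: (projT2 (cid (ex n))).
apply: (h u); first by move=> n; have [] := uP n.
apply/cvg_seq => e e0; exists (Num.trunc e^-1) => n en.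
apply: (lt_le_trans (proj2 (uP n))).
rewrite -(invrK e) lef_pV2 ?posrE ?ltr0n ?invr_gt0//.
apply: ltW; apply: (lt_le_trans (truncnS_gt _)).
by rewrite ler_nat.
Qed.

Lemma closed_subspaceD M x y : closed_subspace M -> M x -> M y -> M (x + y).
Proof. by move=> [_ lM _] Mx My; rewrite -[x]scale1r; exact: lM. Qed.

Lemma closed_subspaceZ M a x : closed_subspace M -> M x -> M (a *: x).
Proof. by move=> [M0 lM _] Mx; rewrite -[_ *: _]addr0; exact: lM. Qed.

Lemma closed_subspaceN M x : closed_subspace M -> M x -> M (- x).
Proof. by move=> cM Mx; rewrite -scaleN1r; exact: closed_subspaceZ. Qed.

Lemma closed_subspaceB M x y : closed_subspace M -> M x -> M y -> M (x - y).
Proof.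
by move=> cM Mx My; apply: closed_subspaceD => //; exact: closed_subspaceN.
Qed.

Lemma closed_subspace_sum M (I : Type) (r : seq I) (f : I -> K) :
  closed_subspace M -> (forall i, M (f i)) -> M (\sum_(i <- r) f i).
Proof.
move=> cM Mf; elim/big_ind: _ => //; first by case: cM.
by move=> x y; exact: closed_subspaceD.
Qed.

(** The nearest point of M is the limit of any minimizing sequence, which is
    Cauchy by the parallelogram law. *)
Lemma nearest_point M x : closed_subspace M ->
  exists y, M y /\ forall m, M m -> rnorm (x - y) <= rnorm (x - m).
Proof.
move=> cM; have [M0 lM clM] := cM.
pose A := [set r | exists2 m, M m & r = rnorm (x - m)].
have A0 : A (rnorm (x - 0)) by exists 0.
have lbA : lbound A 0 by move=> _ [m _ ->]; exact: rnorm_ge0.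
have hA : has_inf A by split; [exists (rnorm (x - 0)) | exists 0].
pose d := inf A.
have d0 : 0 <= d by apply: lb_le_inf => //; exists (rnorm (x - 0)).
have dle m : M m -> d <= rnorm (x - m).
  by move=> Mm; apply: ge_inf; [exists 0 | exists m].
have ex n : exists m, M m /\ rnorm (x - m) < d + n.+1%:R^-1.
  have [|_ [m Mm ->] lt] := @inf_adherent _ A (n.+1%:R^-1) _ hA.
    by rewrite invr_gt0 ltr0n.
  by exists m.
pose u n := projT1 (cid (ex n)).
have uP n : M (u n) /\ rnorm (x - u n) < d + n.+1%:R^-1 by exact: (projT2 (cid (ex n))).
have key m n (e : R) : 0 <= e -> e <= 1 -> rnorm (x - u m) < d + e -> rnorm (x - u n) < d + e ->
    rnorm (u m - u n) ^+ 2 <= 4 * (2 * d + 1) * e.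
  move=> e0 e1 hm hn.
  have := parallelogram (x - u m) (x - u n).
  have -> : x - u m - (x - u n) = - (u m - u n) by rewrite !opprB addrC subrKA.
  have -> : x - u m + (x - u n) = 2%:R *: (x - 2%:R^-1 *: (u m + u n)).
    rewrite scalerBr scalerA divff ?pnatr_eq0// scale1r scaler_nat mulr2n opprD.
    by rewrite addrACA.
  rewrite rnormN rnormZ cabs_nat exprMn => h.
  have hd : d <= rnorm (x - 2%:R^-1 *: (u m + u n)).
    apply: dle; apply: closed_subspaceZ => //.
    by apply: closed_subspaceD => //; exact: (proj1 (uP _)).
  have q1 : rnorm (x - u m) ^+ 2 <= (d + e) ^+ 2.
    by rewrite ler_pXn2r ?nnegrE ?rnorm_ge0 ?addr_ge0// ltW.
  have q2 : rnorm (x - u n) ^+ 2 <= (d + e) ^+ 2.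
    by rewrite ler_pXn2r ?nnegrE ?rnorm_ge0 ?addr_ge0// ltW.
  have q3 : d ^+ 2 <= rnorm (x - 2%:R^-1 *: (u m + u n)) ^+ 2.
    by rewrite ler_pXn2r ?nnegrE ?rnorm_ge0.
  have : rnorm (u m - u n) ^+ 2 <= 4 * ((d + e) ^+ 2 - d ^+ 2) by lra.
  move=> /le_trans; apply; nra.
have [y uy] : exists y, u @ \oo --> y.
  apply: cauchy_cvg_seq => e e0.
  pose c : R := 4 * (2 * d + 1).
  have c0 : 0 < c by rewrite /c; lra.
  exists (Num.trunc (c / e ^+ 2)) => m n hm hn.
  pose N := Num.trunc (c / e ^+ 2).
  have iN : N.+1%:R^-1 < e ^+ 2 / c.
    rewrite -[X in _ < X]invf_div ltf_pV2 ?posrE ?ltr0n ?divr_gt0 ?exprn_gt0//.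
    exact: truncnS_gt.
  have le1 k : (N <= k)%N -> rnorm (x - u k) < d + N.+1%:R^-1.
    move=> Nk; apply: (lt_le_trans (proj2 (uP k))).
    by rewrite lerD2l lef_pV2 ?posrE ?ltr0n// ler_nat.
  rewrite -(ltr_pXn2r (ltn0Sn 1)) ?nnegrE ?rnorm_ge0 ?(ltW e0)//.
  apply: le_lt_trans (key m n N.+1%:R^-1 _ _ (le1 _ hm) (le1 _ hn)) _.
  - by rewrite invr_ge0.
  - by rewrite invf_le1 ?ltr0n// ler1n.
  by rewrite -/c mulrC -ltr_pdivlMr.
have My : M y by apply: (closed_seq clM _ uy) => n; exact: (proj1 (uP n)).
exists y; split=> // m Mm; apply: le_trans (dle m Mm).
suff h (e : R) : 0 < e -> rnorm (x - y) <= d + e by apply/ler_addgt0Pr => e; exact: h.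
move=> e0.
have e2 : 0 < e / 2 by rewrite divr_gt0.
have /cvg_seq /(_ _ e2) [N hN] := uy.
pose n := maxn N (Num.trunc (e / 2)^-1).
have h1 := hN n (leq_maxl _ _).
have h2 : n.+1%:R^-1 <= e / 2.
  rewrite -[X in _ <= X](invrK (e / 2)) lef_pV2 ?posrE ?ltr0n ?invr_gt0//.
  apply: ltW; apply: (lt_le_trans (truncnS_gt _)).
  by rewrite ler_nat ltnS leq_maxr.
have h3 := proj2 (uP n).
have h4 := rnormD (x - u n) (u n - y).
rewrite addrA subrK in h4.
move: h2 h3; move: (n.+1%:R^-1 : R) => w h2 h3.
lra.
Qed.

(** Perturbing the nearest point by a multiple of [m] in the direction of
    [inner (x - y) m] would bring it closer unless that number is zero. *)
Lemma orthoproj_exists M x : closed_subspace M ->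
  exists y, M y /\ forall m, M m -> inner (x - y) m = 0.
Proof.
move=> cM; have [y [My hy]] := nearest_point x cM; exists y; split=> // m Mm.
set c := inner (x - y) m.
(* any positive [t] with [t * rnorm m ^+ 2 < 2] will do *)
pose t : R := (rnorm m ^+ 2 + 1)^-1.
have M1 : M (y + (t%:C * c) *: m).
  by apply: closed_subspaceD => //; exact: closed_subspaceZ.
have := hy _ M1.
rewrite -(ler_pXn2r (ltn0Sn 1)) ?nnegrE ?rnorm_ge0// opprD addrA.
rewrite (rnormB_sqr (x - y)) innerZr -/c rnormZ cabsM cabsR.
have t0 : 0 < t by rewrite invr_gt0 ltr_wpDl ?sqr_ge0.
rewrite (gtr0_norm t0).
have -> : complex.Re (Num.conj (t%:C * c) * c) = t * cabs c ^+ 2.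
  rewrite cabs_sqr; case: (c) => p q /=; rewrite !mul0r subr0 addr0 !expr2; ring.
have tm : t * rnorm m ^+ 2 < 1.
  by rewrite mulrC ltr_pdivrMr ?mul1r ?ltrDl// ltr_wpDl ?sqr_ge0.
rewrite !exprMn => h.
have {}h : 2 * (t * cabs c ^+ 2) <= (t * rnorm m ^+ 2) * (t * cabs c ^+ 2) by nra.
have : cabs c = 0.
  apply/eqP; apply: contraT => c0.
  have : 0 < t * cabs c ^+ 2.
    by rewrite mulr_gt0// exprn_gt0// lt0r c0 cabs_ge0.
  nra.
by move=> /(congr1 (fun r => r%:C)); rewrite -cabsE => /eqP; rewrite normr_eq0 => /eqP.
Qed.

Section Proj.
Variable M : set K.
Hypothesis cM : closed_subspace M.

Lemma orthoprojP x :
  M (orthoproj M x) /\ forall m, M m -> inner (x - orthoproj M x) m = 0.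
Proof.
have [y hy] := orthoproj_exists x cM.
exact: (@xgetPex _ 0 [set y | M y /\ forall m, M m -> inner (x - y) m = 0] (ex_intro _ y hy)).
Qed.

Lemma orthoproj_in x : M (orthoproj M x).
Proof. by have [] := orthoprojP x. Qed.

Lemma orthoproj_ortho x m : M m -> inner (x - orthoproj M x) m = 0.
Proof. by move=> Mm; have [_ ->] := orthoprojP x. Qed.

Lemma orthoproj_inner x m : M m -> inner (orthoproj M x) m = inner x m.
Proof.
by move=> Mm; apply/esym/eqP; rewrite -subr_eq0 -innerBl orthoproj_ortho.
Qed.

Lemma orthoproj_innerr x m : M m -> inner m (orthoproj M x) = inner m x.
Proof. by move=> Mm; rewrite innerC orthoproj_inner// -innerC. Qed.

Lemma orthoproj_unique x y :
  M y -> (forall m, M m -> inner x m = inner y m) -> orthoproj M x = y.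
Proof.
move=> My h; apply/eqP; rewrite -subr_eq0; apply/eqP/inner_eq0.
have Md : M (orthoproj M x - y) by apply: closed_subspaceB => //; exact: orthoproj_in.
by rewrite innerBl orthoproj_inner// h// subrr.
Qed.

Lemma orthoproj_id x : M x -> orthoproj M x = x.
Proof. by move=> Mx; exact: orthoproj_unique. Qed.

Lemma orthoproj_eq0 x : (forall m, M m -> inner x m = 0) -> orthoproj M x = 0.
Proof.
move=> h; apply: orthoproj_unique; first by case: cM.
by move=> m Mm; rewrite h// inner0l.
Qed.

Lemma orthoproj_sym x y : inner (orthoproj M x) y = inner x (orthoproj M y).
Proof.
by rewrite -(orthoproj_innerr y (orthoproj_in x)) orthoproj_inner//; exact: orthoproj_in.
Qed.

Lemma orthoproj_pythagoras x :
  rnorm x ^+ 2 = rnorm (orthoproj M x) ^+ 2 + rnorm (x - orthoproj M x) ^+ 2.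
Proof.
rewrite -pythagoras ?subrKC//.
by rewrite innerC orthoproj_ortho ?conj0//; exact: orthoproj_in.
Qed.

Lemma orthoproj_le x : rnorm (orthoproj M x) <= rnorm x.
Proof.
rewrite -(ler_pXn2r (ltn0Sn 1)) ?nnegrE ?rnorm_ge0//.
by rewrite [X in _ <= X]orthoproj_pythagoras lerDl sqr_ge0.
Qed.

End Proj.

(** Everywhere defined bounded linear operators, as a predicate on functions so
    that it applies to the operators obtained by choice. *)
Definition blin T :=
  linear T /\ exists c : R, 0 <= c /\ forall x, rnorm (T x) <= c * rnorm x.

Lemma blin_proj M : closed_subspace M -> blin (orthoproj M).
Proof.
move=> cM; split; last by exists 1; split=> // x; rewrite mul1r orthoproj_le.
move=> a x y; apply: (orthoproj_unique cM).
  by have [_ h _] := cM; apply: h; exact: orthoproj_in.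
by move=> m Mm; rewrite !innerDl !innerZl !orthoproj_inner.
Qed.

Lemma blin_id : blin id.
Proof. by split=> //; exists 1; split=> // x; rewrite mul1r. Qed.

Lemma blin_comp T1 T2 : blin T1 -> blin T2 -> blin (T1 \o T2).
Proof.
move=> [l1 [c1 [c10 b1]]] [l2 [c2 [c20 b2]]]; split.
  by move=> a x y; rewrite /= l2 l1.
exists (c1 * c2); split; first exact: mulr_ge0.
by move=> x; rewrite /= (le_trans (b1 _))// -mulrA ler_wpM2l.
Qed.

Lemma blin_add T1 T2 : blin T1 -> blin T2 -> blin (fun x => T1 x + T2 x).
Proof.
move=> [l1 [c1 [c10 b1]]] [l2 [c2 [c20 b2]]]; split.
  by move=> a x y; rewrite l2 l1 scalerDr addrACA.
exists (c1 + c2); split; first exact: addr_ge0.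
by move=> x; rewrite (le_trans (rnormD _ _))// mulrDl lerD.
Qed.

Lemma blin_scale a T : blin T -> blin (fun x => a *: T x).
Proof.
move=> [l1 [c1 [c10 b1]]]; split.
  by move=> b x y; rewrite l1 scalerDr !scalerA mulrC.
exists (cabs a * c1); split; first by rewrite mulr_ge0 ?cabs_ge0.
by move=> x; rewrite rnormZ -mulrA ler_wpM2l ?cabs_ge0.
Qed.

Lemma blin_sub T1 T2 : blin T1 -> blin T2 -> blin (fun x => T1 x - T2 x).
Proof.
move=> h1 h2; have := blin_add h1 (blin_scale (-1) h2).
by under eq_fun do rewrite scaleN1r.
Qed.

Lemma blin_iter T n : blin T -> blin (iter n T).
Proof.
by move=> h; elim: n => [|n ih]; [exact: blin_id | exact: (blin_comp h ih)].
Qed.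

Section Blin.
Variable T : K -> K.
Hypothesis bT : blin T.

Lemma blinD x y : T (x + y) = T x + T y.
Proof. by have [l _] := bT; rewrite -[x]scale1r l !scale1r. Qed.
Lemma blin0 : T 0 = 0.
Proof. by apply: (addrI (T 0)); rewrite -blinD !addr0. Qed.
Lemma blinZ a x : T (a *: x) = a *: T x.
Proof. by have [l _] := bT; rewrite -[_ *: x]addr0 l blin0 addr0. Qed.
Lemma blinN x : T (- x) = - T x.
Proof. by rewrite -scaleN1r blinZ scaleN1r. Qed.
Lemma blinB x y : T (x - y) = T x - T y.
Proof. by rewrite blinD blinN. Qed.
Lemma blin_sum (I : Type) (r : seq I) (f : I -> K) :
  T (\sum_(i <- r) f i) = \sum_(i <- r) T (f i).
Proof. by elim/big_ind2: _ => [|_ x _ y <- <-|//]; [exact: blin0 | rewrite blinD]. Qed.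

Lemma blin_cvg (I : Type) (F : set_system I) {FF : Filter F} (u : I -> K) (l : K) :
  u @ F --> l -> (fun i => T (u i)) @ F --> T l.
Proof.
have [_ [c [c0 hc]]] := bT.
move=> /cvg_rnorm ul; apply/cvg_rnorm => e e0.
have c1 : 0 < c + 1 by rewrite ltr_wpDl.
have /ul : 0 < e / (c + 1) by rewrite divr_gt0.
apply: filterS => i; rewrite ltr_pdivlMr// => h.
rewrite -blinB; apply: le_lt_trans (hc _) (le_lt_trans _ h).
by rewrite mulrC ler_wpM2l ?rnorm_ge0// lerDl.
Qed.

End Blin.

(** The kernel of a nonzero functional has codimension one, so that the functional
    is a multiple of the product with any nonzero vector orthogonal to it. *)
Lemma riesz (f : K -> R[i]) :
  (forall a x y, f (a *: x + y) = a * f x + f y) ->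
  (exists c : R, forall x, cabs (f x) <= c * rnorm x) ->
  exists z, forall m, f m = inner m z.
Proof.
move=> lf [c hc].
have f0 : f 0 = 0.
  by have := lf (-1) 0 0; rewrite scaler0 addr0 mulN1r addNr.
have fZ a x : f (a *: x) = a * f x by rewrite -[_ *: x]addr0 lf f0 addr0.
have fD x y : f (x + y) = f x + f y by rewrite -[x]scale1r lf mul1r scale1r.
have fB x y : f (x - y) = f x - f y by rewrite fD -scaleN1r fZ mulN1r.
pose M := [set x | f x = 0].
have cM : closed_subspace M.
  split=> //; first by move=> a x y fx fy; rewrite /M /= lf fx fy mulr0 addr0.
  apply: seq_closed => u l Mu /cvg_seq ul; rewrite /M /=.
  suff : cabs (f l) <= 0.
    rewrite -lecR -cabsE => h; apply/eqP; rewrite -normr_eq0.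
    by rewrite eq_le h normr_ge0.
  apply/ler_addgt0Pr => e e0; rewrite add0r.
  have c1 : 0 < `|c| + 1 by rewrite ltr_wpDl.
  have /ul [N /(_ N (leqnn N))] : 0 < e / (`|c| + 1) by rewrite divr_gt0.
  rewrite ltr_pdivlMr// rnormC => h.
  have <- : f (l - u N) = f l by rewrite fB (Mu N) subr0.
  apply: le_trans (hc _) _.
  apply: le_trans (ltW h); rewrite mulrC ler_wpM2l ?rnorm_ge0//.
  by rewrite (le_trans (ler_norm _))// lerDl.
have [h0|] := pselect (forall x, f x = 0).
  by exists 0 => m; rewrite h0 inner0r.
move=> /existsNP [x0 /eqP fx0].
pose z := x0 - orthoproj M x0.
have zM m : f m = 0 -> inner m z = 0.
  by move=> fm; rewrite innerC (orthoproj_ortho cM) ?conj0.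
have fz : f z != 0 by rewrite fB (orthoproj_in cM x0) subr0.
have zz : inner z z != 0.
  by apply: contra fz => /eqP /inner_eq0 ->; rewrite f0.
exists (Num.conj (f z / inner z z) *: z) => m.
have : inner (m - (f m / f z) *: z) z = 0.
  by apply: zM; rewrite fB fZ divfK// subrr.
rewrite innerBl innerZl => /eqP; rewrite subr_eq0 => /eqP h.
rewrite innerZr conjCK h.
by field; rewrite zz fz.
Qed.

Lemma adj_exists T y : blin T -> exists x, forall m, inner (T m) y = inner m x.
Proof.
move=> bT; apply: (riesz (f := fun m => inner (T m) y)).
  by move=> a u v; rewrite blinD// blinZ// innerDl innerZl.
have [_ [c [c0 hc]]] := bT; exists (c * rnorm y) => x.
by rewrite (le_trans (cauchy_schwarz _ _))// mulrAC ler_wpM2r// rnorm_ge0.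
Qed.

Lemma adjP T x y : blin T -> inner (T x) y = inner x (adj T y).
Proof.
move=> bT; have [z hz] := adj_exists y bT.
have [_ ->//] := @xgetPex _ 0 [set x | setT x /\ forall m, setT m -> inner (T m) y = inner m x]
  (ex_intro _ z (conj I (fun m _ => hz m))).
Qed.

Lemma adjPr T x y : blin T -> inner y (T x) = inner (adj T y) x.
Proof. by move=> bT; rewrite innerC adjP// -innerC. Qed.

Lemma adj_unique T T' : (forall x y, inner (T x) y = inner x (T' y)) ->
  adj T = T'.
Proof.
move=> h; apply/funext => y; rewrite /adj /adj_on.
have [_ hx] := @xgetPex _ 0 [set x | setT x /\ forall m, setT m -> inner (T m) y = inner m x]
  (ex_intro _ (T' y) (conj I (fun m _ => h m y))).
by apply: inner_ext => m; rewrite -hx// h.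
Qed.

Lemma adj_on_unique M T y z : closed_subspace M -> M z ->
  (forall m, M m -> inner (T m) y = inner m z) -> adj_on M T y = z.
Proof.
move=> cM Mz h; rewrite /adj_on.
have [Mx hx] := @xgetPex _ 0 [set x | M x /\ forall m, M m -> inner (T m) y = inner m x]
  (ex_intro _ z (conj Mz h)).
set x := xget _ _ in Mx hx *.
apply/eqP; rewrite -subr_eq0; apply/eqP/inner_eq0.
have Md : M (x - z) by exact: closed_subspaceB.
by rewrite innerBr -hx// h// subrr.
Qed.

(** Boundedness: apply the Cauchy-Schwarz inequality to
    [inner (T (adj T x)) x], which is the squared norm of [adj T x]. *)
Lemma blin_adj T : blin T -> blin (adj T).
Proof.
move=> bT; split.
  move=> a x y; apply: inner_ext => m.
  by rewrite innerDr innerZr -!adjP// innerDr innerZr.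
have [_ [c [c0 hc]]] := bT; exists c; split=> // x.
have [->|nz] := eqVneq (rnorm (adj T x)) 0; first by rewrite mulr_ge0 ?rnorm_ge0.
have pz : 0 < rnorm (adj T x) by rewrite lt0r nz rnorm_ge0.
rewrite -(ler_pM2r pz) -expr2 rnorm_sqr -adjP//.
apply: le_trans (ler_norm _) _; apply: le_trans (le_Re_cabs _) _.
apply: le_trans (cauchy_schwarz _ _) _.
by rewrite mulrAC ler_wpM2r ?rnorm_ge0.
Qed.

Lemma continuous_blin (T : {linear K -> K}) : continuous T -> blin T.
Proof.
move=> cT; split; first exact: linearP.
have : T x @[x --> (0 : K)] --> T 0 by exact: cT.
rewrite linear0 => /cvgrPdist_lt /(_ 1 ltr01) /nbhs_ballP [[d d']].
rewrite /= ltcE /= => /andP[/eqP -> d0] h.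
exists (2 / d); split; first by rewrite divr_ge0// ltW.
move=> x; have [/rnorm_eq0->|nz] := eqVneq (rnorm x) 0.
  by rewrite linear0 !rnorm0 mulr0.
have px : 0 < rnorm x by rewrite lt0r nz rnorm_ge0.
pose t : R := d / 2 / rnorm x.
have t0 : 0 < t by rewrite !divr_gt0.
have /h : ball (0 : K) (d%:C) (t%:C *: x).
  rewrite -ball_normE /ball_ /= sub0r normrN normE ltcR rnormZ cabsR gtr0_norm//.
  by rewrite /t divfK// ltr_pdivrMr// mulr_natr mulr2n ltrDl.
rewrite /= sub0r normrN normE ltcR linearZ rnormZ cabsR gtr0_norm// => ht.
have -> : 2 / d * rnorm x = t^-1.
  by rewrite /t !invfM !invrK; field; rewrite gt_eqF.
by rewrite -[t^-1]mulr1 -(ler_pdivrMl _ _ (_ : 0 < t^-1)) ?invr_gt0// invrK ltW.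
Qed.

End Projections.

(** * Structure of Brownian unitaries *)

Section BrownianUnitary.
Context {R : realType} {K : hilbertType R}.
Implicit Types (x y z d : K) (a b : R[i]) (M D : set K) (S T U : K -> K).

Lemma closureP M x :
  closure M x <-> forall e : R, 0 < e -> exists2 m, M m & rnorm (m - x) < e.
Proof.
split=> [cl e e0|h B /nbhs_ballP[[e e']]].
  have e0' : (0 : R[i]) < e%:C by rewrite ltcR.
  have [m [Mm]] := cl _ (nbhsx_ballx x _ e0').
  by rewrite -ball_normE /ball_ /= normE ltcR rnormC; exists m.
rewrite /= ltcE /= => /andP[/eqP -> e0] eB.
have [m Mm mx] := h _ e0; exists m; split=> //; apply: eB.
by rewrite -ball_normE /ball_ /= normE ltcR rnormC.
Qed.

Lemma closed_subspace_closure M :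
  M 0 -> (forall a x y, M x -> M y -> M (a *: x + y)) ->
  closed_subspace (closure M).
Proof.
move=> M0 lM; split; first exact: subset_closure.
  move=> a x y /closureP cx /closureP cy; apply/closureP => e e0.
  have c1 : 0 < cabs a + 1 by rewrite ltr_wpDl ?cabs_ge0.
  have [|m Mm hm] := cx (e / 2 / (cabs a + 1)); first by rewrite !divr_gt0.
  have [|n Mn hn] := cy (e / 2); first by rewrite divr_gt0.
  exists (a *: m + n); first exact: lM.
  rewrite opprD addrACA -scalerBr; apply: le_lt_trans (rnormD _ _) _.
  rewrite rnormZ [e]splitr ltr_leD// 2?ltW//.
  rewrite ltr_pdivlMr// mulrDr mulr1 in hm.
  by apply: le_lt_trans hm; rewrite mulrC lerDl rnorm_ge0.
exact: closed_closure.
Qed.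

Lemma closed_subspace_null T : blin T -> closed_subspace (nullspace T).
Proof.
move=> bT; split; first by rewrite /nullspace /= blin0.
  by move=> a x y; rewrite /nullspace /= => hx hy; rewrite blinD// blinZ// hx hy scaler0 addr0.
apply: seq_closed => u l hu ul; rewrite /nullspace /=.
apply: (cvg_uniqK (blin_cvg bT ul)).
by under eq_fun do rewrite hu; exact: cvg_cst.
Qed.

(** The hyperplane is the kernel of a bounded operator of rank one. *)
Lemma closed_subspace_ortho x : closed_subspace [set y | inner y x = 0].
Proof.
have -> : [set y | inner y x = 0] = nullspace (fun y => inner y x *: x).
  apply/seteqP; split=> y; rewrite /nullspace /=; first by move=> ->; rewrite scale0r.
  by move/eqP; rewrite scaler_eq0 => /orP[/eqP//|/eqP ->]; rewrite inner0r.
apply: closed_subspace_null; split.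
  by move=> a y z; rewrite innerDl innerZl scalerDl scalerA.
exists (rnorm x ^+ 2); split; first exact: sqr_ge0.
move=> y; rewrite rnormZ expr2 mulrAC ler_wpM2r ?rnorm_ge0//.
by rewrite (le_trans (cauchy_schwarz _ _))// mulrC.
Qed.

(** Polarization. *)
Lemma isometry_inner M T x y : closed_subspace M -> isometry_on M T ->
  M x -> M y -> inner (T x) (T y) = inner x y.
Proof.
move=> cM [lT nT].
have ReT u v : M u -> M v -> complex.Re (inner (T u) (T v)) = complex.Re (inner u v).
  move=> Mu Mv; have := nT _ (closed_subspaceD cM Mu Mv).
  have -> : T (u + v) = T u + T v by rewrite -[u]scale1r lT// !scale1r.
  move=> /(congr1 (fun r => r ^+ 2)); rewrite !rnormD_sqr !nT//; lra.
move=> Mx My; have hr := ReT _ _ Mx My.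
have Mix : M ('i *: x) by exact: closed_subspaceZ.
have := ReT _ _ Mix My.
have -> : T ('i *: x) = 'i *: T x.
  rewrite -[_ *: x]addr0 lT//; last by case: cM.
  have M0 : M 0 by case: cM.
  have := lT 1 _ _ M0 M0; rewrite scaler0 addr0 scale1r => /eqP.
  by rewrite -subr_eq subrr => /eqP <-; rewrite addr0.
rewrite !innerZl; move: hr; case: (inner _ _) => p q; case: (inner _ _) => r s /=.
by rewrite !mul0r !mul1r !sub0r => -> /oppr_inj ->.
Qed.

(** What is used of a Brownian unitary with defect space [D] and covariance
    [delta]: relative to the complement of [D] and [D], the operator is the block
    matrix with rows [V, delta E0] and [0, U], with [U] unitary. The inverse of [U]
    is the restriction of the adjoint to [D], and [bd_ker] expresses that the range
    of [E0] is the whole kernel of the adjoint of [V]. *)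
Record brownian_data S D (delta : R) : Prop := BrownianData {
  bd_lin : blin S;
  bd_sub : closed_subspace D;
  bd_pos : 0 < delta;
  bd_gram : forall x, adj S (S x) = x + (delta ^+ 2)%:C *: orthoproj D x;
  bd_adj : forall d, D d -> D (adj S d);
  bd_adjK : forall d, D d -> orthoproj D (S (adj S d)) = d;
  bd_projK : forall d, D d -> adj S (orthoproj D (S d)) = d;
  bd_proj : forall x, orthoproj D (S x) = orthoproj D (S (orthoproj D x));
  bd_ker : forall x, orthoproj D x = 0 -> adj S x = 0 -> x = 0 }.

Section Brownian.
Variables S U : K -> K.
Hypothesis bS : blin S.
Hypothesis S_brownian : brownian_unitary S.

Let N := nullspace (Delta S).
Let D := closure (range (Delta S)).
Let delta := cov S.

Lemma blin_Delta : blin (Delta S).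
Proof. exact: (blin_sub (blin_comp (blin_adj bS) bS) blin_id). Qed.

Lemma Delta_sym x y : inner (Delta S x) y = inner x (Delta S y).
Proof.
by rewrite /Delta innerBl innerBr -adjP// -adjPr.
Qed.

Let cN : closed_subspace N.
Proof. exact: closed_subspace_null blin_Delta. Qed.

Let cD : closed_subspace D.
Proof.
apply: closed_subspace_closure; first by exists 0 => //; rewrite blin0//; exact: blin_Delta.
move=> a _ _ [x _ <-] [y _ <-]; exists (a *: x + y) => //.
by rewrite blinD ?blinZ//; exact: blin_Delta.
Qed.

Lemma null_ortho x d : N x -> D d -> inner x d = 0.
Proof.
move=> Nx Dd; rewrite innerC.
have [_ _ cH] := closed_subspace_ortho x.
have -> : inner d x = 0; last exact: conj0.
move: Dd; rewrite /D closureE => /(_ [set y | inner y x = 0]); apply; split => //.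
move=> _ [y _ <-].
by rewrite /= Delta_sym (_ : Delta S x = 0) ?inner0r.
Qed.

Lemma ortho_null x : (forall d, D d -> inner x d = 0) -> N x.
Proof.
move=> h; apply: inner_ext => m; rewrite inner0r -Delta_sym innerC h ?conj0//.
by rewrite /D; apply: subset_closure; exists m.
Qed.

Lemma proj_null x : orthoproj N x = x - orthoproj D x.
Proof.
apply: (orthoproj_unique cN).
  by apply: ortho_null => d Dd; rewrite (orthoproj_ortho cD).
move=> m Nm; rewrite innerBl [inner (orthoproj _ _) _]innerC (@null_ortho m) ?conj0 ?subr0//.
exact: (orthoproj_in cD).
Qed.

(** On [D] the operator splits orthogonally into [delta] times an isometry and a
    unitary, so that its Gram operator is [1 + delta^2] there. *)
Lemma Delta_scalar x : Delta S x = (delta ^+ 2)%:C *: orthoproj D x.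
Proof.
have [_ [E0 [iE _ hE [iY _]]]] := S_brownian.
have onD d : D d -> Delta S d = (delta ^+ 2)%:C *: d.
  move=> Dd; have DD y : D (Delta S y) by rewrite /D; apply: subset_closure; exists y.
  suff h m : D m -> inner (Delta S d - (delta ^+ 2)%:C *: d) m = 0.
    apply/eqP; rewrite -subr_eq0; apply/eqP/inner_eq0; apply: h.
    by apply: (closed_subspaceB cD); [rewrite /D; apply: subset_closure; exists d | exact: (closed_subspaceZ _ cD)].
  move=> Dm; rewrite innerBl innerZl /Delta innerBl -adjPr//.
  have split y : D y -> S y = delta%:C *: E0 y + orthoproj D (S y).
    by move=> Dy; rewrite -hE// proj_null subrK.
  have NE y : D y -> N (delta%:C *: E0 y) by move=> Dy; rewrite -hE//; exact: (orthoproj_in cN).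
  rewrite (split d Dd) (split m Dm).
  rewrite innerDl !innerDr [inner (orthoproj D _) (_ *: _)]innerC.
  rewrite !(null_ortho (NE _ _) (orthoproj_in cD _))// conj0 addr0 add0r.
  rewrite innerZl innerZr (isometry_inner cD iE)// (isometry_inner cD iY)//.
  by rewrite addrK mulrA conjR -rmorphM -expr2 subrr.
have Px : D (orthoproj D x) by exact: (orthoproj_in cD).
rewrite -onD//; apply/eqP; rewrite -subr_eq0 -blinB//; last exact: blin_Delta.
by rewrite -proj_null; apply/eqP; exact: (orthoproj_in cN).
Qed.

Lemma gram x : adj S (S x) = x + (delta ^+ 2)%:C *: orthoproj D x.
Proof. by rewrite -Delta_scalar /Delta subrKC. Qed.

Lemma brownian_ker x : orthoproj D x = 0 -> adj S x = 0 -> delta = 0 \/ x = 0.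
Proof.
have [_ [E0 [iE rE hE _]]] := S_brownian.
move=> Px Sx; have Nx : N x.
  apply: ortho_null => d Dd; rewrite -(orthoproj_inner cD _ Dd) Px inner0l//.
have [d Dd dx] : (E0 @` D) x.
  rewrite rE; split=> //; apply: (adj_on_unique cN); first by case: cN.
  by move=> m _; rewrite adjP// Sx.
have [->|d0] := eqVneq delta 0; [by left|right].
apply: inner_eq0; rewrite -{1}dx.
have : inner (S d) x = 0 by rewrite adjP// Sx inner0r.
have -> : S d = delta%:C *: E0 d + orthoproj D (S d).
  by rewrite -hE// proj_null subrK.
rewrite innerDl [inner (orthoproj D _) _]innerC (@null_ortho x)//; last exact: (orthoproj_in cD).
rewrite conj0 addr0 innerZl => /eqP; rewrite mulf_eq0 => /orP[|/eqP//].
by move=> /eqP /complexI /eqP; rewrite (negPf d0).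
Qed.

(** With zero covariance the operator is an isometry without defect space, whose
    corner [E0] then leaves no kernel to the adjoint: it is a unitary operator, and
    the ranges of its powers are the whole space. *)
Lemma brownian_trivial : analytic_operator S -> delta = 0 -> forall x, x = 0.
Proof.
move=> aS d0; have gr x : adj S (S x) = x by rewrite gram d0 expr0n scale0r addr0.
have Pz x : orthoproj D x = 0.
  apply: inner_eq0; rewrite (orthoproj_inner cD _ (orthoproj_in cD _)).
  have : Delta S x = 0 by rewrite Delta_scalar d0 expr0n scale0r.
  by move=> Nx; apply: null_ortho => //; exact: (orthoproj_in cD).
have [_ [E0 [[lE nE] rE hE _]]] := S_brownian.
have ker x : adj S x = 0 -> x = 0.
  move=> Sx.
  have [d Dd <-] : (E0 @` D) x.
    rewrite rE; split; first by rewrite /N /nullspace /= Delta_scalar Pz scaler0.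
    apply: (adj_on_unique cN); first by case: cN.
    by move=> m _; rewrite adjP// Sx.
  by apply: rnorm_eq0; rewrite nE// -(orthoproj_id cD Dd) Pz rnorm0.
have SK x : S (adj S x) = x.
  apply/eqP; rewrite -subr_eq0; apply/eqP/ker.
  by rewrite blinB ?gr ?subrr//; exact: blin_adj.
move=> x; suff : (\bigcap_(n in [set n | (1 <= n)%N]) range (iter n S)) x by rewrite aS.
move=> n _; exists (iter n (adj S) x) => //.
by elim: n => // n ih; rewrite iterSr [iter n.+1 (adj S) x]/= SK.
Qed.

Hypothesis delta_gt0 : 0 < delta.

(** [Delta S] is a nonzero multiple of a projection. *)
Lemma range_Delta : range (Delta S) = D.
Proof.
apply/seteqP; split; first exact: subset_closure.
move=> x Dx; exists ((delta ^- 2)%:C *: x) => //.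
rewrite Delta_scalar blinZ ?(orthoproj_id cD)//; last exact: blin_proj.
by rewrite scalerA -rmorphM /= mulfV ?scale1r// expf_neq0// gt_eqF.
Qed.

Hypothesis U_unitary : unitary_on (range (Delta S)) U.
Hypothesis U_adj : forall d, range (Delta S) d ->
  adj_on (range (Delta S)) U d = adj S d.

Let iU : isometry_on D U. Proof. by rewrite -range_Delta; case: U_unitary. Qed.
Let rU : U @` D = D. Proof. by rewrite -range_Delta; case: U_unitary. Qed.

Lemma adj_U d : D d -> adj S (U d) = d.
Proof.
move=> Dd; have DU : D (U d) by rewrite -rU; exists d.
rewrite -U_adj range_Delta//; apply: (adj_on_unique cD) => // m Dm.
exact: (isometry_inner cD iU).
Qed.

Lemma U_proj d : D d -> U d = orthoproj D (S d).
Proof.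
move=> Dd; apply/esym/(orthoproj_unique cD); first by rewrite -rU; exists d.
move=> m; rewrite -{1}rU => -[e De <-].
by rewrite (isometry_inner cD iU)// adjP// adj_U.
Qed.

Lemma brownian_dataP : brownian_data S D delta.
Proof.
have adjD d : D d -> D (adj S d) by rewrite -{1}rU => -[e De <-]; rewrite adj_U.
split=> //.
- exact: gram.
- by move=> d; rewrite -{1}rU => -[e De <-]; rewrite adj_U// U_proj.
- by move=> d Dd; rewrite -U_proj// adj_U.
- move=> x; apply/eqP; rewrite -subr_eq0 -blinB; last exact: blin_proj.
  rewrite -blinB// -proj_null; apply/eqP/(orthoproj_eq0 cD) => d Dd.
  by rewrite adjP// null_ortho//; [exact: (orthoproj_in cN) | exact: adjD].
by move=> x Px Sx; case: (brownian_ker Px Sx) => // d0; move: delta_gt0; rewrite d0 ltxx.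
Qed.

End Brownian.
End BrownianUnitary.

(** * Square-summable sequences *)

Section SquareSummable.
Context {R : realType}.
Implicit Types (f : nat -> R).

Lemma nneg_series_cvg f (C : R) : (forall n, 0 <= f n) ->
  (forall N, \sum_(0 <= i < N) f i <= C) ->
  exists l : R, (series f @ \oo --> l) /\ forall N, \sum_(0 <= i < N) f i <= l.
Proof.
move=> f0 fC.
have nd : nondecreasing_seq (series f).
  by apply/nondecreasing_seqP => n; rewrite /series /= big_nat_recr//= lerDl.
have ub : has_ubound (range (series f)) by exists C => _ [n _ <-]; exact: fC.
exists (limn (series f)); split; first exact: nondecreasing_is_cvgn.
move=> N; apply: (@nondecreasing_cvgn_le _ (series f)) => //.
exact: nondecreasing_is_cvgn.
Qed.

Lemma nneg_series_tail f (C : R) : (forall n, 0 <= f n) ->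
  (forall N, \sum_(0 <= i < N) f i <= C) ->
  forall e : R, 0 < e -> exists M, forall N, \sum_(M <= i < N) f i < e.
Proof.
move=> f0 fC e e0; have [l [/cvg_seqR fl le]] := nneg_series_cvg f0 fC.
have [M /(_ M (leqnn M)) hM] := fl _ e0; exists M => N.
have [MN|NM] := leqP M N; last by rewrite big_geq// ltnW.
have := le N; rewrite (big_cat_nat (leq0n M) MN)/=; move: hM.
rewrite /series /= distrC ger0_norm ?subr_ge0 ?le//. lra.
Qed.

(** The weights [q] make it possible to trade the decay of the [a i] against their
    number. *)
Lemma weighted_cauchy_schwarz (I : Type) (r : seq I) (a q : I -> R) :
  (forall i, 0 <= a i) -> (forall i, 0 < q i) ->
  (\sum_(i <- r) a i) ^+ 2 <= (\sum_(i <- r) a i ^+ 2 / q i) * \sum_(i <- r) q i.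
Proof.
move=> a0 q0; elim: r => [|i r ih]; first by rewrite !big_nil expr0n mul0r.
rewrite !big_cons.
have sa0 : 0 <= \sum_(i <- r) a i by exact: sumr_ge0.
have sq0 : 0 <= \sum_(i <- r) q i by apply: sumr_ge0 => j _; exact: ltW.
have st0 : 0 <= \sum_(i <- r) a i ^+ 2 / q i.
  by apply: sumr_ge0 => j _; rewrite divr_ge0 ?sqr_ge0// ltW.
move: ih sa0 sq0 st0 (a0 i) (q0 i).
move: (\sum_(i <- r) a i) (\sum_(i <- r) q i) (\sum_(i <- r) a i ^+ 2 / q i) (a i) (q i).
move=> A Q T p w ATQ A0 Q0 T0 p0 w0.
have -> : (p ^+ 2 / w + T) * (w + Q) = p ^+ 2 + (p ^+ 2 * Q / w + T * w) + T * Q.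
  by field; rewrite gt_eqF.
suff : 2 * p * A <= p ^+ 2 * Q / w + T * w.
  move: (p ^+ 2 * Q / w + T * w) => t h.
  have -> : (p + A) ^+ 2 = p ^+ 2 + 2 * p * A + A ^+ 2 by ring.
  by rewrite lerD// lerD2l.
have g1 : 0 <= 2 * p * A by rewrite !mulr_ge0.
have g2 : 0 <= p ^+ 2 * Q / w + T * w.
  by rewrite addr_ge0 ?mulr_ge0 ?sqr_ge0 ?invr_ge0 ?(ltW w0).
rewrite -(ler_pXn2r (ltn0Sn 1)) ?nnegrE//.
apply: (@le_trans _ _ (4 * (p ^+ 2 * Q / w) * (T * w))).
  have -> : 4 * (p ^+ 2 * Q / w) * (T * w) = 4 * p ^+ 2 * (T * Q).
    by field; rewrite gt_eqF.
  by rewrite !exprMn -natrX ler_wpM2l// mulr_ge0 ?sqr_ge0.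
move: (p ^+ 2 * Q / w) (T * w) => u v; rewrite -subr_ge0.
have -> : (u + v) ^+ 2 - 4 * u * v = (u - v) ^+ 2 by ring.
exact: sqr_ge0.
Qed.

(** The sum telescopes. *)
Lemma sum_inv_consecutive m n : (m <= n)%N ->
  \sum_(m <= j < n) (j.+1%:R * j.+2%:R)^-1 <= m.+1%:R^-1 :> R.
Proof.
move=> mn; suff -> : \sum_(m <= j < n) (j.+1%:R * j.+2%:R)^-1 = m.+1%:R^-1 - n.+1%:R^-1 :> R.
  by rewrite gerBl invr_ge0.
elim: n mn => [|n ih]; first by rewrite leqn0 => /eqP ->; rewrite big_geq// subrr.
rewrite leq_eqVlt => /orP[/eqP ->|]; first by rewrite big_geq// subrr.
rewrite ltnS => mn; rewrite big_nat_recr//= ih//.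
rewrite -[n.+2%:R]natr1; move: (m.+1%:R^-1 : R) => p.
have : 0 < n.+1%:R :> R by rewrite ltr0n.
move: (n.+1%:R : R) => a a0; field.
by rewrite !gt_eqF// addr_gt0.
Qed.

Context {K : hilbertType R}.
Implicit Types (y : nat -> K) (v : K).

Lemma rnorm_lim_le (u : nat -> K) (l x : K) (c : R) N :
  (forall n, (N <= n)%N -> rnorm (x - u n) <= c) -> u @ \oo --> l ->
  rnorm (x - l) <= c.
Proof.
move=> h /cvg_seq ul; suff H (e : R) : 0 < e -> rnorm (x - l) <= c + e.
  by apply/ler_addgt0Pr => e; exact: H.
move=> e0; have [M hM] := ul _ e0.
have := hM _ (leq_maxr N M); have := h _ (leq_maxl N M).
have := rnormD (x - u (maxn N M)) (u (maxn N M) - l); rewrite addrA subrK; lra.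
Qed.

Lemma variance_step (s y : K) (n : nat) : (0 < n)%N ->
  rnorm s ^+ 2 / n%:R + rnorm y ^+ 2 =
  rnorm (s + y) ^+ 2 / n.+1%:R + rnorm (s - n%:R *: y) ^+ 2 / (n%:R * n.+1%:R).
Proof.
move=> n0; rewrite rnormD_sqr rnormB_sqr rnormZ innerZr conj_nat ReZ_nat cabs_nat.
rewrite -[n.+1%:R]natr1; have : 0 < n%:R :> R by rewrite ltr0n.
move: (n%:R : R) => a a0; field.
by rewrite !gt_eqF// addr_gt0.
Qed.

(** The variance of a growing sample, updated one term at a time: each new term
    contributes to the mean and to its deviation from the mean of the earlier
    ones. *)
Lemma variance_telescope y N :
  \sum_(0 <= m < N.+1) rnorm (y m) ^+ 2 =
  rnorm (\sum_(0 <= m < N.+1) y m) ^+ 2 / N.+1%:R +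
  \sum_(0 <= n < N) rnorm (\sum_(0 <= m < n.+1) y m - n.+1%:R *: y n.+1) ^+ 2
    / (n.+1%:R * n.+2%:R).
Proof.
elim: N => [|N ih]; first by rewrite !big_nat1 big_geq// divr1 addr0.
rewrite big_nat_recr//= ih [in RHS]big_nat_recr//=.
rewrite [X in _ = _ + X]big_nat_recr//= addrAC variance_step//.
by rewrite addrAC !addrA.
Qed.

Lemma rnorm_sum_sqr (m n : nat) (w : nat -> K) (q : nat -> R) :
  (forall i, 0 < q i) ->
  rnorm (\sum_(m <= i < n) w i) ^+ 2 <=
  (\sum_(m <= i < n) rnorm (w i) ^+ 2 / q i) * \sum_(m <= i < n) q i.
Proof.
move=> q0; apply: le_trans (weighted_cauchy_schwarz _ _ q0); last by move=> i; exact: rnorm_ge0.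
by rewrite ler_pXn2r ?nnegrE ?rnorm_ge0 ?rnorm_sum// sumr_ge0// => i _; exact: rnorm_ge0.
Qed.

(** Fix a head of the sequence that carries all but a small part of the sum of
    squares: the head contributes [O(1/N)], and the tail at most its sum of squares,
    by the Cauchy-Schwarz inequality. *)
Lemma mean_cvg0 y (C : R) : (forall N, \sum_(0 <= m < N) rnorm (y m) ^+ 2 <= C) ->
  (fun N => rnorm (\sum_(0 <= m < N.+1) y m) ^+ 2 / N.+1%:R) @ \oo --> (0 : R).
Proof.
move=> hC; apply/cvg_seqR => e e0.
have e4 : 0 < e / 4 by rewrite divr_gt0.
have [M hM] := nneg_series_tail (fun n => sqr_ge0 (rnorm (y n))) hC e4.
pose c := 2 * rnorm (\sum_(0 <= m < M) y m) ^+ 2.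
have c0 : 0 <= c by rewrite mulr_ge0 ?sqr_ge0.
pose N0 := Num.trunc (c / (e / 2)).
exists (maxn M N0) => N; rewrite geq_max => /andP[MN N0N].
rewrite subr0 ger0_norm ?divr_ge0 ?sqr_ge0//.
rewrite ltr_pdivrMr ?ltr0n// (big_cat_nat (leq0n M) (leqW MN))/=.
have h1 : c < e / 2 * N.+1%:R.
  rewrite mulrC -ltr_pdivrMr ?divr_gt0//; apply: (lt_le_trans (truncnS_gt _)).
  by rewrite ler_nat ltnS.
have h2 : rnorm (\sum_(M <= i < N.+1) y i) ^+ 2 <= e / 4 * N.+1%:R.
  apply: le_trans (rnorm_sum_sqr _ _ _ (fun=> ltr01)) _.
  under eq_bigr do rewrite divr1.
  rewrite sumr_const_nat; apply: ler_pM.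
  - by apply: sumr_ge0 => i _; exact: sqr_ge0.
  - exact: ler0n.
  - exact/ltW/hM.
  by rewrite ler_nat leq_subr.
have := parallelogram (\sum_(0 <= m < M) y m) (\sum_(M <= i < N.+1) y i).
have := sqr_ge0 (rnorm (\sum_(0 <= m < M) y m - \sum_(M <= i < N.+1) y i)).
rewrite -/c; lra.
Qed.

(** The deviations from the running means do not see constants, and control the
    sequence up to one. The running means [A n] satisfy
    [norm (A m - A n) ^ 2 <= C / (m + 1)], and [v] is their limit; for the sequence
    shifted by [v], the term of the mean in [variance_telescope] stays below [C]. *)
Lemma deviation_summable M y (C : R) : closed_subspace M -> (forall n, M (y n)) ->
  (forall N, \sum_(0 <= n < N)
     rnorm (\sum_(0 <= m < n.+1) y m - n.+1%:R *: y n.+1) ^+ 2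
       / (n.+1%:R * n.+2%:R) <= C) ->
  exists2 v, M v & forall N, \sum_(0 <= m < N) rnorm (y m - v) ^+ 2 <= C + C.
Proof.
move=> cM My hC.
have C0 : 0 <= C by have := hC 0%N; rewrite big_geq.
pose s n : K := \sum_(0 <= m < n.+1) y m.
pose u n := s n - n.+1%:R *: y n.+1.
pose A n : K := n.+1%:R^-1 *: s n.
pose w n : K := A n.+1 - A n.
have sE n : s n = n.+1%:R *: A n.
  by rewrite /A scalerA mulfV ?scale1r// pnatr_eq0.
have uE n : u n = - ((n.+1 * n.+2)%:R *: w n).
  have yE : y n.+1 = n.+2%:R *: A n.+1 - n.+1%:R *: A n.
    by rewrite -!sE /s [X in _ = X - _]big_nat_recr//= addrAC subrr add0r.
  rewrite /u /w yE sE; move: (A n) (A n.+1) => p q.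
  rewrite !scalerBr !scalerA -!natrM !opprB addrA; congr (_ - _).
  by rewrite -scalerDl -natrD -(mulnS n.+1 n.+1).
have wE n : rnorm (w n) ^+ 2 / (n.+1%:R * n.+2%:R)^-1 = rnorm (u n) ^+ 2 / (n.+1%:R * n.+2%:R).
  rewrite uE rnormN rnormZ cabs_nat natrM invrK exprMn.
  have : 0 < n.+1%:R :> R by rewrite ltr0n.
  have : 0 < n.+2%:R :> R by rewrite ltr0n.
  move: (n.+1%:R : R) (n.+2%:R : R) => a b b0 a0; field.
  by rewrite !gt_eqF.
have hw m n : (m <= n)%N -> rnorm (A m - A n) ^+ 2 <= C / m.+1%:R.
  move=> mn; have -> : A m - A n = - \sum_(m <= i < n) w i.
    by rewrite /w telescope_sumr// opprB.
  rewrite rnormN.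
  apply: le_trans (rnorm_sum_sqr _ _ _ (_ : forall i, 0 < (i.+1%:R * i.+2%:R)^-1)) _.
    by move=> i; rewrite invr_gt0 mulr_gt0.
  have h1 := sum_inv_consecutive mn.
  apply: ler_pM => //.
  - by apply: sumr_ge0 => i _; rewrite divr_ge0 ?sqr_ge0// invr_ge0 mulr_ge0.
  - by apply: sumr_ge0 => i _; rewrite invr_ge0 mulr_ge0.
  under eq_bigr do rewrite wE.
  have := hC n; rewrite (big_cat_nat (leq0n m) mn)/=; apply: le_trans.
  by rewrite lerDr; apply: sumr_ge0 => i _; rewrite divr_ge0 ?sqr_ge0 ?mulr_ge0.
have [v Av] : exists v : K, A @ \oo --> v.
  apply: cauchy_cvg_seq => e e0.
  have e2 : 0 < (e / 2) ^+ 2 by rewrite exprn_gt0 ?divr_gt0.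
  pose N := Num.trunc (C / (e / 2) ^+ 2).
  have small m : (N <= m)%N -> rnorm (A N - A m) < e / 2.
    move=> Nm; rewrite -(ltr_pXn2r (ltn0Sn 1)) ?nnegrE ?rnorm_ge0 ?divr_ge0 ?(ltW e0)//.
    apply: le_lt_trans (hw _ _ Nm) _.
    by rewrite ltr_pdivrMr ?ltr0n// mulrC -ltr_pdivrMr//; exact: truncnS_gt.
  exists N => m n hm hn.
  have := rnormD (A m - A N) (A N - A n); rewrite addrA subrK [rnorm (A m - A N)]rnormC.
  have := small _ hm; have := small _ hn; lra.
have Mv : M v.
  have [_ _ clM] := cM; apply: (closed_seq clM _ Av) => n.
  by apply: (closed_subspaceZ _ cM); apply: closed_subspace_sum.
have hv m : rnorm (A m - v) ^+ 2 <= C / m.+1%:R.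
  have c0 : 0 <= C / m.+1%:R by rewrite divr_ge0.
  rewrite -(sqr_sqrtr c0) ler_pXn2r ?nnegrE ?rnorm_ge0 ?sqrtr_ge0//.
  apply: (rnorm_lim_le (N := m) _ Av) => n mn.
  rewrite -(ler_pXn2r (ltn0Sn 1)) ?nnegrE ?rnorm_ge0 ?sqrtr_ge0// sqr_sqrtr//.
  exact: hw.
exists v => // -[|N]; first by rewrite big_geq// addr_ge0.
have sv n : \sum_(0 <= m < n.+1) (y m - v) = s n - n.+1%:R *: v.
  by rewrite sumrB sumr_const_nat subn0 scaler_nat.
rewrite (variance_telescope (fun m => y m - v)) sv sE -scalerBr rnormZ cabs_nat exprMn.
apply: lerD.
  have N0 : 0 < N.+1%:R :> R by rewrite ltr0n.
  have := hv N; rewrite ler_pdivlMr//; apply: le_trans.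
  rewrite le_eqVlt; apply/orP; left; apply/eqP; move: (N.+1%:R : R) N0 => a a0.
  by field; rewrite gt_eqF.
apply: le_trans (hC N); rewrite le_eqVlt; apply/orP; left; apply/eqP.
apply: eq_bigr => n _; congr (rnorm _ ^+ 2 / _).
by rewrite sv scalerBr opprB addrA subrK.
Qed.

End SquareSummable.

(** * Taylor coefficients and the norm *)

Section Model.
Context {R : realType} {K : hilbertType R}.
Variables (S : K -> K) (D : set K) (delta : R).
Hypothesis B : brownian_data S D delta.
Implicit Types (x y z d k a b : K).

Let P := orthoproj D.
Let E := nullspace (adj S).
Let bS : blin S := bd_lin B.
Let cD : closed_subspace D := bd_sub B.
Let d0 : 0 < delta := bd_pos B.
Let bA : blin (adj S) := blin_adj bS.
Let bP : blin P := blin_proj cD.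
Let cE : closed_subspace E := closed_subspace_null bA.
Let PD x : D (P x) := orthoproj_in cD x.

Definition compression x : K := orthoproj D (S x).
Let A := compression.

Lemma blin_compression : blin A.
Proof. exact: blin_comp. Qed.

Let bC : blin A := blin_compression.

Lemma compression_in x : D (A x). Proof. exact: PD. Qed.

Lemma compression_proj x : P (S x) = A (P x).
Proof. exact: bd_proj B x. Qed.

Lemma iter_compression_in n x : D x -> D (iter n A x).
Proof. by case: n => //= n _; exact: compression_in. Qed.

Lemma compression_iso d : D d -> rnorm (A d) = rnorm d.
Proof.
move=> Dd; apply/eqP; rewrite -(eqrXn2 (ltn0Sn 1)) ?rnorm_ge0//; apply/eqP.
rewrite !rnorm_sqr; congr complex.Re.
rewrite {1}/A /compression orthoproj_inner//; last exact: compression_in.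
by rewrite adjP// (bd_projK B).
Qed.

Lemma iter_compression_iso n d : D d -> rnorm (iter n A d) = rnorm d.
Proof.
move=> Dd; elim: n => //= n ih; rewrite compression_iso//.
exact: iter_compression_in.
Qed.

Lemma iter_adj_compression n d : D d -> iter n (adj S) (iter n A d) = d.
Proof.
move=> Dd; elim: n => // n ih; rewrite iterSr iterS {1}/A /compression (bd_projK B)//.
exact: iter_compression_in.
Qed.

Lemma iter_compression_adj n d : D d -> iter n A (iter n (adj S) d) = d.
Proof.
move=> Dd; elim: n => // n ih; rewrite iterSr [iter n.+1 (adj S) d]iterS.
rewrite {2}/A /compression (bd_adjK B)//.
by elim: n {ih} => //= n; exact: (bd_adj B).
Qed.

Lemma rnorm_S x : rnorm (S x) ^+ 2 = rnorm x ^+ 2 + delta ^+ 2 * rnorm (P x) ^+ 2.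
Proof.
rewrite !rnorm_sqr adjP// (bd_gram B) innerDr ReD innerZr conjR ReZ.
by rewrite (orthoproj_inner cD x (PD x)).
Qed.

(** The squared cosine of the angle between [D] and the kernel of the adjoint. *)
Definition ratio : R := delta ^+ 2 / (1 + delta ^+ 2).
Let c := ratio.
Let r : R := 1 + delta ^- 2.

Let cr : c * r = 1.
Proof.
rewrite /c /ratio /r; have := exprn_gt0 2 d0; move: (delta ^+ 2) => e e0; field.
by rewrite !gt_eqF// addr_gt0.
Qed.

Let c_delta : c * (1 + delta ^+ 2) = delta ^+ 2.
Proof. by rewrite /c /ratio divfK// gt_eqF// addr_gt0// exprn_gt0. Qed.

(** The kernel of the adjoint is a graph over the defect space, and this is the map
    from [D] to the graph: the component of [graph_map d] outside [D] is the one
    which [adj S] sends to [- adj S d]. *)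
Definition graph_map d : K := r%:C *: d - (delta ^- 2)%:C *: S (adj S d).
Let J := graph_map.

Lemma graph_map_ker d : D d -> E (J d).
Proof.
move=> Dd; rewrite /E /nullspace /= /J /graph_map (blinB bA) !(blinZ bA) (bd_gram B).
rewrite (orthoproj_id cD (bd_adj B Dd)) -[X in _ *: (X + _)]scale1r -scalerDl scalerA.
have -> : 1 + (delta ^+ 2)%:C = (1 + delta ^+ 2)%:C by rewrite rmorphD rmorph1.
rewrite -scalerBl -rmorphM -rmorphB /=.
have -> : r - delta ^- 2 * (1 + delta ^+ 2) = 0.
  by rewrite /r; field; rewrite gt_eqF.
by rewrite scale0r.
Qed.

Lemma proj_graph_map d : D d -> P (J d) = d.
Proof.
move=> Dd; rewrite /J /graph_map (blinB bP) !(blinZ bP) [P (S _)](bd_adjK B Dd) [P d](orthoproj_id cD Dd).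
by rewrite -scalerBl -rmorphB /= /r addrK scale1r.
Qed.

Lemma graph_map_proj a : E a -> J (P a) = a.
Proof.
move=> Ea; apply/eqP; rewrite -subr_eq0; apply/eqP/(bd_ker B).
  by rewrite [orthoproj D _](blinB bP) proj_graph_map// subrr.
by rewrite (blinB bA) Ea (graph_map_ker (PD a)) subrr.
Qed.

Lemma inner_graph_map d a : E a -> inner (J d) a = r%:C * inner d a.
Proof.
move=> Ea; rewrite /J /graph_map innerBl !innerZl [inner (S _) a]adjP//.
by rewrite (_ : adj S a = 0)// inner0r mulr0 subr0.
Qed.

Lemma blin_graph_map : blin J.
Proof.
apply: blin_sub; first exact: blin_scale blin_id.
by apply: blin_scale; exact: blin_comp.
Qed.

Lemma proj_ker d : D d -> orthoproj E d = c%:C *: J d.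
Proof.
move=> Dd; apply: (orthoproj_unique cE).
  by apply: (closed_subspaceZ _ cE); exact: graph_map_ker.
by move=> a Ea; rewrite innerZl inner_graph_map// mulrA -rmorphM /= cr mul1r.
Qed.

Lemma ker_graph : E = [set J d | d in D].
Proof.
apply/seteqP; split=> [a Ea|_ [d Dd <-]]; last exact: graph_map_ker.
by exists (P a); [exact: PD | exact: graph_map_proj].
Qed.

(** The adjoint of the Cauchy dual ([adj_cauchy_dual]), a left inverse of [S] that
    annihilates the kernel of the adjoint. *)
Definition dual_adj y : K := adj S y - c%:C *: P (adj S y).
Let L := dual_adj.

Let Q x : K := x - c%:C *: P x.

Let bQ : blin Q.
Proof. by apply: blin_sub; [exact: blin_id | exact: blin_scale]. Qed.

Let QG x : Q (adj S (S x)) = x.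
Proof.
rewrite (bd_gram B) /Q (blinD bP) (blinZ bP) [P (orthoproj D x)](orthoproj_id cD)// -/P.
rewrite -[X in _ *: (X + _)]scale1r -scalerDl scalerA.
have -> : 1 + (delta ^+ 2)%:C = (1 + delta ^+ 2)%:C by rewrite rmorphD rmorph1.
by rewrite -rmorphM /= c_delta addrK.
Qed.

Let GQ x : adj S (S (Q x)) = x.
Proof.
rewrite (bd_gram B) -/P /Q (blinB bP) (blinZ bP) [P (P x)](orthoproj_id cD)//.
rewrite -[X in _ *: (X - _)]scale1r -scalerBl scalerA -addrA -scaleNr -scalerDl.
have -> : 1 - c%:C = (1 - c)%:C by rewrite rmorphB rmorph1.
rewrite -rmorphN -rmorphM -rmorphD /=.
have -> : - c + delta ^+ 2 * (1 - c) = 0.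
  by have := c_delta; lra.
by rewrite scale0r addr0.
Qed.

Let Qsym x y : inner (Q x) y = inner x (Q y).
Proof.
by rewrite /Q innerBl innerBr innerZl innerZr conjR [inner (P x) y](orthoproj_sym cD).
Qed.

Lemma cauchy_dualE : cauchy_dual S = S \o Q.
Proof.
apply/funext => x; rewrite /cauchy_dual /=; congr (S _).
set f := adj S \o S.
have f_inj : {in [set: K] &, injective f}.
  by move=> u v _ _ /(congr1 Q); rewrite /f /= !QG.
have {1}<- : f (Q x) = x by rewrite /f /= GQ.
by rewrite pinvKV//; apply/mem_set.
Qed.

Lemma adj_cauchy_dual : adj (cauchy_dual S) = L.
Proof.
rewrite cauchy_dualE; apply: adj_unique => x y.
by rewrite /= adjP// Qsym.
Qed.

Lemma blin_L : blin L.
Proof. exact: (blin_comp bQ bA). Qed.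

Lemma LS x : L (S x) = x.
Proof. exact: QG. Qed.

Lemma L_ker a : E a -> L a = 0.
Proof. by move=> Ea; rewrite /L /dual_adj (_ : adj S a = 0)// (blin0 bP) scaler0 subr0. Qed.

Lemma SL x : x - S (L x) = orthoproj E x.
Proof.
apply/esym/(orthoproj_unique cE).
  by rewrite /E /nullspace /= (blinB bA) [adj S (S _)]GQ subrr.
move=> a Ea; rewrite innerBl [inner (S _) a]adjP//.
by rewrite (_ : adj S a = 0) ?inner0r ?subr0.
Qed.

Lemma SL_add x : x = orthoproj E x + S (L x).
Proof. by rewrite -SL subrK. Qed.

(** As [S] expands the part in [D] only, peeling off one Taylor coefficient costs
    its norm and a multiple of the defect of the remainder. *)
Lemma rnorm_split x : rnorm x ^+ 2 =
  rnorm (orthoproj E x) ^+ 2 + rnorm (L x) ^+ 2 + delta ^+ 2 * rnorm (P (L x)) ^+ 2.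
Proof.
rewrite {1}[x]SL_add pythagoras ?rnorm_S ?addrA//.
rewrite innerC adjP// (_ : adj S _ = 0) ?inner0r ?conj0//.
exact: (orthoproj_in cE).
Qed.

Lemma defect_split x : P x = P (orthoproj E x) + A (P (L x)).
Proof. by rewrite {1}[x]SL_add (blinD bP) compression_proj. Qed.

Lemma rnorm_split_iter k N : rnorm k ^+ 2 =
  \sum_(0 <= n < N) rnorm (orthoproj E (iter n L k)) ^+ 2 + rnorm (iter N L k) ^+ 2 +
  delta ^+ 2 * \sum_(0 <= n < N) rnorm (P (iter n.+1 L k)) ^+ 2.
Proof.
elim: N => [|N ih]; first by rewrite !big_geq// add0r mulr0 addr0.
by rewrite ih [in RHS]big_nat_recr// [X in _ = _ + _ * X]big_nat_recr//= (rnorm_split (iter N L k)); ring.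
Qed.

(* The adjoint of the isometric corner [V]. *)
Let G x := adj S x - P (adj S x).

Let bG : blin G.
Proof. by apply: blin_sub => //; exact: blin_comp. Qed.

Let PG x : P (G x) = 0.
Proof. by rewrite /G (blinB bP) [P (P _)](orthoproj_id cD)// subrr. Qed.

Let S_iso x : P x = 0 -> adj S (S x) = x.
Proof. by move=> Px; rewrite (bd_gram B) -/P Px scaler0 addr0. Qed.

Let PS0 x : P x = 0 -> P (S x) = 0.
Proof. by move=> Px; rewrite compression_proj Px blin0. Qed.

Let iter_PS0 n x : P x = 0 -> P (iter n S x) = 0.
Proof. by move=> Px; elim: n => //= n; exact: PS0. Qed.

Let rnorm_iter n x : P x = 0 -> rnorm (iter n S x) = rnorm x.
Proof.
move=> Px; elim: n => // n ih; rewrite iterS -ih.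
apply/eqP; rewrite -(eqrXn2 (ltn0Sn 1)) ?rnorm_ge0//; apply/eqP.
by rewrite rnorm_S iter_PS0// rnorm0 expr0n mulr0 addr0.
Qed.

Let GP0 d : D d -> G d = 0.
Proof.
by move=> Dd; rewrite /G [P _](orthoproj_id cD) ?subrr//; exact: (bd_adj B).
Qed.

Let G_proj x : G (x - P x) = G x.
Proof. by rewrite (blinB bG) (GP0 (PD x)) subr0. Qed.

Let GS x : P x = 0 -> G (S x) = x.
Proof. by move=> Px; rewrite /G S_iso// Px subr0. Qed.

Let iter_GS n x : P x = 0 -> iter n G (iter n S x) = x.
Proof. by move=> Px; elim: n => // n ih; rewrite iterSr iterS GS// iter_PS0. Qed.

Let iter_PG n x : P x = 0 -> P (iter n G x) = 0.
Proof. by move=> Px; case: n => [|n] /=; [exact: Px | exact: PG]. Qed.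

Let inner_GS n u v : P v = 0 -> inner u (iter n S v) = inner (iter n G u) v.
Proof.
move=> Pv; elim: n u => // n ih u; rewrite iterS adjPr// iterSr -ih /G innerBl.
by rewrite [inner (P _) _](orthoproj_sym cD) -/P iter_PS0// inner0r subr0.
Qed.

(* For [x] in the domain of [V], the projection onto the range of the [n]-th power
   of [V]; these projections decrease, whence the convergence in [wold_cvg]. *)
Let wold n x : K := iter n S (iter n G x).

Let wold_norm n x : P x = 0 -> rnorm (wold n x) = rnorm (iter n G x).
Proof. by move=> Px; rewrite rnorm_iter// iter_PG. Qed.

Let wold_dist n m x : P x = 0 -> (n <= m)%N ->
  rnorm (wold n x - wold m x) ^+ 2 = rnorm (wold n x) ^+ 2 - rnorm (wold m x) ^+ 2.
Proof.
move=> Px nm; rewrite rnormB_sqr.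
suff -> : complex.Re (inner (wold n x) (wold m x)) = rnorm (wold m x) ^+ 2 by ring.
have Pm := iter_PG m Px; have Pn := iter_PG n Px.
have xm : inner x (wold m x) = inner (wold m x) (wold m x).
  by rewrite /wold !inner_GS// iter_GS.
rewrite rnorm_sqr -xm; congr complex.Re.
have -> : wold m x = iter n S (iter (m - n) S (iter m G x)).
  by rewrite /wold -iterD subnKC.
have Pv := iter_PS0 (m - n) Pm.
by rewrite /wold !inner_GS// iter_GS.
Qed.

Let wold_cvg x : P x = 0 -> exists l : K, (fun n => wold n x) @ \oo --> l.
Proof.
move=> Px; pose f n := rnorm (wold n x) ^+ 2 - rnorm (wold n.+1 x) ^+ 2.
have f0 n : 0 <= f n by rewrite /f -wold_dist// sqr_ge0.
have fE m n : (m <= n)%N -> \sum_(m <= i < n) f i = rnorm (wold m x) ^+ 2 - rnorm (wold n x) ^+ 2.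
  move=> mn; rewrite -[RHS]opprB -(telescope_sumr (fun n => rnorm (wold n x) ^+ 2) mn) -sumrN.
  by apply: eq_bigr => i _; rewrite opprB.
have fC N : \sum_(0 <= i < N) f i <= rnorm (wold 0 x) ^+ 2.
  by rewrite fE// gerBl sqr_ge0.
apply: cauchy_cvg_seq => e e0.
have e2 : 0 < (e / 2) ^+ 2 by rewrite exprn_gt0 ?divr_gt0.
have [M hM] := nneg_series_tail f0 fC e2.
have small n : (M <= n)%N -> rnorm (wold M x - wold n x) < e / 2.
  move=> Mn; rewrite -(ltr_pXn2r (ltn0Sn 1)) ?nnegrE ?rnorm_ge0 ?divr_ge0 ?(ltW e0)//.
  by rewrite wold_dist// -fE.
exists M => m n hm hn.
have := rnormD (wold m x - wold M x) (wold M x - wold n x).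
rewrite addrA subrK [rnorm (wold m x - wold M x)]rnormC.
have := small _ hm; have := small _ hn; lra.
Qed.

Lemma cvg_shift (u : nat -> K) (l : K) n :
  u @ \oo --> l -> (fun m => u (n + m)%N) @ \oo --> l.
Proof.
move=> /cvg_seq h; apply/cvg_seq => e /h [N hN]; exists N => m Nm; apply: hN.
by rewrite (leq_trans Nm)// leq_addl.
Qed.

Section Analytic.
Hypothesis S_analytic : analytic_operator S.

(** The limit of [S^n G^n x] lies in the range of every power of [S]. *)
Lemma iter_corner_cvg0 x : P x = 0 -> (fun n => rnorm (iter n G x)) @ \oo --> (0 : R).
Proof.
move=> Px; have [l xl] := wold_cvg Px.
suff l0 : l = 0.
  move: xl; rewrite l0 => /cvg_seq h; apply/cvg_seqR => e /h [N hN].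
  by exists N => n /hN; rewrite !subr0 ger0_norm ?rnorm_ge0// wold_norm.
suff : (\bigcap_(n in [set n | (1 <= n)%N]) range (iter n S)) l by rewrite S_analytic.
move=> n _; have [ln xln] := wold_cvg (iter_PG n Px); exists ln => //.
apply: (cvg_uniqK (blin_cvg (blin_iter n bS) xln)).
have := cvg_shift n xl; rewrite /wold.
by under eq_fun do rewrite iterD [(n + _)%N]addnC iterD.
Qed.

(** The part outside [D] is moved by the adjoint of an isometry with trivial unitary
    part, and the part in [D] is square-summable. *)
Lemma iter_L_cvg0 k (C : R) :
  (forall N, \sum_(0 <= n < N) rnorm (P (iter n.+1 L k)) ^+ 2 <= C) ->
  (fun n => rnorm (iter n L k) ^+ 2) @ \oo --> (0 : R).
Proof.
move=> hC; pose u n : K := iter n L k - P (iter n L k).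
have uG n : u n = iter n G (u 0%N).
  elim: n => // n ih; rewrite iterS -ih /u G_proj /= /L /dual_adj -/L.
  rewrite (blinB bP) (blinZ bP) [P (P _)](orthoproj_id cD)// -/L /G.
  by rewrite opprB addrA subrK.
have Pu : P (u 0%N) = 0 by rewrite /u (blinB bP) [P (P _)](orthoproj_id cD)// subrr.
apply/cvg_seqR => e e0.
have e2 : 0 < e / 2 by rewrite divr_gt0.
have s2 : 0 < Num.sqrt (e / 2) by rewrite sqrtr_gt0.
have [N1 h1] := nneg_series_tail (fun n => sqr_ge0 _) hC e2.
have /cvg_seqR /(_ _ s2) [N2 h2] := iter_corner_cvg0 Pu.
exists (maxn N1.+1 N2) => n; rewrite geq_max => /andP[hn1 hn2].
rewrite subr0 ger0_norm ?sqr_ge0// (orthoproj_pythagoras cD) -/P.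
have : rnorm (u n) ^+ 2 < e / 2.
  have := h2 _ hn2; rewrite subr0 ger0_norm ?rnorm_ge0// -uG => h.
  by rewrite -(sqr_sqrtr (ltW e2)) ltr_pXn2r ?nnegrE ?rnorm_ge0 ?sqrtr_ge0.
have : rnorm (P (iter n L k)) ^+ 2 < e / 2.
  case: n hn1 {hn2} => // n hn1; have := h1 n.+1; rewrite big_nat_recr//=.
  by apply: le_lt_trans; rewrite lerDr sumr_ge0// => i _; exact: sqr_ge0.
rewrite -/(u n); lra.
Qed.

(** The [n]-th term of the Dirichlet integral, up to the factor [delta ^+ 2]. For a
    sequence [y] with the differences of [deviationE] it is the squared deviation of
    [y n.+1] from the mean of the earlier terms, weighted as in
    [variance_telescope]. *)
Definition deviation (a : nat -> K) (n : nat) : R :=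
  rnorm (\sum_(0 <= m < n.+1) m.+1%:R *: iter m.+1 A (P (a m.+1))) ^+ 2
    / (n.+1%:R * n.+2%:R).

(** Summation by parts. *)
Lemma abel_sum (y : nat -> K) n :
  \sum_(0 <= m < n.+1) m.+1%:R *: (y m - y m.+1) =
  \sum_(0 <= m < n.+1) y m - n.+1%:R *: y n.+1.
Proof.
elim: n => [|n ih]; first by rewrite !big_nat1 !scale1r.
rewrite big_nat_recr//= ih [in RHS]big_nat_recr//= scalerBr addrA; congr (_ - _).
by rewrite -[n.+2%:R]natr1 scalerDl scale1r addrA subrK.
Qed.

Lemma deviationE (y a : nat -> K) n :
  (forall m, iter m.+1 A (P (a m.+1)) = y m - y m.+1) ->
  deviation a n = rnorm (\sum_(0 <= m < n.+1) y m - n.+1%:R *: y n.+1) ^+ 2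
    / (n.+1%:R * n.+2%:R).
Proof.
move=> h; rewrite /deviation -abel_sum; congr (rnorm _ ^+ 2 / _).
by apply: eq_bigr => m _; rewrite h.
Qed.

(** The defects [y j] of the remainders, rotated by powers of the unitary part, have
    the rotated defects of the coefficients as differences. Their sum of squares, which [rnorm_split_iter]
    involves, equals the sum of the deviations, by [mean_cvg0]. *)
Lemma norm_identity k : let a n := orthoproj E (iter n L k) in
  exists p q : R, [/\ series (fun n => rnorm (a n) ^+ 2) @ \oo --> p,
    series (deviation a) @ \oo --> q & p + delta ^+ 2 * q = rnorm k ^+ 2].
Proof.
move=> a; pose y j := iter j.+1 A (P (iter j.+1 L k)).
have ya m : iter m.+1 A (P (a m.+1)) = y m - y m.+1.
  rewrite /y [iter m.+2 A _]iterSr -(blinB (blin_iter m.+1 bC)); congr iter.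
  by rewrite (defect_split (iter m.+1 L k)) addrK.
have yE j : rnorm (y j) = rnorm (P (iter j.+1 L k)) by rewrite iter_compression_iso.
have spl N : rnorm k ^+ 2 = \sum_(0 <= n < N) rnorm (a n) ^+ 2 + rnorm (iter N L k) ^+ 2 +
    delta ^+ 2 * \sum_(0 <= n < N) rnorm (y n) ^+ 2.
  rewrite {1}(rnorm_split_iter k N); congr (_ + _ * _).
  by apply: eq_bigr => i _; rewrite yE.
have dd : 0 < delta ^+ 2 by rewrite exprn_gt0.
have s1 N : 0 <= \sum_(0 <= n < N) rnorm (a n) ^+ 2.
  by apply: sumr_ge0 => i _; exact: sqr_ge0.
have s2 N : 0 <= \sum_(0 <= n < N) rnorm (y n) ^+ 2.
  by apply: sumr_ge0 => i _; exact: sqr_ge0.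
have Ca N : \sum_(0 <= n < N) rnorm (a n) ^+ 2 <= rnorm k ^+ 2.
  rewrite (spl N) -addrA lerDl addr_ge0 ?sqr_ge0// mulr_ge0// ltW//.
have Cy N : \sum_(0 <= n < N) rnorm (y n) ^+ 2 <= rnorm k ^+ 2 / delta ^+ 2.
  by rewrite ler_pdivlMr// mulrC (spl N) lerDr addr_ge0 ?sqr_ge0.
have [p [ap _]] := nneg_series_cvg (fun n => sqr_ge0 _) Ca.
have [q [yq _]] := nneg_series_cvg (fun n => sqr_ge0 _) Cy.
exists p, q; split=> //.
  have m0 := mean_cvg0 Cy.
  have -> : series (deviation a) = (fun N => \sum_(0 <= n < N.+1) rnorm (y n) ^+ 2
     - rnorm (\sum_(0 <= m < N.+1) y m) ^+ 2 / N.+1%:R).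
    apply/funext => N; rewrite variance_telescope addrC addKr /series /=.
    by apply: eq_bigr => i _; exact: deviationE.
  rewrite -[q]subr0; apply: cvgB => //.
  by move: yq; rewrite -cvg_shiftS.
have Lk : (fun n => rnorm (iter n L k) ^+ 2) @ \oo --> (0 : R).
  by apply: (iter_L_cvg0 (C := rnorm k ^+ 2 / delta ^+ 2)) => N; under eq_bigr do rewrite -yE.
have h : (fun N => series (fun n => rnorm (a n) ^+ 2) N + rnorm (iter N L k) ^+ 2 +
    delta ^+ 2 * series (fun n => rnorm (y n) ^+ 2) N) @ \oo --> p + 0 + delta ^+ 2 * q.
  by apply: cvgD; [exact: cvgD | exact: cvgMr].
rewrite addr0 in h.
have : (fun N : nat => rnorm k ^+ 2) @ \oo --> p + delta ^+ 2 * q.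
  by under eq_fun => N do rewrite (spl N); exact: h.
by move=> h2; apply: (cvg_unique _ h2 (cvg_cst _)); exact: norm_hausdorff.
Qed.

End Analytic.

(* The kernel of [G] is wandering for [S]: its translates are pairwise orthogonal
   and carried isometrically. *)
Let rnorm_shift_sum (w : nat -> K) N : (forall n, P (w n) = 0) -> (forall n, G (w n) = 0) ->
  rnorm (\sum_(0 <= j < N) iter j S (w j)) ^+ 2 = \sum_(0 <= j < N) rnorm (w j) ^+ 2.
Proof.
move=> Pw Gw; elim: N w Pw Gw => [|N ih] w Pw Gw; first by rewrite !big_geq// rnorm0 expr0n.
rewrite !big_nat_recl//= -ih//.
have -> : \sum_(0 <= i < N) S (iter i S (w i.+1)) = S (\sum_(0 <= i < N) iter i S (w i.+1)).
  by rewrite blin_sum.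
have Pz : P (\sum_(0 <= i < N) iter i S (w i.+1)) = 0.
  by rewrite blin_sum//; apply: big1 => i _; exact: iter_PS0.
rewrite pythagoras; last by rewrite (inner_GS 1)// /= Gw inner0l.
by congr (_ + _); rewrite rnorm_S Pz rnorm0 expr0n mulr0 addr0.
Qed.

Let shift_sum_cvg (w : nat -> K) (C : R) : (forall n, P (w n) = 0) -> (forall n, G (w n) = 0) ->
  (forall N, \sum_(0 <= n < N) rnorm (w n) ^+ 2 <= C) ->
  exists l : K, series (fun j => iter j S (w j)) @ \oo --> l.
Proof.
move=> Pw Gw hC; apply: cauchy_cvg_seq => e e0.
have e2 : 0 < (e / 2) ^+ 2 by rewrite exprn_gt0 ?divr_gt0.
have [M hM] := nneg_series_tail (fun n => sqr_ge0 _) hC e2.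
pose T := series (fun j => iter j S (w j)).
have small n : (M <= n)%N -> rnorm (T n - T M) < e / 2.
  move=> Mn; rewrite -(ltr_pXn2r (ltn0Sn 1)) ?nnegrE ?rnorm_ge0 ?divr_ge0 ?(ltW e0)//.
  have -> : T n - T M = iter M S (\sum_(0 <= j < n - M) iter j S (w (j + M)%N)).
    rewrite /T /series /= (big_cat_nat (leq0n M) Mn)/= addrAC subrr add0r.
    rewrite (blin_sum (blin_iter M bS)) -{1}[M]add0n big_addn.
    by apply: eq_bigr => j _; rewrite -iterD addnC.
  rewrite rnorm_iter; last first.
    by rewrite blin_sum//; apply: big1 => i _; exact: iter_PS0.
  rewrite rnorm_shift_sum//; have := hM n.
  by rewrite -{1}[M]add0n big_addn.
exists M => m n hm hn; rewrite -!/(T _).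
have := rnormD (T m - T M) (T M - T n); rewrite addrA subrK.
have := small _ hm; have := small _ hn; rewrite [rnorm (T n - T M)]rnormC; lra.
Qed.

(** The remainders [k n = L^n k] of the vector looked for must satisfy
    [k n = a n + S (k n.+1)]. In [D] this is a difference equation, with solution
    determined up to a constant [v]; [deviation_summable] provides the constant for
    which the solution is square-summable. Outside [D] the solution is then an
    orthogonal series. *)
Lemma realization (a : nat -> K) (C1 C2 : R) : (forall n, E (a n)) ->
  (forall N, \sum_(0 <= n < N) rnorm (a n) ^+ 2 <= C1) ->
  (forall N, \sum_(0 <= n < N) deviation a n <= C2) ->
  exists k, forall n, orthoproj E (iter n L k) = a n.
Proof.
move=> Ea hC1 hC2.
pose y n : K := - \sum_(0 <= m < n) iter m.+1 A (P (a m.+1)).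
have yS m : iter m.+1 A (P (a m.+1)) = y m - y m.+1.
  by rewrite /y opprK big_nat_recr//= addKr.
have Dy n : D (y n).
  apply: (closed_subspaceN cD); apply: closed_subspace_sum => // i.
  exact: iter_compression_in.
have [v Dv hv] : exists2 v, D v & forall N, \sum_(0 <= m < N) rnorm (y m - v) ^+ 2 <= C2 + C2.
  apply: deviation_summable => // N; have := hC2 N.
  by under eq_bigr do rewrite (deviationE _ yS).
have Dyv n : D (y n - v) by exact: (closed_subspaceB cD).
pose d n : K := iter n.+1 (adj S) (y n - v).
have Dd n : D (d n).
  by rewrite /d; elim: n.+1 => //= m; exact: (bd_adj B).
have nd n : rnorm (d n) = rnorm (y n - v).
  by rewrite -[in RHS](iter_compression_adj n.+1 (Dyv n)) (iter_compression_iso _ (Dd n)).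
have dS n : d n = P (a n.+1) + A (d n.+1).
  have inj : iter n.+1 A (d n) = iter n.+1 A (P (a n.+1) + A (d n.+1)).
    rewrite (blinD (blin_iter n.+1 bC)) -iterSr yS /d !iter_compression_adj//.
    by rewrite addrA subrK.
  have Dr : D (P (a n.+1) + A (d n.+1)).
    by apply: (closed_subspaceD cD) => //; exact: compression_in.
  by rewrite -(iter_adj_compression n.+1 (Dd n)) inj iter_adj_compression.
pose w n : K := (a n - P (a n)) + (S (d n) - A (d n)).
have Pw n : P (w n) = 0.
  rewrite /w (blinD bP) !(blinB bP) [P (P _)](orthoproj_id cD)// [P (A _)](orthoproj_id cD)//.
    by rewrite !subrr addr0.
  exact: compression_in.
have Gw n : G (w n) = 0.
  rewrite /w (blinD bG) G_proj (blinB bG) (GP0 (compression_in _)) subr0.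
  rewrite /G (_ : adj S (a n) = 0)//; last exact: Ea.
  rewrite (blin0 bP) subr0 add0r (bd_gram B) -/P (blinD bP) (blinZ bP).
  by rewrite [P (P _)](orthoproj_id cD)// [P (d n)](orthoproj_id cD)// subrr.
pose C := 2 * C1 + 2 * ((1 + delta ^+ 2) * (C2 + C2)).
have Cw N : \sum_(0 <= n < N) rnorm (w n) ^+ 2 <= C.
  have wle n : rnorm (w n) ^+ 2 <= 2 * rnorm (a n) ^+ 2 + 2 * ((1 + delta ^+ 2) * rnorm (y n - v) ^+ 2).
    have h1 := parallelogram (a n - P (a n)) (S (d n) - A (d n)).
    have h2 := orthoproj_pythagoras cD (a n).
    have h3 := orthoproj_pythagoras cD (S (d n)).
    have h4 := rnorm_S (d n).
    rewrite [P _](orthoproj_id cD)// nd in h4.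
    have := sqr_ge0 (rnorm (a n - P (a n) - (S (d n) - A (d n)))).
    have := sqr_ge0 (rnorm (P (a n))).
    have := sqr_ge0 (rnorm (A (d n))).
    move: h1 h2 h3 h4; rewrite -/(A (d n)) -/(P (a n)) -/(w n).
    move: (rnorm (w n) ^+ 2) (rnorm (a n - P (a n) - (S (d n) - A (d n))) ^+ 2) => t1 t2.
    move: (rnorm (a n - P (a n)) ^+ 2) (rnorm (S (d n) - A (d n)) ^+ 2) => t3 t4.
    move: (rnorm (S (d n)) ^+ 2) (rnorm (a n) ^+ 2) (rnorm (P (a n)) ^+ 2) (rnorm (A (d n)) ^+ 2) => t5 t6 t7 t8.
    move: (rnorm (y n - v) ^+ 2) => t9 ? ? ? h4 *.
    have -> : (1 + delta ^+ 2) * t9 = t5 by rewrite h4; ring.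
    lra.
  apply: le_trans (ler_sum _ (fun n _ => wle n)) _.
  rewrite big_split/= -!mulr_sumr /C.
  have d1 : 0 <= 1 + delta ^+ 2 by rewrite addr_ge0 ?sqr_ge0.
  apply: lerD; first by rewrite ler_wpM2l.
  by rewrite ler_wpM2l// ler_wpM2l.
have ex n : exists l : K, series (fun j => iter j S (w (n + j)%N)) @ \oo --> l.
  apply: (shift_sum_cvg (C := C)) => // N.
  have sh : \sum_(n <= i < n + N) rnorm (w i) ^+ 2 = \sum_(0 <= j < N) rnorm (w (n + j)%N) ^+ 2.
    rewrite -{1}[n]add0n big_addn addKn.
    by apply: eq_bigr => j _; rewrite addnC.
  have := Cw (n + N)%N; rewrite (big_cat_nat (leq0n n) (leq_addr _ _))/= sh.
  by apply: le_trans; rewrite lerDr; apply: sumr_ge0 => i _; exact: sqr_ge0.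
pose W n := projT1 (cid (ex n)).
have WP n : series (fun j => iter j S (w (n + j)%N)) @ \oo --> W n by exact: (projT2 (cid (ex n))).
have WS n : W n = w n + S (W n.+1).
  apply: (cvg_uniqK (cvg_shift 1 (WP n))).
  have h : (fun N => w n + S (series (fun j => iter j S (w (n.+1 + j)%N)) N)) @ \oo -->
      w n + S (W n.+1).
    by apply: cvgD; [exact: cvg_cst | exact: (blin_cvg bS (WP n.+1))].
  have -> // : (fun m => series (fun j => iter j S (w (n + j)%N)) (1 + m)%N) =
    (fun N => w n + S (series (fun j => iter j S (w (n.+1 + j)%N)) N)).
  apply/funext => N.
  rewrite /series /= big_nat_recl//= addn0; congr (_ + _).
  by rewrite blin_sum//; apply: eq_bigr => j _; rewrite addnS.
pose k n : K := W n + (P (a n) + A (d n)).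
have kS n : k n = a n + S (k n.+1).
  rewrite /k -dS (blinD bS) WS /w.
  move: (a n) (P (a n)) (S (d n)) (A (d n)) (S (W n.+1)) => t1 t2 t3 t4 t5.
  by rewrite [_ + t5]addrC -[LHS]addrA addrACA !subrK addrCA.
have Lk n : L (k n) = k n.+1 by rewrite kS (blinD blin_L) L_ker// LS add0r.
have iLk n : iter n L (k 0%N) = k n by elim: n => //= n ->.
by exists (k 0%N) => n; rewrite iLk -SL Lk kS addrK.
Qed.

End Model.

(** * Vector-valued power series *)

Section PowerSeries.
Context {R : realType} {K : hilbertType R}.
Implicit Types (a b c : nat -> K) (f g : R[i] -> K) (z w h : R[i]).

Lemma unit_diskE z : unit_disk z <-> cabs z < 1.
Proof. by rewrite /unit_disk /= cabsE ltcR. Qed.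

(** Radius of convergence at least one, in the form of Abel's lemma. *)
Definition abel a := forall r : R, 0 < r -> r < 1 ->
  exists C : R, forall n, rnorm (a n) * r ^+ n <= C.

Lemma geometric_sum_le (x : R) N : 0 <= x -> x < 1 ->
  \sum_(0 <= k < N) x ^+ k <= (1 - x)^-1.
Proof.
move=> x0 x1; have x1' : 0 < 1 - x by rewrite subr_gt0.
rewrite -[X in _ <= X]mul1r ler_pdivlMr// mulr_suml.
suff -> : \sum_(0 <= k < N) x ^+ k * (1 - x) = 1 - x ^+ N by rewrite gerBl exprn_ge0.
elim: N => [|N ih]; first by rewrite big_geq// subrr.
by rewrite big_nat_recr//= ih exprS; ring.
Qed.

(** Compare the last power with all the earlier ones in the geometric sum. *)
Lemma natmul_expr_le (x : R) n : 0 <= x -> x < 1 -> n.+1%:R * x ^+ n <= (1 - x)^-1.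
Proof.
move=> x0 x1; apply: le_trans (geometric_sum_le n.+1 x0 x1).
rewrite mulr_natl -[n.+1 in X in X <= _]subn0 -sumr_const_nat.
rewrite !big_mkord; apply: ler_sum => i _.
by rewrite ler_wiXn2l// ?ltW// -ltnS ltn_ord.
Qed.

Lemma abel_step (r : R) : 0 < r -> r < 1 -> exists s, [/\ r < s, 0 < s & s < 1].
Proof. by move=> r0 r1; exists ((r + 1) / 2); split; lra. Qed.

Lemma abel_natmul a : abel a -> abel (fun n => n.+1%:R *: a n).
Proof.
move=> ha r r0 r1; have [s [rs s0 s1]] := abel_step r0 r1.
have [C hC] := ha s s0 s1.
have q0 : 0 <= r / s by rewrite divr_ge0 ?ltW.
have q1 : r / s < 1 by rewrite ltr_pdivrMr// mul1r.
exists (C * (1 - r / s)^-1) => n.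
rewrite rnormZ cabs_nat -{1}[r](divfK (lt0r_neq0 s0)) exprMn.
have -> : n.+1%:R * rnorm (a n) * ((r / s) ^+ n * s ^+ n) =
  (rnorm (a n) * s ^+ n) * (n.+1%:R * (r / s) ^+ n) by ring.
apply: ler_pM => //; first by rewrite mulr_ge0 ?rnorm_ge0 ?exprn_ge0 ?ltW.
- by rewrite mulr_ge0 ?exprn_ge0.
- exact: natmul_expr_le.
Qed.

Lemma abel_shift a : abel a -> abel (fun n => a n.+1).
Proof.
move=> ha r r0 r1; have [C hC] := ha r r0 r1; exists (C / r) => n.
by rewrite ler_pdivlMr// -mulrA -exprSr.
Qed.

Lemma abelD a b : abel a -> abel b -> abel (fun n => a n + b n).
Proof.
move=> ha hb r r0 r1; have [C hC] := ha r r0 r1; have [C' hC'] := hb r r0 r1.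
exists (C + C') => n; apply: le_trans (lerD (hC n) (hC' n)).
by rewrite -mulrDl ler_wpM2r ?rnormD// exprn_ge0 ?ltW.
Qed.

Lemma abel_le a b (C : R) : abel a -> (forall n, rnorm (b n) <= C * rnorm (a n)) -> abel b.
Proof.
move=> ha h r r0 r1; have [C' hC'] := ha r r0 r1; exists (`|C| * C') => n.
have rn : 0 <= r ^+ n by rewrite exprn_ge0 ?ltW.
apply: le_trans (ler_wpM2r rn (h n)) _; rewrite -mulrA.
apply: le_trans (ler_wpM2r _ (ler_norm C)) _; first by rewrite mulr_ge0 ?rnorm_ge0.
by rewrite ler_wpM2l.
Qed.

Lemma abel_bounded a (C : R) : (forall n, rnorm (a n) <= C) -> abel a.
Proof.
move=> h r r0 r1; exists C => n; apply: le_trans (h n).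
by rewrite ler_piMr ?rnorm_ge0// exprn_ile1 ?ltW.
Qed.

Lemma abel_summable a (r : R) : abel a -> 0 <= r -> r < 1 ->
  exists C : R, forall N, \sum_(0 <= n < N) rnorm (a n) * r ^+ n <= C.
Proof.
move=> ha; rewrite le_eqVlt => /orP[/eqP <- _|r0 r1].
  exists (rnorm (a 0%N)) => -[|N]; first by rewrite big_geq ?rnorm_ge0.
  by rewrite big_nat_recl//= mulr1 big1 ?addr0// => i _; rewrite expr0n mulr0.
have [s [rs s0 s1]] := abel_step r0 r1.
have [C hC] := ha s s0 s1.
have q0 : 0 <= r / s by rewrite divr_ge0 ?ltW.
have q1 : r / s < 1 by rewrite ltr_pdivrMr// mul1r.
have C0 : 0 <= C by apply: le_trans (hC 0%N); rewrite mulr_ge0 ?rnorm_ge0.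
exists (C * (1 - r / s)^-1) => N.
apply: le_trans (_ : \sum_(0 <= n < N) C * (r / s) ^+ n <= _).
  apply: ler_sum => n _; rewrite -{1}[r](divfK (lt0r_neq0 s0)) exprMn mulrCA mulrC.
  by rewrite ler_wpM2r ?exprn_ge0.
by rewrite -mulr_sumr ler_wpM2l// geometric_sum_le.
Qed.

Lemma series_abs_cvg (u : nat -> K) (C : R) :
  (forall N, \sum_(0 <= n < N) rnorm (u n) <= C) -> exists l : K, series u @ \oo --> l.
Proof.
move=> hC; apply: cauchy_cvg_seq => e e0.
have e2 : 0 < e / 2 by rewrite divr_gt0.
have [M hM] := nneg_series_tail (fun n => rnorm_ge0 _) hC e2.
have small n : (M <= n)%N -> rnorm (series u n - series u M) < e / 2.
  move=> Mn; rewrite /series /= (big_cat_nat (leq0n M) Mn)/= addrAC subrr add0r.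
  exact: le_lt_trans (rnorm_sum _ _) (hM n).
exists M => m n hm hn.
have := rnormD (series u m - series u M) (series u M - series u n); rewrite addrA subrK.
have := small _ hm; have := small _ hn; rewrite [rnorm (series u n - _)]rnormC; lra.
Qed.

Lemma abel_partial_le a z (r : R) N : cabs z <= r ->
  \sum_(0 <= n < N) rnorm (z ^+ n *: a n) <= \sum_(0 <= n < N) rnorm (a n) * r ^+ n.
Proof.
move=> zr; apply: ler_sum => n _; rewrite rnormZ cabsX mulrC ler_wpM2l ?rnorm_ge0//.
by rewrite lerXn2r ?nnegrE ?cabs_ge0// (le_trans (cabs_ge0 z)).
Qed.

Lemma abel_cvg a z : abel a -> cabs z < 1 ->
  exists l : K, series (fun n => z ^+ n *: a n) @ \oo --> l.
Proof.
move=> ha z1; have [C hC] := abel_summable ha (cabs_ge0 z) z1.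
by apply: (series_abs_cvg (C := C)) => N; apply: le_trans (hC N); exact: abel_partial_le.
Qed.

(** The terms of a convergent series are bounded. *)
Lemma power_series_abel a f : power_series a f -> abel a.
Proof.
move=> haf r r0 r1.
have cr : cabs r%:C = r by rewrite cabsR gtr0_norm.
have /haf/cvg_seq h : unit_disk (r%:C : R[i]) by apply/unit_diskE; rewrite cr.
have [N hN] := h 1 ltr01.
pose C := \sum_(0 <= n < N) rnorm (a n) * r ^+ n.
have s0 n : 0 <= rnorm (a n) * r ^+ n by rewrite mulr_ge0 ?rnorm_ge0 ?exprn_ge0 ?ltW.
exists (C + 2) => n; have [Nn|nN] := leqP N n.
  have -> : rnorm (a n) * r ^+ n = rnorm (r%:C ^+ n *: a n).
    by rewrite rnormZ cabsX cr mulrC.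
  set l := f r%:C in hN; set s := series _ in hN.
  have -> : r%:C ^+ n *: a n = (s n.+1 - l) - (s n - l).
    by rewrite opprB addrA subrK /s /series /= big_nat_recr//= addrAC subrr add0r.
  have := rnormB (s n.+1 - l) (s n - l).
  have := hN n Nn; have := hN n.+1 (leqW Nn).
  have : 0 <= C by exact: sumr_ge0.
  lra.
apply: (@le_trans _ _ C); last by rewrite lerDl.
rewrite /C big_mkord (bigD1 (Ordinal nN))//= lerDl.
by apply: sumr_ge0 => i _; exact: s0.
Qed.

(** The coefficients of the derivative. *)
Definition dcoef a n : K := n.+1%:R *: a n.+1.

Lemma abel_dcoef a : abel a -> abel (dcoef a).
Proof. by move=> ha; exact: (abel_natmul (abel_shift ha)). Qed.

(** The error of the first-order expansion of the power [n] at [z]. *)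
Definition taylor_rest z h n : R[i] := (z + h) ^+ n - z ^+ n - n%:R * h * z ^+ n.-1.

Lemma taylor_rest_le z h (r : R) n : cabs z <= r -> cabs h + cabs z <= r ->
  r ^+ 2 * cabs (taylor_rest z h n) <= n%:R ^+ 2 * cabs h ^+ 2 * r ^+ n.
Proof.
move=> zr hr; have r0 : 0 <= r := le_trans (cabs_ge0 z) zr.
have zh : cabs (z + h) <= r by apply: le_trans hr; rewrite addrC cabsD.
have step m : taylor_rest z h m.+1 = (z + h) * taylor_rest z h m + m%:R * h ^+ 2 * z ^+ m.-1.
  rewrite /taylor_rest -pred_Sn exprS [z ^+ m.+1]exprS -natr1.
  by case: m => [|m] /=; rewrite ?exprS; ring.
elim: n => [|n ih].
  by rewrite /taylor_rest !expr0 subrr !mul0r sub0r oppr0 cabsR normr0 mulr0 expr0n !mul0r.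
rewrite step; apply: le_trans (ler_wpM2l (sqr_ge0 r) (cabsD _ _)) _.
rewrite mulrDr !cabsM cabs_nat !cabsX.
have h1 : r ^+ 2 * (cabs (z + h) * cabs (taylor_rest z h n)) <= r * (n%:R ^+ 2 * cabs h ^+ 2 * r ^+ n).
  rewrite mulrCA; apply: ler_pM => //; first exact: cabs_ge0.
  by rewrite mulr_ge0 ?sqr_ge0 ?cabs_ge0.
have h2 : r ^+ 2 * (n%:R * cabs h ^+ 2 * cabs z ^+ n.-1) <= n%:R * cabs h ^+ 2 * r ^+ n.+1.
  case: n {ih h1} => [|n]; first by rewrite !mul0r mulr0.
  rewrite mulrCA; apply: ler_wpM2l; first by rewrite mulr_ge0 ?sqr_ge0.
  rewrite [r ^+ n.+2]exprS [r ^+ n.+1]exprS mulrA -expr2 ler_wpM2l ?sqr_ge0//.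
  by rewrite lerXn2r ?nnegrE ?cabs_ge0.
apply: le_trans (lerD h1 h2) _.
rewrite [r ^+ n.+1]exprS -[n.+1%:R]natr1 -subr_ge0.
have : 0 <= cabs h ^+ 2 * (r * r ^+ n).
  by apply: mulr_ge0; [exact: sqr_ge0 | apply: mulr_ge0 => //; exact: exprn_ge0].
have : 0 <= n%:R :> R by exact: ler0n.
move: (cabs h ^+ 2) (r ^+ n) (n%:R : R) => u v m m0 uv.
have -> : (m + 1) ^+ 2 * u * (r * v) - (r * (m ^+ 2 * u * v) + m * u * (r * v)) =
  (m + 1) * (u * (r * v)) by ring.
by rewrite mulr_ge0// addr_ge0.
Qed.

(** Summed over [n], the quadratic bound [taylor_rest_le] makes the difference
    quotient differ from the derived series by [O(cabs h)]. *)
Lemma power_series_derive a f z : abel a -> power_series a f -> unit_disk z ->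
  exists2 l : K, derive1 f z = l & series (fun n => z ^+ n *: dcoef a n) @ \oo --> l.
Proof.
move=> ha haf Dz; have z1 := (unit_diskE z).1 Dz.
have [l hl] := abel_cvg (abel_dcoef ha) z1; exists l => //.
pose r := (cabs z + 1) / 2.
have z0 := cabs_ge0 z.
have r0 : 0 < r by rewrite /r; lra.
have r1 : r < 1 by rewrite /r; lra.
have zr : cabs z < r by rewrite /r; lra.
have [C hC] := abel_summable (abel_natmul (abel_natmul ha)) (ltW r0) r1.
have C0 : 0 <= C by have := hC 0%N; rewrite big_geq.
have r2 : 0 < r ^+ 2 by rewrite exprn_gt0.
have bound h : cabs h <= r - cabs z ->
    rnorm (f (z + h) - f z - h *: l) <= C / r ^+ 2 * cabs h ^+ 2.
  move=> hr.
  have Dzh : unit_disk (z + h).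
    by apply/unit_diskE; apply: le_lt_trans (cabsD _ _) _; lra.
  pose u N : K := \sum_(0 <= n < N.+1) taylor_rest z h n *: a n.
  have uE N : u N = series (fun n => (z + h) ^+ n *: a n) N.+1 - series (fun n => z ^+ n *: a n) N.+1
      - h *: series (fun n => z ^+ n *: dcoef a n) N.
    rewrite /u /series /= -sumrB scaler_sumr.
    have -> : \sum_(0 <= i < N) h *: (z ^+ i *: dcoef a i) =
        \sum_(0 <= n < N.+1) (n%:R * h * z ^+ n.-1) *: a n.
      rewrite [RHS]big_nat_recl//= !mul0r scale0r add0r.
      by apply: eq_bigr => i _; rewrite /dcoef !scalerA; congr (_ *: _); ring.
    by rewrite -sumrB; apply: eq_bigr => i _; rewrite /taylor_rest -!scalerBl.
  have ul : u @ \oo --> f (z + h) - f z - h *: l.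
    rewrite (funext uE); apply: cvgB.
      by apply: cvgB; rewrite cvg_shiftS; exact: haf.
    exact: cvgZr.
  rewrite -rnormN -sub0r; apply: (rnorm_lim_le (N := 0)) ul => N _.
  rewrite sub0r rnormN; apply: le_trans (rnorm_sum _ _) _.
  rewrite mulrAC ler_pdivlMr// mulrC mulr_sumr.
  apply: (@le_trans _ _ (cabs h ^+ 2 * \sum_(0 <= n < N.+1) rnorm (n.+1%:R *: (n.+1%:R *: a n)) * r ^+ n)).
    rewrite mulr_sumr; apply: ler_sum => n _; rewrite !rnormZ cabs_nat.
    have hz : cabs h + cabs z <= r by lra.
    have := taylor_rest_le n (ltW zr) hz => ht.
    rewrite [X in X <= _]mulrA; apply: le_trans (ler_wpM2r (rnorm_ge0 _) ht) _.
    have -> : cabs h ^+ 2 * (n.+1%:R * (n.+1%:R * rnorm (a n)) * r ^+ n) =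
      n.+1%:R ^+ 2 * cabs h ^+ 2 * r ^+ n * rnorm (a n) by ring.
    rewrite ler_wpM2r ?rnorm_ge0// ler_wpM2r ?exprn_ge0 ?(ltW r0)// ler_wpM2r ?sqr_ge0//.
    by rewrite lerXn2r ?nnegrE// ler_nat.
  by rewrite [X in _ <= X]mulrC ler_wpM2l ?sqr_ge0.
apply/cvg_lim; first exact: norm_hausdorff.
apply/cvg_rnorm => e e0.
have d0 : 0 < Num.min (r - cabs z) (e / (C / r ^+ 2 + 1)).
  rewrite lt_min subr_gt0 zr divr_gt0// ltr_wpDl// divr_ge0// ltW//.
near=> h.
have hne : h != 0 by near: h; exact: nbhs_dnbhs_neq.
have hsm : cabs h < Num.min (r - cabs z) (e / (C / r ^+ 2 + 1)).
  rewrite -ltcR -cabsE; near: h; apply: dnbhs0_lt; by rewrite ltcR.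
move: hsm; rewrite lt_min => /andP[hs1 hs2].
have hc0 : 0 < cabs h by rewrite -ltcR -cabsE normr_gt0.
have -> : h^-1 *: (f (h + z) - f z) - l = h^-1 *: (f (z + h) - f z - h *: l).
  by rewrite [h + z]addrC [RHS]scalerBr scalerA mulVf// scale1r.
rewrite rnormZ; have -> : cabs h^-1 = (cabs h)^-1.
  by apply: complexI; rewrite -cabsE normfV cabsE fmorphV.
rewrite mulrC ltr_pdivrMr//; apply: le_lt_trans (bound _ (ltW hs1)) _.
rewrite expr2 mulrA ltr_pM2r//.
have c1 : 0 < C / r ^+ 2 + 1 by rewrite ltr_wpDl// divr_ge0// ltW.
rewrite ltr_pdivlMr// in hs2; apply: le_lt_trans hs2.
by rewrite mulrC ler_wpM2l ?cabs_ge0// lerDl.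
Unshelve. all: by end_near. Qed.

(** A power series that vanishes off the origin has vanishing constant term, by
    continuity at the origin, and may be divided by the variable. *)
Lemma power_series_zero c : abel c ->
  (forall z, z != 0 -> cabs z < 1 -> series (fun n => z ^+ n *: c n) @ \oo --> (0 : K)) ->
  c 0%N = 0 /\
  forall z, z != 0 -> cabs z < 1 -> series (fun n => z ^+ n *: c n.+1) @ \oo --> (0 : K).
Proof.
move=> hc h0; have half1 : (2^-1 : R) < 1 by lra.
have half0 : (0 : R) <= 2^-1 by lra.
have [C hC] := abel_summable (abel_shift hc) half0 half1.
have C0 : 0 <= C by have := hC 0%N; rewrite big_geq.
have recl z N : series (fun n => z ^+ n *: c n) N.+1 = c 0%N + z *: series (fun n => z ^+ n *: c n.+1) N.
  rewrite /series /= big_nat_recl//= expr0 scale1r scaler_sumr; congr (_ + _).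
  by apply: eq_bigr => i _; rewrite scalerA exprS.
have small (e : R) : 0 < e -> e <= 2^-1 -> rnorm (c 0%N) <= C * e.
  move=> e0 e2; have ce : cabs e%:C = e by rewrite cabsR gtr0_norm.
  have ez : e%:C != 0 :> R[i] by rewrite -normr_eq0 cabsE ce; apply/eqP => /complexI/eqP; rewrite gt_eqF.
  have hz : cabs e%:C < 1 by rewrite ce; lra.
  have := h0 _ ez hz; rewrite -cvg_shiftS => hl.
  rewrite -[c 0%N]subr0; apply: (rnorm_lim_le (N := 0)) hl => N _.
  rewrite /= recl opprD addrA subrr sub0r rnormN rnormZ ce mulrC ler_wpM2r ?(ltW e0)//.
  apply: le_trans (rnorm_sum _ _) _; apply: le_trans (hC N).
  by apply: abel_partial_le; rewrite ce.
have c00 : c 0%N = 0.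
  apply: rnorm_eq0; apply/eqP; rewrite eq_le rnorm_ge0 andbT leNgt; apply/negP => p0.
  pose e := Num.min (2^-1) (rnorm (c 0%N) / (2 * (C + 1))).
  have e0 : 0 < e by rewrite lt_min invr_gt0 ltr0n divr_gt0// mulr_gt0// ltr_wpDl.
  have e1 : e <= 2^-1 by rewrite /e ge_min lexx.
  have := small e e0 e1.
  have e2 : e <= rnorm (c 0%N) / (2 * (C + 1)) by rewrite /e ge_min lexx orbT.
  rewrite ler_pdivlMr ?mulr_gt0 ?ltr_wpDl// in e2; nra.
split=> // z z0 z1; have := h0 z z0 z1; rewrite -cvg_shiftS (funext (recl z)) c00.
move=> hl; rewrite -(scaler0 _ (z^-1)).
have -> : series (fun n => z ^+ n *: c n.+1) =
  (fun N => z^-1 *: (0 + z *: series (fun n => z ^+ n *: c n.+1) N)).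
  by apply/funext => N; rewrite add0r scalerA mulVf// scale1r.
by apply: cvgZr; exact: hl.
Qed.

Lemma power_series_unique a b f : power_series a f -> power_series b f -> a = b.
Proof.
move=> ha hb; have aa := power_series_abel ha; have ab := power_series_abel hb.
have key n : forall c, abel c ->
  (forall z, z != 0 -> cabs z < 1 -> series (fun n => z ^+ n *: c n) @ \oo --> (0 : K)) -> c n = 0.
  elim: n => [|n ih] c hc h0; have [c0 h1] := power_series_zero hc h0 => //.
  by apply: (ih (fun n => c n.+1)) => //; exact: abel_shift.
apply/funext => n; apply/eqP; rewrite -subr_eq0; apply/eqP.
apply: (key n (fun n => a n - b n)).
  apply: abelD => //; apply: (abel_le (C := 1) ab) => m.
  by rewrite rnormN mul1r.
move=> z _ /unit_diskE Dz; rewrite -(subrr (f z)).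
have -> : series (fun n => z ^+ n *: (a n - b n)) =
  (fun N => series (fun n => z ^+ n *: a n) N - series (fun n => z ^+ n *: b n) N).
  by apply/funext => N; rewrite /series /= -sumrB; apply: eq_bigr => i _; rewrite scalerBr.
by apply: cvgB; [exact: ha | exact: hb].
Qed.

Lemma coefficientsE a f : power_series a f -> coefficients f = a.
Proof.
move=> ha; rewrite /coefficients.
have := @xgetPex _ (fun=> 0) [set a | power_series a f] (ex_intro _ a ha).
by move=> h; exact: power_series_unique h ha.
Qed.

End PowerSeries.

(** * Integrals over the disk *)

Section AreaIntegrals.
Context {R : realType}.
Local Notation plane := (measurableTypeR R * measurableTypeR R)%type.
Local Notation area := ((lebesgue_measure \x lebesgue_measure)%E : set plane -> \bar R).
Implicit Types (rho : R) (f g : plane -> R).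

Definition disk rho : set plane := [set p | (p.1 : R) ^+ 2 + (p.2 : R) ^+ 2 < rho ^+ 2].

Lemma measurable_x : measurable_fun setT (fun p : plane => p.1 : R).
Proof. exact: measurable_fst. Qed.
Lemma measurable_y : measurable_fun setT (fun p : plane => p.2 : R).
Proof. exact: measurable_snd. Qed.

Lemma measurable_disk rho : measurable (disk rho).
Proof.
have -> : disk rho = (fun p : plane => (p.1 : R) ^+ 2 + (p.2 : R) ^+ 2) @^-1` `]-oo, rho ^+ 2[.
  by apply/seteqP; split=> p; rewrite /disk /= in_itv.
rewrite -[X in measurable X]setTI.
have mf : measurable_fun setT (fun p : plane => (p.1 : R) ^+ 2 + (p.2 : R) ^+ 2).
  by apply: measurable_funD; apply: measurable_funX; [exact: measurable_x | exact: measurable_y].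
by apply: mf => //; exact: measurable_itv.
Qed.

Lemma area_disk_fin rho : (area (disk rho) < +oo)%E.
Proof.
apply: (@le_lt_trans _ _ (area (`[- `|rho|, `|rho|]%classic `*` `[- `|rho|, `|rho|]%classic))).
  have m1 := measurable_disk rho.
  have m2 : measurable (`[- `|rho|, `|rho|]%classic `*` `[- `|rho|, `|rho|]%classic : set plane).
    by apply: measurableX; exact: measurable_itv.
  apply: le_measure; [exact/mem_set | exact/mem_set |].
  move=> [x y]; rewrite /disk /= => h; rewrite !in_itv /= -!ler_norml.
  have hx : `|x| ^+ 2 <= `|rho| ^+ 2 by rewrite -!normrX !ger0_norm ?sqr_ge0//; have := sqr_ge0 y; lra.
  have hy : `|y| ^+ 2 <= `|rho| ^+ 2 by rewrite -!normrX !ger0_norm ?sqr_ge0//; have := sqr_ge0 x; lra.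
  by rewrite !ler_pXn2r ?nnegrE in hx hy.
rewrite product_measure1E//= !lebesgue_measure_itv /= !lte_fin.
by case: ifPn => _; rewrite -?EFinB -?EFinM ?mule0 ltry.
Qed.

Lemma disk_integrable rho f (C : R) : measurable_fun setT f ->
  (forall p, disk rho p -> `|f p| <= C) ->
  (area : {measure set plane -> \bar R}).-integrable (disk rho) (EFin \o f).
Proof.
move=> mf hC; apply: measurable_bounded_integrable.
- exact: measurable_disk.
- exact: area_disk_fin.
- exact: measurable_funTS.
by exists C; split; [rewrite num_real | move=> M CM p /hC h; apply: le_trans h (ltW CM)].
Qed.

(** The fundamental theorem of calculus on a chord of the circle, at whose end
    points [u] vanishes. *)
Lemma chord_integral (r2 s : R) (u : {poly R}) :
  (forall t, t ^+ 2 + s ^+ 2 = r2 -> u.[t] = 0) ->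
  (\int[lebesgue_measure]_(t in [set t : measurableTypeR R | ((t : R) ^+ 2 + s ^+ 2 < r2)%R])
    ((u^`().[t])%R)%:E = 0)%E.
Proof.
move=> u0; have [r0|r0] := leP (r2 - s ^+ 2) 0.
  rewrite (_ : [set t | _] = set0) ?integral_set0//.
  apply/seteqP; split=> // t /=; have := sqr_ge0 t; lra.
pose w := Num.sqrt (r2 - s ^+ 2).
have w0 : 0 < w by rewrite sqrtr_gt0.
have w2 : w ^+ 2 = r2 - s ^+ 2 by rewrite sqr_sqrtr// ltW.
have -> : [set t | t ^+ 2 + s ^+ 2 < r2] = `]- w, w[%classic.
  apply/seteqP; split=> t /=; rewrite in_itv /= -ltr_norml.
    move=> h; rewrite -(ltr_pXn2r (ltn0Sn 1)) ?nnegrE ?(ltW w0)// -normrX ger0_norm ?sqr_ge0// w2; lra.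
  move=> h; have : `|t| ^+ 2 < w ^+ 2 by rewrite ltr_pXn2r ?nnegrE ?(ltW w0).
  by rewrite -normrX ger0_norm ?sqr_ge0// w2; lra.
rewrite -(@integral_itv_bndoo _ _ _ _ true false); last first.
  apply/measurable_EFinP; apply: measurable_funTS; apply: continuous_measurable_fun.
  exact: continuous_horner.
rewrite (@continuous_FTC2 _ (horner u^`()) (horner u)).
- by rewrite !u0 ?sqrrN ?w2 ?subrK// subee.
- by rewrite gtrN.
- apply: continuous_subspaceT; exact: continuous_horner.
- split.
  + by move=> t _; exact: derivable_horner.
  + by apply: cvg_at_right_filter; exact: continuous_horner.
  + by apply: cvg_at_left_filter; exact: continuous_horner.
by move=> t _; rewrite -derivE.
Qed.

End AreaIntegrals.

Section Moments.
Context {R : realType}.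
Local Notation plane := (measurableTypeR R * measurableTypeR R)%type.
Local Notation area := ((lebesgue_measure \x lebesgue_measure)%E : {measure set plane -> \bar R}).
Implicit Types (rho : R) (f g : plane -> R) (c z : R[i]) (p q : nat).

Section ChordFubini.
Variables (rho C : R) (f : plane -> R) (u : R -> {poly R}).
Hypothesis mf : measurable_fun setT f.
Hypothesis hC : forall v, disk rho v -> `|f v| <= C.
Hypothesis u0 : forall t s, t ^+ 2 + s ^+ 2 = rho ^+ 2 -> (u s).[t] = 0.

Let intf : area.-integrable setT ((EFin \o f) \_ (disk rho)).
Proof.
rewrite -integrable_mkcond; last exact: measurable_disk.
exact: (disk_integrable mf hC).
Qed.

(** By Fubini's theorem, directional derivatives of a function that vanishes on the
    circle have integral zero over the disk. *)
Lemma disk_derivative_x : (forall x y, f (x, y) = (u y)^`().[x]) ->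
  (\int[area]_(v in disk rho) (f v)%:E = 0)%E.
Proof.
move=> fu; rewrite integral_mkcond.
rewrite -(integral21_prod_meas1 intf) /fubini_G.
apply: integral0_eq => y _.
transitivity (\int[lebesgue_measure]_(t in [set t : measurableTypeR R | ((t : R) ^+ 2 + y ^+ 2 < rho ^+ 2)%R])
    (((u y)^`().[t])%R)%:E)%E.
  rewrite [RHS]integral_mkcond; apply: eq_integral => x _.
  by rewrite !patchE /= fu.
by apply: chord_integral => t; exact: u0.
Qed.

Lemma disk_derivative_y : (forall x y, f (x, y) = (u x)^`().[y]) ->
  (\int[area]_(v in disk rho) (f v)%:E = 0)%E.
Proof.
move=> fu; rewrite integral_mkcond.
rewrite -(integral12_prod_meas1 intf) /fubini_F.
apply: integral0_eq => x _.
transitivity (\int[lebesgue_measure]_(t in [set t : measurableTypeR R | ((t : R) ^+ 2 + x ^+ 2 < rho ^+ 2)%R])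
    (((u x)^`().[t])%R)%:E)%E.
  rewrite [RHS]integral_mkcond; apply: eq_integral => y _.
  rewrite !patchE /= fu; congr (if _ then _ else _).
  by apply/idP/idP; rewrite !inE /disk /= addrC.
by apply: chord_integral => t; exact: u0.
Qed.

End ChordFubini.

(** On real arguments, the real part of a complex polynomial is the polynomial of
    the real parts of the coefficients. *)
Definition re_poly (q : {poly R[i]}) : {poly R} := map_poly (@complex.Re R) q.

Lemma horner_re_poly (q : {poly R[i]}) (t : R) : (re_poly q).[t] = complex.Re q.[t%:C].
Proof.
rewrite (@horner_coef_wide _ (size q)); last first.
  by rewrite /re_poly; apply: (leq_trans (size_poly _ _)).
rewrite horner_coef; elim/big_ind2: _ => [|x a y b -> ->|i _] //; first by rewrite ReD.
rewrite coef_map_id0 // -rmorphXn /=; case: (q`_i) => a b /=; ring.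
Qed.

Lemma deriv_re_poly (q : {poly R[i]}) : (re_poly q)^`() = re_poly q^`().
Proof.
apply/polyP => i; rewrite coef_deriv !coef_map_id0 // coef_deriv.
have Remn (a : R[i]) n : complex.Re (a *+ n) = complex.Re a *+ n.
  by elim: n => [|n ih]; rewrite ?mulr0n// !mulrS ReD ih.
by rewrite Remn.
Qed.

Definition mono c p q (v : plane) : R :=
  complex.Re (c * plane_point v ^+ p * Num.conj (plane_point v) ^+ q).

Lemma measurable_Re_Im (w : plane -> R[i]) :
  measurable_fun setT (fun v => complex.Re (w v)) ->
  measurable_fun setT (fun v => complex.Im (w v)) -> forall n,
  measurable_fun setT (fun v => complex.Re (w v * plane_point v ^+ n)) /\
  measurable_fun setT (fun v => complex.Im (w v * plane_point v ^+ n)).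
Proof.
move=> mr mi; elim=> [|n [ir ii]].
  by split; under eq_fun do rewrite expr0 mulr1.
split.
  have -> : (fun v => complex.Re (w v * plane_point v ^+ n.+1)) =
    (fun v => complex.Re (w v * plane_point v ^+ n) * (v.1 : R) -
      complex.Im (w v * plane_point v ^+ n) * (v.2 : R)).
    by apply/funext => v; rewrite exprSr mulrA; case: (w v * _).
  by apply: measurable_funB; apply: measurable_funM.
have -> : (fun v => complex.Im (w v * plane_point v ^+ n.+1)) =
  (fun v => complex.Re (w v * plane_point v ^+ n) * (v.2 : R) +
    complex.Im (w v * plane_point v ^+ n) * (v.1 : R)).
  by apply/funext => v; rewrite exprSr mulrA; case: (w v * _).
by apply: measurable_funD; apply: measurable_funM.
Qed.

Lemma measurable_mono c p q : measurable_fun setT (mono c p q).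
Proof.
have h0 (a : R[i]) n : measurable_fun setT (fun v : plane => complex.Re (a * plane_point v ^+ n)) /\
  measurable_fun setT (fun v : plane => complex.Im (a * plane_point v ^+ n)).
  have := @measurable_Re_Im (fun=> a); apply; exact: measurable_cst.
have [hr hi] := h0 (Num.conj c) q.
have conjRe a : complex.Re (Num.conj a) = complex.Re a := Re_conj a.
have conjIm a : complex.Im (Num.conj a) = - complex.Im a by case: a.
have mr : measurable_fun setT (fun v : plane => complex.Re (c * Num.conj (plane_point v) ^+ q)).
  have -> : (fun v : plane => complex.Re (c * Num.conj (plane_point v) ^+ q)) =
     (fun v => complex.Re (Num.conj c * plane_point v ^+ q)).
    by apply/funext => v; rewrite -[LHS]conjRe rmorphM /= rmorphXn /= conjCK.
  exact: hr.
have mi : measurable_fun setT (fun v : plane => complex.Im (c * Num.conj (plane_point v) ^+ q)).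
  have -> : (fun v : plane => complex.Im (c * Num.conj (plane_point v) ^+ q)) =
     (fun v => - complex.Im (Num.conj c * plane_point v ^+ q)).
    by apply/funext => v; rewrite -[c * _]conjCK conjIm rmorphM /= rmorphXn /= conjCK.
  by apply: measurable_funN; exact: hi.
have [h _] := measurable_Re_Im mr mi p.
by rewrite /mono; under eq_fun do rewrite mulrAC.
Qed.

Lemma cabs_plane_point rho v : 0 <= rho -> disk rho v -> cabs (plane_point v) <= rho.
Proof.
move=> r0 h; rewrite -(ler_pXn2r (ltn0Sn 1)) ?nnegrE ?cabs_ge0// cabs_sqr.
exact: ltW.
Qed.

Lemma mono_bound rho c p q v : 0 <= rho -> disk rho v ->
  `|mono c p q v| <= cabs c * (rho ^+ p * rho ^+ q).
Proof.
move=> r0 h; apply: le_trans (le_Re_cabs _) _.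
rewrite -mulrA !cabsM !cabsX cabs_conj ler_wpM2l ?cabs_ge0//.
have hc := cabs_plane_point r0 h.
by apply: ler_pM; rewrite ?exprn_ge0 ?cabs_ge0// lerXn2r ?nnegrE ?cabs_ge0.
Qed.

(** The derivative of [u = (rho^2 - |z|^2) z^p conj(z)^q] in the direction
    [alpha] is [alpha u_z + conj(alpha) u_zbar]. *)
Definition du_z rho p q z : R[i] :=
  p%:R * (rho ^+ 2)%:C * z ^+ p.-1 * Num.conj z ^+ q
  - p.+1%:R * z ^+ p * Num.conj z ^+ q.+1.
Definition du_zbar rho p q z : R[i] :=
  q%:R * (rho ^+ 2)%:C * z ^+ p * Num.conj z ^+ q.-1
  - q.+1%:R * z ^+ p.+1 * Num.conj z ^+ q.

(** The function [u] on the line with direction [alpha] through [beta]. *)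
Definition chord_poly rho p q (alpha beta : R[i]) : {poly R[i]} :=
  let Z := alpha *: 'X + beta%:P in
  let Zb := Num.conj alpha *: 'X + (Num.conj beta)%:P in
  (rho ^+ 2)%:C *: (Z ^+ p * Zb ^+ q) - Z ^+ p.+1 * Zb ^+ q.+1.

Lemma conj_line (alpha beta : R[i]) (t : R) :
  Num.conj (alpha * t%:C + beta) = Num.conj alpha * t%:C + Num.conj beta.
Proof. by rewrite rmorphD rmorphM; congr (_ * _ + _); exact: conjR. Qed.

Lemma chord_polyE rho p q alpha beta (t : R) :
  (chord_poly rho p q alpha beta).[t%:C] =
  let z := alpha * t%:C + beta in
  ((rho ^+ 2)%:C - z * Num.conj z) * (z ^+ p * Num.conj z ^+ q).
Proof.
cbv zeta; rewrite conj_line /chord_poly.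
rewrite hornerD hornerN hornerZ !hornerM !horner_exp.
rewrite !hornerD !hornerZ hornerX !hornerC.
move: (alpha * _ + _) (Num.conj alpha * _ + _) => z zb.
rewrite (exprS z p) (exprS zb q).
by ring.
Qed.

Lemma deriv_chord_poly rho p q alpha beta (t : R) :
  (chord_poly rho p q alpha beta)^`().[t%:C] =
  let z := alpha * t%:C + beta in
  alpha * du_z rho p q z + Num.conj alpha * du_zbar rho p q z.
Proof.
cbv zeta; rewrite /du_z /du_zbar conj_line /chord_poly.
set Z := alpha *: 'X + beta%:P; set Zb := Num.conj alpha *: 'X + (Num.conj beta)%:P.
have dZ : Z^`() = alpha%:P by rewrite /Z derivD derivZ derivX derivC addr0 alg_polyC.
have dZb : Zb^`() = (Num.conj alpha)%:P by rewrite /Zb derivD derivZ derivX derivC addr0 alg_polyC.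
have hZ : Z.[t%:C] = alpha * t%:C + beta by rewrite /Z !hornerE.
have hZb : Zb.[t%:C] = Num.conj alpha * t%:C + Num.conj beta by rewrite /Zb !hornerE.
have H m n : ((Z ^+ m * Zb ^+ n)^`()).[t%:C] =
    m%:R * alpha * Z.[t%:C] ^+ m.-1 * Zb.[t%:C] ^+ n +
    n%:R * Num.conj alpha * Z.[t%:C] ^+ m * Zb.[t%:C] ^+ n.-1.
  rewrite derivM !deriv_exp dZ dZb hornerD 2!hornerM 2!hornerMn 2!hornerM.
  rewrite !horner_exp !hornerC.
  rewrite -(mulr_natl _ m) -(mulr_natl _ n).
  move: (m%:R : R[i]) (n%:R : R[i]) (Z.[_] ^+ _) (Z.[_] ^+ _) (Zb.[_] ^+ _) (Zb.[_] ^+ _) => *; ring.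
rewrite -hZ -hZb derivB derivZ hornerD hornerN hornerZ !H.
move: (Z.[_]) (Zb.[_]) (rho ^+ 2)%:C => z zb r; rewrite !succnK.
move: (z ^+ p) (z ^+ p.-1) (z ^+ p.+1) (zb ^+ q) (zb ^+ q.-1) (zb ^+ q.+1) => ? ? ? ? ? ?.
move: (p%:R : R[i]) (q%:R : R[i]) (p.+1%:R : R[i]) (q.+1%:R : R[i]) => ? ? ? ?.
ring.
Qed.

Section Recursion.
Variable rho : R.
Hypothesis r0 : 0 <= rho.

Let mD : measurable (disk rho) := measurable_disk rho.

Definition disk_bounded f :=
  measurable_fun setT f /\ exists C : R, forall v, disk rho v -> `|f v| <= C.

Lemma disk_bounded_integrable f : disk_bounded f ->
  area.-integrable (disk rho) (EFin \o f).
Proof. by move=> [mf [C hC]]; exact: disk_integrable mf hC. Qed.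

Lemma disk_bounded_mono c p q : disk_bounded (mono c p q).
Proof.
split; first exact: measurable_mono.
by exists (cabs c * (rho ^+ p * rho ^+ q)) => v; exact: mono_bound.
Qed.

Lemma disk_boundedD f g : disk_bounded f -> disk_bounded g ->
  disk_bounded (fun v => f v + g v).
Proof.
move=> [mf [C hC]] [mg [C' hC']]; split; first exact: measurable_funD.
exists (C + C') => v Dv; apply: le_trans (ler_normD _ _) _.
by rewrite lerD ?hC ?hC'.
Qed.

Lemma disk_boundedZ (r : R) f : disk_bounded f -> disk_bounded (fun v => r * f v).
Proof.
move=> [mf [C hC]]; split; first by apply: measurable_funM => //; exact: measurable_cst.
by exists (`|r| * C) => v Dv; rewrite normrM ler_wpM2l// hC.
Qed.

Lemma disk_bounded_sum (I : Type) (s : seq I) (F : I -> plane -> R) :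
  (forall i, disk_bounded (F i)) -> disk_bounded (fun v => \sum_(i <- s) F i v).
Proof.
move=> h; elim: s => [|i s ih].
  under eq_fun do rewrite big_nil.
  by split; [exact: measurable_cst | exists 0 => v _; rewrite normr0].
by under eq_fun do rewrite big_cons; exact: disk_boundedD.
Qed.

Lemma disk_intD f g : disk_bounded f -> disk_bounded g ->
  \int[area]_(v in disk rho) (f v + g v) =
  \int[area]_(v in disk rho) f v + \int[area]_(v in disk rho) g v.
Proof.
by move=> hf hg; rewrite RintegralD//; exact: disk_bounded_integrable.
Qed.

Lemma disk_intZ (r : R) f : disk_bounded f ->
  \int[area]_(v in disk rho) (r * f v) = r * \int[area]_(v in disk rho) f v.
Proof. by move=> hf; rewrite RintegralZl//; exact: disk_bounded_integrable. Qed.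

Lemma disk_int_sum (I : Type) (s : seq I) (F : I -> plane -> R) :
  (forall i, disk_bounded (F i)) ->
  \int[area]_(v in disk rho) (\sum_(i <- s) F i v) =
  \sum_(i <- s) \int[area]_(v in disk rho) F i v.
Proof.
move=> h; elim: s => [|i s ih].
  rewrite big_nil -[RHS](mul0r (\int[area]_(v in disk rho) mono 0 0 0 v)).
  rewrite -disk_intZ; last exact: disk_bounded_mono.
  by apply: eq_Rintegral => v _; rewrite big_nil mul0r.
rewrite big_cons -ih -disk_intD//; last exact: disk_bounded_sum.
by apply: eq_Rintegral => v _; rewrite big_cons.
Qed.

Definition moment c p q : R := \int[area]_(v in disk rho) mono c p q v.

Lemma moment_conj c p q : moment c p q = moment (Num.conj c) q p.
Proof.
apply: eq_Rintegral => v _; rewrite /mono -[RHS]Re_conj !rmorphM /= !rmorphXn /= !conjCK.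
by rewrite mulrAC.
Qed.

Lemma plane_point_x x y : plane_point (x, y) = 1 * x%:C + 'i * y%:C :> R[i].
Proof. by rewrite mul1r addrC /plane_point /=; congr (_ +i* _); ring. Qed.

Lemma plane_point_y x y : plane_point (x, y) = 'i * y%:C + x%:C :> R[i].
Proof. by rewrite /plane_point /=; congr (_ +i* _); ring. Qed.

Lemma plane_point_norm (x y : R) : x ^+ 2 + y ^+ 2 = rho ^+ 2 ->
  (rho ^+ 2)%:C - plane_point (x, y) * Num.conj (plane_point (x, y)) = 0 :> R[i].
Proof. by move=> <-; congr (_ +i* _) => /=; ring. Qed.

Let dz c p q v := complex.Re (c * du_z rho p q (plane_point v)).
Let dzb c p q v := complex.Re (c * du_zbar rho p q (plane_point v)).

Let dzE c p q v : dz c p q v =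
  (p%:R * rho ^+ 2) * mono c p.-1 q v + (- p.+1%:R) * mono c p q.+1 v.
Proof.
rewrite /dz /du_z /mono -!ReZ -ReD; congr complex.Re.
rewrite rmorphN rmorphM !rmorph_nat /=; ring.
Qed.

Let dzbE c p q v : dzb c p q v =
  (q%:R * rho ^+ 2) * mono c p q.-1 v + (- q.+1%:R) * mono c p.+1 q v.
Proof.
rewrite /dzb /du_zbar /mono -!ReZ -ReD; congr complex.Re.
rewrite rmorphN rmorphM !rmorph_nat /=; ring.
Qed.

Let db_dz c p q : disk_bounded (dz c p q).
Proof.
rewrite (funext (dzE c p q)); apply: disk_boundedD; apply: disk_boundedZ;
  exact: disk_bounded_mono.
Qed.

Let db_dzb c p q : disk_bounded (dzb c p q).
Proof.
rewrite (funext (dzbE c p q)); apply: disk_boundedD; apply: disk_boundedZ;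
  exact: disk_bounded_mono.
Qed.

Let int_x c p q :
  \int[area]_(v in disk rho) (dz c p q v + dzb c p q v) = 0.
Proof.
have [mf [C hC]] := disk_boundedD (db_dz c p q) (db_dzb c p q).
rewrite /Rintegral (disk_derivative_x (u := fun y =>
  re_poly (c *: chord_poly rho p q 1 ('i * y%:C))) mf hC)//.
  move=> t s ts; rewrite horner_re_poly hornerZ chord_polyE /= -plane_point_x.
  by rewrite plane_point_norm// mul0r mulr0.
move=> x y; rewrite deriv_re_poly horner_re_poly derivZ hornerZ deriv_chord_poly.
by rewrite /= -plane_point_x rmorph1 !mul1r mulrDr ReD.
Qed.

Let int_y c p q :
  \int[area]_(v in disk rho) (dz c p q v + - 1 * dzb c p q v) = 0.
Proof.
have [mf [C hC]] := disk_boundedD (db_dz c p q) (disk_boundedZ (- 1) (db_dzb c p q)).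
rewrite /Rintegral (disk_derivative_y (u := fun x =>
  re_poly ((- 'i * c) *: chord_poly rho p q 'i (x%:C))) mf hC)//.
  move=> t s ts; rewrite horner_re_poly hornerZ chord_polyE /= -plane_point_y.
  by rewrite plane_point_norm ?mul0r ?mulr0// addrC.
move=> x y; rewrite deriv_re_poly horner_re_poly derivZ hornerZ deriv_chord_poly.
rewrite -plane_point_y /dz /dzb.
have -> : Num.conj ('i : R[i]) = - 'i by congr (_ +i* _); rewrite /= ?oppr0.
move: (du_z _ _ _ _) (du_zbar _ _ _ _) => [a b] [a' b']; clear C mf hC; case: c => e e' /=; ring.
Qed.

(** The integrals of [u_z + u_zbar] and [u_z - u_zbar] vanish, as these are the
    derivatives of [u] along the axes, up to a constant factor; hence so does that
    of [u_z], a combination of the two monomials. *)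
Lemma moment_rec c p q :
  p.+1%:R * moment c p q.+1 = p%:R * rho ^+ 2 * moment c p.-1 q.
Proof.
have hx := int_x c p q; have hy := int_y c p q.
rewrite disk_intD// in hx; rewrite disk_intD ?disk_intZ// in hy; last exact: disk_boundedZ.
have : \int[area]_(v in disk rho) dz c p q v = 0 by lra.
under eq_Rintegral do rewrite dzE.
rewrite disk_intD ?disk_intZ; try by [exact: disk_bounded_mono | apply: disk_boundedZ; exact: disk_bounded_mono].
rewrite -/(moment _ _ _) -/(moment _ _ _); lra.
Qed.

Lemma moment_offdiag c p q : (p < q)%N -> moment c p q = 0.
Proof.
elim: p q => [|p ih] [//|q] pq.
  by have := moment_rec c 0 q; rewrite mul1r !mul0r.
have := moment_rec c p.+1 q; rewrite ih// mulr0 => /eqP.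
by rewrite mulf_eq0 pnatr_eq0 => /eqP.
Qed.

(** The recursion lowers both exponents, until one of them is zero. *)
Lemma moment_neq c p q : p != q -> moment c p q = 0.
Proof.
rewrite neq_ltn => /orP[pq|qp]; first exact: moment_offdiag.
by rewrite moment_conj moment_offdiag.
Qed.

Lemma moment_diag c p : p.+1%:R * moment c p p = rho ^+ p.*2 * moment c 0 0.
Proof.
elim: p => [|p ih]; first by rewrite -[RHS]/(1 * moment c 0 0).
by rewrite moment_rec /= mulrAC ih doubleS !exprS; ring.
Qed.

End Recursion.
End Moments.

Section DiskArea.
Context {R : realType}.
Local Notation plane := (measurableTypeR R * measurableTypeR R)%type.
Local Notation area := ((lebesgue_measure \x lebesgue_measure)%E : {measure set plane -> \bar R}).

Lemma chord_length (rho x : R) :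
  lebesgue_measure (xsection (disk rho) (x : measurableTypeR R)) =
  (2 * Num.sqrt (rho ^+ 2 - x ^+ 2))%:E.
Proof.
set w := Num.sqrt _.
have -> : xsection (disk rho) (x : measurableTypeR R) = `]- w, w[%classic.
  apply/seteqP; split=> y /=; rewrite /xsection /= in_setE /disk /= in_itv /= -ltr_norml => h.
    rewrite -sqrtr_sqr ltr_sqrt; first by lra.
    by have := sqr_ge0 y; lra.
  have w0 : 0 < w by apply: le_lt_trans h.
  move: (w0); rewrite sqrtr_gt0 => r0.
  have : `|y| ^+ 2 < w ^+ 2 by rewrite ltr_pXn2r ?nnegrE ?(ltW w0).
  by rewrite -normrX ger0_norm ?sqr_ge0// sqr_sqrtr ?(ltW r0)//; lra.
rewrite lebesgue_measure_itv /= lte_fin.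
have w0 : 0 <= w := sqrtr_ge0 _.
case: ifPn => [_|]; first by rewrite -EFinB; congr (_%:E); ring.
rewrite -leNgt => h; have -> : w = 0 by lra.
by rewrite mulr0.
Qed.

Lemma half_disk (rho : R) : 0 < rho ->
  (\int[lebesgue_measure]_(x in `[(- rho)%R, rho]) ((2 * Num.sqrt (rho ^+ 2 - x ^+ 2))%R)%:E =
  (pi * rho ^+ 2)%:E)%E.
Proof.
(* substitute [x = rho * sin t] *)
move=> r0; pose Fs (t : R) := rho * sin t; pose G (x : R) := 2 * Num.sqrt (rho ^+ 2 - x ^+ 2).
have p0 : 0 < pi / 2 :> R by rewrite divr_gt0 ?pi_gt0.
have pp : - (pi / 2) < pi / 2 :> R by rewrite gtrN.
have dF (t : R) : is_derive t 1 Fs (rho * cos t).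
  by rewrite /Fs; apply: is_derive_eq.
have dFE : derive1 Fs = (fun t => rho * cos t).
  by apply/funext => t; rewrite derive1E; apply: derive_val.
have cF : continuous Fs by move=> t; apply: cvgMr; exact: continuous_sin.
have Fa : Fs (- (pi / 2)) = - rho by rewrite /Fs sinN sin_pihalf mulrN mulr1.
have Fb : Fs (pi / 2) = rho by rewrite /Fs sin_pihalf mulr1.
have cG : continuous G.
  move=> x; apply: cvgMr; apply: continuous_comp; last exact: sqrt_continuous.
  by apply: cvgB; [exact: cvg_cst | exact: exprn_continuous].
have cdF : continuous (fun t : R => rho * cos t) by move=> t; apply: cvgMr; exact: continuous_cos.
have := @integration_by_substitution_increasing _ Fs G _ _ (ltW pp).
rewrite Fa Fb => -> //; last first.
- exact: continuous_subspaceT.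
- split; first by move=> t _; exact: ex_derive.
  + by apply: cvg_at_right_filter; exact: cF.
  + by apply: cvg_at_left_filter; exact: cF.
- by rewrite dFE; apply/cvg_ex; eexists; apply: cvg_at_left_filter; exact: cdF.
- by rewrite dFE; apply/cvg_ex; eexists; apply: cvg_at_right_filter; exact: cdF.
- by rewrite dFE => t _; exact: cdF.
- by move=> s t hs ht st; rewrite /Fs ltr_pM2l// ltr_sin.
pose H (t : R) := rho ^+ 2 * (t + sin t * cos t).
pose h (t : R) := 2 * (rho * cos t) ^+ 2.
have dH (t : R) : is_derive t 1 H (h t).
  apply: is_derive_eq.
  rewrite /GRing.scale /= /h exprMn.
  have -> : 1 + (sin t * - sin t + cos t * cos t) = 2 * cos t ^+ 2.
    by have := cos2Dsin2 t; rewrite !expr2; lra.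
  ring.
have dHE : derive1 H = h by apply/funext => t; rewrite derive1E; apply: derive_val.
have cH : continuous H.
  by move=> t; apply: differentiable_continuous; apply/derivable1_diffP; exact: ex_derive.
have ch : continuous h.
  move=> t; apply: cvgMr; apply: (@continuous_comp _ _ _ (fun t => rho * cos t) (fun x => x ^+ 2)).
    exact: cdF.
  exact: exprn_continuous.
transitivity (\int[lebesgue_measure]_(x in `[(- (pi / 2))%R, (pi / 2)%R]) ((h x)%R)%:E)%E.
  apply: eq_integral => t; rewrite inE /= in_itv /= => tp; congr EFin.
  rewrite dFE /= /GRing.mul /= /G /Fs /h.
  have ct := cos_ge0_pihalf tp.
  have -> : rho ^+ 2 - (rho * sin t) ^+ 2 = (rho * cos t) ^+ 2.
    by rewrite !exprMn cos2sin2; ring.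
  by rewrite sqrtr_sqr ger0_norm ?mulr_ge0 ?(ltW r0)// expr2 mulrA.
rewrite (@continuous_FTC2 _ h H)//.
- rewrite /H sinN cosN sin_pihalf cos_pihalf !mulr0 !addr0 -EFinB; congr (_%:E).
  by rewrite mulrN opprK -mulrDr -splitr mulrC.
- exact: continuous_subspaceT.
- split; first by move=> t _; exact: ex_derive.
  + by apply: cvg_at_right_filter; exact: cH.
  + by apply: cvg_at_left_filter; exact: cH.
by rewrite dHE.
Qed.

Lemma area_disk (rho : R) : 0 < rho -> area (disk rho) = (pi * rho ^+ 2)%:E.
Proof.
move=> r0; rewrite -half_disk// /product_measure1 /=.
rewrite [RHS]integral_mkcond /=; apply: eq_integral => x _.
rewrite [LHS]chord_length patchE; case: ifPn => // /negP.
rewrite inE /= in_itv /= -ler_norml => /negP; rewrite -ltNge => h.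
rewrite (_ : Num.sqrt _ = 0) ?mulr0//; apply/eqP; rewrite sqrtr_eq0.
rewrite subr_le0 -[x ^+ 2]ger0_norm ?sqr_ge0// normrX lerXn2r ?nnegrE ?(ltW r0) ?(ltW h)//.
Qed.

Lemma moment00 (rho : R) (c : R[i]) : 0 < rho -> moment rho c 0 0 = complex.Re c * (pi * rho ^+ 2).
Proof.
move=> r0; rewrite /moment.
have -> : (fun v => mono c 0 0 v) = (fun=> complex.Re c).
  by apply/funext => v; rewrite /mono !expr0 !mulr1.
rewrite Rintegral_cst; last exact: measurable_disk.
by rewrite area_disk.
Qed.

Lemma momentE (rho : R) (c : R[i]) p q : 0 < rho ->
  moment rho c p q = if p == q then complex.Re c * (pi * rho ^+ p.*2.+2 / p.+1%:R) else 0.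
Proof.
move=> r0; case: eqP => [->|/eqP pq]; last exact: moment_neq (ltW r0) _ _ _ pq.
have n0 : q.+1%:R != 0 :> R by rewrite pnatr_eq0.
apply: (mulfI n0); rewrite moment_diag ?ltW// moment00// !exprS.
by field; rewrite addrC natr1 -natr1 addrC.
Qed.

End DiskArea.

Section DiskNorm.
Context {R : realType} {K : hilbertType R}.
Local Notation plane := (measurableTypeR R * measurableTypeR R)%type.
Local Notation area := ((lebesgue_measure \x lebesgue_measure)%E : {measure set plane -> \bar R}).
Variables (a : nat -> K) (f : R[i] -> K).
Hypothesis fa : power_series a f.
Implicit Types (v : plane) (rho : R).

Lemma inner_suml (I : Type) (r : seq I) (F : I -> K) (y : K) :
  inner (\sum_(i <- r) F i) y = \sum_(i <- r) inner (F i) y.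
Proof.
by elim/big_ind2: _ => [|x p z q <- <-|//]; [exact: inner0l | rewrite innerDl].
Qed.

Lemma inner_sumr (I : Type) (r : seq I) (F : I -> K) (y : K) :
  inner y (\sum_(i <- r) F i) = \sum_(i <- r) inner y (F i).
Proof.
by elim/big_ind2: _ => [|x p z q <- <-|//]; [exact: inner0r | rewrite innerDr].
Qed.

Lemma Re_sum (I : Type) (r : seq I) (F : I -> R[i]) :
  complex.Re (\sum_(i <- r) F i) = \sum_(i <- r) complex.Re (F i).
Proof. by elim/big_ind2: _ => [|x p z q <- <-|//] //; rewrite ReD. Qed.

Lemma cvg_EFin_seq (u : nat -> R) (l : R) :
  u @ \oo --> l -> (fun n => (u n)%:E) @ \oo --> l%:E.
Proof. by move=> h; apply: cvg_EFin => //; exact: nearW. Qed.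

Let w v : R := (1 - cabs (plane_point v) ^+ 2) * rnorm (f (plane_point v)) ^+ 2.

Let wN N v : R := (1 - cabs (plane_point v) ^+ 2) *
  rnorm (series (fun n => plane_point v ^+ n *: a n) N) ^+ 2.

Let mN N v : R := \sum_(0 <= n < N) \sum_(0 <= m < N)
  (mono (inner (a n) (a m)) n m v + - 1 * mono (inner (a n) (a m)) n.+1 m.+1 v).

Let wNE N v : wN N v = mN N v.
Proof.
rewrite /wN /mN /series /= rnorm_sqr inner_suml -ReZ mulr_sumr Re_sum.
apply: eq_bigr => n _; rewrite inner_sumr mulr_sumr Re_sum.
apply: eq_bigr => m _; rewrite mulN1r /mono -ReN -ReD; congr complex.Re.
have -> : (1 - cabs (plane_point v) ^+ 2)%:C = 1 - plane_point v * Num.conj (plane_point v) :> R[i].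
  by rewrite -normCK cabsE rmorphB rmorphXn rmorph1.
by rewrite innerZl innerZr rmorphXn /= !exprS; ring.
Qed.

Let weight rho n : R := pi * (rho ^+ n.*2.+2 / n.+1%:R - rho ^+ n.*2.+4 / n.+2%:R).

Let weight_ge0 rho n : 0 < rho -> rho <= 1 -> 0 <= weight rho n.
Proof.
move=> r0 r1; rewrite /weight mulr_ge0 ?pi_ge0// subr_ge0.
apply: ler_pM; rewrite ?exprn_ge0 ?invr_ge0 ?(ltW r0)//.
  by rewrite ler_wiXn2l ?(ltW r0)// !ltnS leqW.
by rewrite lef_pV2 ?posrE ?ltr0n// ler_nat.
Qed.

Let bounded_mN rho n m : 0 < rho -> disk_bounded rho (fun v =>
  mono (inner (a n) (a m)) n m v + - 1 * mono (inner (a n) (a m)) n.+1 m.+1 v).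
Proof.
move=> r0; apply: disk_boundedD; first exact: (disk_bounded_mono (ltW r0)).
by apply: disk_boundedZ; exact: (disk_bounded_mono (ltW r0)).
Qed.

Let bounded_wN rho N : 0 < rho -> disk_bounded rho (wN N).
Proof.
move=> r0; rewrite (funext (wNE N)); apply: disk_bounded_sum => n.
by apply: disk_bounded_sum => m; exact: bounded_mN.
Qed.

Let int_term rho (c : R[i]) n m : 0 < rho ->
  \int[area]_(v in disk rho) (mono c n m v + - 1 * mono c n.+1 m.+1 v) =
  moment rho c n m - moment rho c n.+1 m.+1.
Proof.
move=> /ltW r0; have h p q := disk_bounded_mono r0 c p q.
by rewrite disk_intD// ?disk_intZ ?mulN1r//; exact: disk_boundedZ.
Qed.

Let int_wN rho N : 0 < rho ->
  \int[area]_(v in disk rho) wN N v = \sum_(0 <= n < N) rnorm (a n) ^+ 2 * weight rho n.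
Proof.
move=> r0; under eq_Rintegral do rewrite wNE.
rewrite (disk_int_sum (ltW r0)); last by move=> n; apply: disk_bounded_sum => m; exact: bounded_mN.
rewrite !big_mkord; apply: eq_bigr => n _.
rewrite (disk_int_sum (ltW r0)); last by move=> m; exact: bounded_mN.
rewrite big_mkord (bigD1 n)//= big1 ?addr0 => [|m mn]; rewrite int_term// !momentE//.
  by rewrite !eqxx -rnorm_sqr /weight doubleS; ring.
have nm : (n == m :> nat) = false by rewrite eq_sym; apply/negbTE.
by rewrite eqSS nm subr0.
Qed.

Let wN_ge0 rho N v : 0 < rho -> rho <= 1 -> disk rho v -> 0 <= wN N v.
Proof.
move=> r0 r1 Dv; rewrite /wN mulr_ge0 ?sqr_ge0// subr_ge0 expr_le1 ?cabs_ge0//.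
exact: le_trans (cabs_plane_point (ltW r0) Dv) r1.
Qed.

Let disk1 v : disk 1 v <-> unit_disk (plane_point v).
Proof.
rewrite unit_diskE /disk /= expr1n -[X in X < 1](cabs_sqr (plane_point v)).
by rewrite expr_lt1// cabs_ge0.
Qed.

Let disk_sub rho v : 0 < rho -> rho <= 1 -> disk rho v -> disk 1 v.
Proof.
move=> r0 r1; rewrite /disk /= => h; apply: lt_le_trans h _.
by rewrite expr1n expr_le1// ltW.
Qed.

Let wN_cvg v : disk 1 v -> (fun N => wN N v) @ \oo --> w v.
Proof.
move=> /disk1 /fa fv; apply: cvgMr.
have : (fun N => rnorm (series (fun n => plane_point v ^+ n *: a n) N)) @ \oo --> rnorm (f (plane_point v)).
  move/cvg_seq: fv => h; apply/cvg_seqR => e /h [N hN]; exists N => n /hN H.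
  apply: le_lt_trans H; set x := series _ _; set y := f _.
  have := rnormD (x - y) y; have := rnormD (y - x) x; rewrite !subrK [rnorm (y - x)]rnormC.
  by move=> h1 h2; rewrite ler_norml; apply/andP; split; lra.
move=> h; exact: (cvgM h h).
Qed.

Let mw : measurable_fun (disk 1) w.
Proof.
apply: (measurable_fun_cvg (h := wN)).
- by move=> N; have [h _] := bounded_wN N ltr01; exact: measurable_funTS.
- by move=> v; exact: wN_cvg.
Qed.

Let mw_rho rho : 0 < rho -> rho <= 1 -> measurable_fun (disk rho) w.
Proof.
move=> r0 r1; apply: measurable_funS mw; first exact: measurable_disk.
by move=> v; exact: disk_sub.
Qed.

Let w_ge0 v : disk 1 v -> 0 <= w v.
Proof.
move=> Dv; rewrite /w mulr_ge0 ?sqr_ge0// subr_ge0 expr_le1 ?cabs_ge0//.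
by have := cabs_plane_point ler01 Dv.
Qed.

Let total N : R := \sum_(0 <= n < N) rnorm (a n) ^+ 2 * (pi / (n.+1%:R * n.+2%:R)).

Let weight1 n : weight 1 n = pi / (n.+1%:R * n.+2%:R).
Proof.
rewrite /weight !expr1n -[n.+2%:R]natr1.
have : 0 < n.+1%:R :> R by rewrite ltr0n.
by move: (n.+1%:R : R) => x x0; field; rewrite !gt_eqF// addr_gt0.
Qed.

(** The integral over a smaller disk dominates each partial sum of moments. *)
Let lower_rho rho N : 0 < rho -> rho < 1 ->
  ((\sum_(0 <= n < N) rnorm (a n) ^+ 2 * weight rho n)%:E <=
   \int[area]_(v in disk 1) (w v)%:E)%E.
Proof.
move=> r0 r1; have aa := power_series_abel fa.
have [C hC] := abel_summable aa (ltW r0) r1.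
have C0 : 0 <= C by have := hC 0%N; rewrite big_geq.
have bnd M v : disk rho v -> `|wN M v| <= C ^+ 2.
  move=> Dv; have zr := cabs_plane_point (ltW r0) Dv.
  rewrite ger0_norm ?(wN_ge0 M r0 (ltW r1) Dv)// /wN -[X in _ <= X]mul1r.
  have c1 : cabs (plane_point v) <= 1 := le_trans zr (ltW r1).
  apply: ler_pM; rewrite ?sqr_ge0//.
  - by rewrite subr_ge0 expr_le1 ?cabs_ge0.
  - by rewrite gerBl sqr_ge0.
  rewrite lerXn2r ?nnegrE ?rnorm_ge0//; apply: le_trans (rnorm_sum _ _) _.
  by apply: le_trans (hC M); exact: abel_partial_le.
have [] := @dominated_convergence _ _ _ area (disk rho) (measurable_disk rho)
  (fun M => EFin \o wN M) (EFin \o w) (EFin \o cst (C ^+ 2)).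
- by move=> M; apply/measurable_EFinP; have [h _] := bounded_wN M r0; exact: measurable_funTS.
- by apply/measurable_EFinP; exact: mw_rho r0 (ltW r1).
- apply: aeW => v Dv; apply: cvg_EFin; first exact: nearW.
  by apply: wN_cvg; exact: disk_sub r0 (ltW r1) Dv.
- by apply: (disk_integrable (C := `|C ^+ 2|)) => //; exact: measurable_cst.
- by apply: aeW => v M Dv; rewrite /= lee_fin; exact: bnd.
move=> _ _ hcvg.
apply: (@le_trans _ _ (\int[area]_(v in disk rho) (w v)%:E)%E); last first.
  apply: ge0_subset_integral; [exact: measurable_disk | exact: measurable_disk | | |].
  - by apply/measurable_EFinP; exact: mw.
  - by move=> v Dv; rewrite lee_fin; exact: w_ge0.
  - by move=> v; exact: disk_sub r0 (ltW r1).
have hlim := cvg_lim (@ereal_hausdorff R) hcvg.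
rewrite -hlim; apply: lime_ge; first by apply/cvg_ex; eexists; exact: hcvg.
exists N => // M /= NM.
have -> : (\int[area]_(v in disk rho) (EFin \o wN M) v)%E =
   (\sum_(0 <= n < M) rnorm (a n) ^+ 2 * weight rho n)%:E.
  rewrite -int_wN// fineK//.
  by apply: integrable_fin_num; [exact: measurable_disk | exact: disk_bounded_integrable (bounded_wN M r0)].
rewrite lee_fin [X in _ <= X](big_cat_nat (leq0n N) NM)/= lerDl.
by apply: sumr_ge0 => n _; rewrite mulr_ge0 ?sqr_ge0// weight_ge0// ltW.
Qed.

Let lower N : ((total N)%:E <= \int[area]_(v in disk 1) (w v)%:E)%E.
Proof.
pose rho k : R := 1 - k.+2%:R^-1.
have rho1 k : rho k < 1 by rewrite /rho gtrBl invr_gt0.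
have rho0 k : 0 < rho k by rewrite /rho subr_gt0 invf_lt1// ltr1n.
have rc : rho @ \oo --> (1 : R).
  rewrite -[X in _ --> X](subr0 1); apply: cvgB; first exact: cvg_cst.
  have := @cvg_harmonic R; rewrite -cvg_shiftS; exact.
have h : (fun k => \sum_(0 <= n < N) rnorm (a n) ^+ 2 * weight (rho k) n) @ \oo --> total N.
  have wc n : (fun k => weight (rho k) n) @ \oo --> weight 1 n.
    apply: cvgMr; apply: cvgB; apply: cvgMl;
      exact: (cvg_comp _ _ rc (@exprn_continuous _ _ _)).
  rewrite /total; elim: N => [|N ih].
    by under eq_fun do rewrite big_geq//; rewrite big_geq//; exact: cvg_cst.
  under eq_fun do rewrite big_nat_recr//; rewrite big_nat_recr//=; apply: cvgD => //.
  by apply: cvgMr; rewrite -weight1; exact: wc.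
have hE := cvg_EFin_seq h.
rewrite -(cvg_lim (@ereal_hausdorff R) hE); apply: lime_le; first by apply/cvg_ex; eexists; exact: hE.
by apply: nearW => k; exact: lower_rho.
Qed.

Let upper : (\int[area]_(v in disk 1) (w v)%:E <=
  \sum_(0 <= n <oo) (rnorm (a n) ^+ 2 * (pi / (n.+1%:R * n.+2%:R)))%:E)%E.
Proof.
have p0 n : (0 <= (rnorm (a n) ^+ 2 * (pi / (n.+1%:R * n.+2%:R)))%:E)%E.
  by rewrite lee_fin mulr_ge0 ?sqr_ge0// divr_ge0 ?pi_ge0// mulr_ge0.
have := @fatou _ _ _ area (disk 1) (measurable_disk 1) (fun N v => (wN N v)%:E).
have -> : (\int[area]_(v in disk 1) limn_einf (fun N => (wN N v)%:E) =
    \int[area]_(v in disk 1) (w v)%:E)%E.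
  apply: eq_integral => v; rewrite inE => Dv.
  have hv := cvg_EFin_seq (wN_cvg Dv).
  rewrite is_cvg_limn_einfE; first exact: (cvg_lim (@ereal_hausdorff R) hv).
  by apply/cvg_ex; eexists; exact: hv.
move=> h; apply: le_trans (h _ _) _.
- by move=> N; apply/measurable_EFinP; have [m _] := bounded_wN N ltr01; exact: measurable_funTS.
- by move=> N v Dv; rewrite lee_fin (wN_ge0 _ ltr01).
have -> : (fun N => \int[area]_(v in disk 1) (wN N v)%:E)%E = (fun N => (total N)%:E).
  apply/funext => N; rewrite /total; under eq_bigr do rewrite -weight1.
  rewrite -int_wN// fineK//.
  by apply: integrable_fin_num; [exact: measurable_disk | exact: disk_bounded_integrable (bounded_wN N ltr01)].
rewrite is_cvg_limn_einfE.
  by rewrite /total; under eq_fun do rewrite -sumEFin.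
by rewrite /total; under eq_fun do rewrite -sumEFin; apply: is_cvg_nneseries.
Qed.

(** On a disk of radius [rho < 1] the partial sums converge boundedly, and their
    integrals are diagonal by [momentE]; letting [rho] tend to one gives the lower
    bound, and Fatou's lemma the upper one. *)
Lemma disk_norm_power_series :
  ((pi^-1)%:E * \int[area]_(v in plane_point @^-1` unit_disk)
     ((1 - cabs (plane_point v) ^+ 2) * rnorm (f (plane_point v)) ^+ 2)%:E =
   \sum_(0 <= n <oo) (rnorm (a n) ^+ 2 / (n.+1%:R * n.+2%:R))%:E)%E.
Proof.
have -> : @plane_point R @^-1` unit_disk = disk 1.
  by apply/funext => v; apply/propext; split=> /disk1.
have pi0 : (pi : R) != 0 by rewrite gt_eqF// pi_gt0.
have -> : (\int[area]_(v in disk 1)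
     ((1 - cabs (plane_point v) ^+ 2) * rnorm (f (plane_point v)) ^+ 2)%:E =
   \sum_(0 <= n <oo) (rnorm (a n) ^+ 2 * (pi / (n.+1%:R * n.+2%:R)))%:E)%E.
  apply/eqP; rewrite eq_le upper /=; apply: lime_le.
    apply: is_cvg_nneseries => n _ _.
    by rewrite lee_fin mulr_ge0 ?sqr_ge0// divr_ge0 ?pi_ge0// mulr_ge0.
  by apply: nearW => N; rewrite sumEFin; exact: lower.
rewrite -nneseriesZl; last first.
  by move=> n _; rewrite lee_fin mulr_ge0 ?sqr_ge0// divr_ge0 ?pi_ge0// mulr_ge0.
apply: eq_eseriesr => n _; rewrite -EFinM; congr (_%:E).
by rewrite mulrCA [X in _ * X]mulrA mulVf// mul1r.
Qed.

End DiskNorm.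

(** * Spectral measures of unitary operators *)

Section BorelPlane.
Context {R : realType}.
Implicit Types (s t : set R[i]) (f : R[i] -> R).

(** The preimages of open rays are open. *)
Lemma measurable_lipschitz f : (forall z w, `|f z - f w| <= cabs (z - w)) ->
  measurable_fun setT (f : @borelC R -> R).
Proof.
move=> fL; apply: (measurability _ (RGenOInfty.measurableE R)) => //.
move=> _ [_ [x ->] <-]; apply: sub_sigma_algebra.
rewrite setTI openE => z; rewrite /= in_itv /= andbT => xz.
have e0 : 0 < f z - x by lra.
have : (id @ (nbhs (z : R[i]^o)) --> (z : R[i]^o)) by exact: cvg_id.
move=> /cvg_rnorm /(_ _ e0); apply: filterS => t /= ht; rewrite /= in_itv /= andbT.
have := fL t z; rewrite -[cabs _]/(rnorm (t - z : R[i]^o)) ler_norml.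
by move=> /andP[h _]; lra.
Qed.

Lemma measurable_cabsB w : measurable_fun setT (fun z : @borelC R => cabs (z - w)).
Proof.
apply: (@measurable_lipschitz (fun z => cabs (z - w))) => z t.
have := cabsD (z - t) (t - w); have := cabsD (t - z) (z - w); rewrite !subrKA.
have := cabsN (z - t); rewrite opprB ler_norml => -> h1 h2.
by apply/andP; split; lra.
Qed.

Lemma measurable_Re : measurable_fun setT (@complex.Re R : @borelC R -> R).
Proof. by apply: measurable_lipschitz => z t; rewrite -ReN -ReD; exact: le_Re_cabs. Qed.

Lemma measurable_Im : measurable_fun setT (@complex.Im R : @borelC R -> R).
Proof.
apply: measurable_lipschitz => z t; have -> : complex.Im z - complex.Im t = complex.Im (z - t).
  by case: z t => [? ?] [? ?].
exact: le_Im_cabs.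
Qed.

Lemma circleE z : unit_circle z <-> cabs z = 1 :> R.
Proof. by rewrite /unit_circle /= cabsE; split=> [[]|->]. Qed.

Lemma measurable_circle : measurable (unit_circle : set (@borelC R)).
Proof.
have -> : unit_circle = setT `&` (fun z => cabs (z - 0)) @^-1` [set (1 : R)].
  by apply/seteqP; split=> z; rewrite setTI /= subr0 circleE.
exact: (measurable_cabsB 0).
Qed.

Lemma borelT0 : borelT (set0 : set R[i]).
Proof. by split; [exact: sub0set | exact: (@measurable0 _ (@borelC R))]. Qed.

Lemma borelT_circle : borelT (unit_circle : set R[i]).
Proof. by split=> //; exact: measurable_circle. Qed.

Lemma borelT_trace (s : set (@borelC R)) : measurable s -> borelT (s `&` unit_circle).
Proof.
by move=> ms; split; [exact: subIsetr | apply: measurableI => //; exact: measurable_circle].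
Qed.

Lemma borelTI s t : borelT s -> borelT t -> borelT (s `&` t).
Proof. by move=> [sT ms] [_ mt]; split; [move=> z [/sT] | exact: (@measurableI _ (@borelC R))]. Qed.

Lemma borelTD s t : borelT s -> borelT t -> borelT (s `\` t).
Proof. by move=> [sT ms] [_ mt]; split; [move=> z [/sT] | exact: (@measurableD _ (@borelC R))]. Qed.

End BorelPlane.

Section SpectralMeasure.
Context {R : realType} {K : hilbertType R}.
Variables (H : set K) (U : K -> K) (F : set R[i] -> K -> K).
Hypotheses (cH : closed_subspace H) (FU : spectral_measure_of H U F).
Implicit Types (s t : set R[i]) (x y : K).

Let F_proj s : borelT s -> exists M, [/\ closed_subspace M, M `<=` H &
  forall x, H x -> F s x = orthoproj M x].
Proof. by case: FU => h _ _ _; exact: h. Qed.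

Lemma spectral_in s x : borelT s -> H x -> H (F s x).
Proof.
by move=> /F_proj [M [cM MH FM]] Hx; rewrite FM//; exact: MH (orthoproj_in cM _).
Qed.

Lemma spectral_linear s a x y : borelT s -> H x -> H y ->
  F s (a *: x + y) = a *: F s x + F s y.
Proof.
move=> /F_proj [M [cM MH FM]] Hx Hy; have [_ Hl _] := cH.
rewrite !FM//; last exact: Hl.
by case: (blin_proj cM) => ->.
Qed.

Lemma spectralD s x y : borelT s -> H x -> H y -> F s (x + y) = F s x + F s y.
Proof. by move=> bs Hx Hy; rewrite -[x]scale1r spectral_linear// !scale1r. Qed.

Lemma spectralZ s a x : borelT s -> H x -> F s (a *: x) = a *: F s x.
Proof.
move=> bs Hx; have [M [cM MH FM]] := F_proj bs.
by rewrite !FM ?(blinZ (blin_proj cM))//; exact: closed_subspaceZ.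
Qed.

Lemma spectralB s x y : borelT s -> H x -> H y -> F s (x - y) = F s x - F s y.
Proof.
move=> bs Hx Hy; rewrite spectralD//; last exact: closed_subspaceN.
by rewrite -scaleN1r spectralZ// scaleN1r.
Qed.

Lemma spectral_sym s x y : borelT s -> H x -> H y -> inner (F s x) y = inner x (F s y).
Proof. by move=> /F_proj [M [cM MH FM]] Hx Hy; rewrite !FM// orthoproj_sym. Qed.

Lemma spectral_idem s x : borelT s -> H x -> F s (F s x) = F s x.
Proof.
move=> bs Hx; have [M [cM MH FM]] := F_proj bs; have Mp := orthoproj_in cM x.
by rewrite (FM x Hx) (FM _ (MH _ Mp)) (orthoproj_id cM Mp).
Qed.

Lemma spectral_quad s x : borelT s -> H x -> inner (F s x) x = (rnorm (F s x) ^+ 2)%:C.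
Proof.
move=> bs Hx; rewrite -inner_norm -[in RHS]spectral_sym ?spectral_idem//.
exact: spectral_in.
Qed.

Lemma spectral_le s x : borelT s -> H x -> rnorm (F s x) <= rnorm x.
Proof. by move=> /F_proj [M [cM MH FM]] Hx; rewrite FM//; exact: orthoproj_le. Qed.

Lemma spectral_circle x : H x -> F unit_circle x = x.
Proof. by case: FU => _ h _ _; exact: h. Qed.

Lemma spectral_additive (A : nat -> set R[i]) x :
  (forall n, borelT (A n)) -> trivIset setT A -> H x ->
  (fun n => \sum_(0 <= k < n) rnorm (F (A k) x) ^+ 2) @ \oo -->
    rnorm (F (\bigcup_k A k) x) ^+ 2.
Proof.
move=> bA tA Hx; case: FU => _ _ /(_ A bA tA x x Hx Hx) h _.
have bU : borelT (\bigcup_k A k).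
  split=> [z [k _]|]; first by case: (bA k) => h0 _ ?; exact: h0.
  by apply: (@bigcupT_measurable _ (@borelC R)) => k; case: (bA k).
apply/cvg_seqR => e /(proj1 (cvg_seq _ _) h)[N hN]; exists N => n /hN.
under eq_bigr do rewrite spectral_quad//.
rewrite spectral_quad// -rmorph_sum -rmorphB /=.
by rewrite -[rnorm _]/(cabs _) cabsR.
Qed.

Lemma spectral0 x : H x -> F set0 x = 0.
Proof.
move=> Hx; apply: rnorm_eq0; apply/eqP; rewrite -sqrf_eq0; apply/eqP.
have t0 : trivIset setT (fun _ : nat => set0 : set R[i]) by move=> i j _ _ [? []].
have := spectral_additive (fun=> borelT0) t0 Hx.
rewrite bigcup0// => h.
have /cvg_series_cvg_0 : cvgn (series (fun=> rnorm (F set0 x) ^+ 2 : R)).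
  by apply/cvg_ex; eexists; exact: h.
by move=> h0; apply: (cvg_unique _ _ h0) => //; exact: cvg_cst.
Qed.

Lemma spectralU s t x : borelT s -> borelT t -> s `&` t = set0 -> H x ->
  F (s `|` t) x = F s x + F t x.
Proof.
move=> bs bt st Hx; have bst : borelT (s `|` t).
  case: bs bt => [sT ms] [tT mt]; split; first by move=> z [/sT|/tT].
  exact: (@measurableU _ (@borelC R)).
apply/eqP; rewrite -subr_eq0; set d := _ - _; apply/eqP/inner_eq0.
have Hd : H d.
  by apply: closed_subspaceB; [|exact: spectral_in|apply: closed_subspaceD => //; exact: spectral_in].
suff h y : H y -> inner (F (s `|` t) x) y = inner (F s x) y + inner (F t x) y.
  by rewrite {1}/d innerBl innerDl h// subrr.
move=> Hy; apply/eqP; rewrite -subr_eq0; apply/eqP/(@rnorm_eq0 _ R[i]^o)/eqP.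
rewrite eq_le rnorm_ge0 andbT leNgt; apply/negP => e0.
case: FU => _ _ + _ => /(_ (bigcup2 s t)) /(_ _ _ x y Hx Hy).
rewrite bigcup2E => /(_ _ _)/cvg_seq /(_ _ e0) []//.
- by case=> [|[|n]] //; exact: borelT0.
- by rewrite -trivIset_bigcup2.
move=> N /(_ N.+2 (leqW (leqW (leqnn N)))).
rewrite big_nat_recl// big_nat_recl//= big1 ?addr0 => [|n _]; last first.
  by rewrite spectral0// inner0l.
by rewrite rnormC ltxx.
Qed.

(** A vector [q] fixed by [F t] leaves no length to [F s q], because the sum
    [F (s `|` t)] of the two projections is a contraction. *)
Lemma spectral_disjoint s t x : borelT s -> borelT t -> s `&` t = set0 -> H x ->
  F s (F t x) = 0.
Proof.
move=> bs bt st Hx; have Hq := spectral_in bt Hx; set q := F t x.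
have bst : borelT (s `|` t).
  case: bs bt => [sT ms] [tT mt]; split; first by move=> z [/sT|/tT].
  exact: (@measurableU _ (@borelC R)).
have := spectral_quad bst Hq; rewrite spectralU// innerDl !spectral_quad//.
rewrite -rmorphD => /(congr1 (@complex.Re R)) /=.
have : rnorm (F (s `|` t) q) ^+ 2 <= rnorm q ^+ 2.
  by rewrite ler_pXn2r ?nnegrE ?rnorm_ge0// spectral_le.
have -> : F t q = q by exact: spectral_idem.
rewrite spectralU//; have -> : F t q = q by exact: spectral_idem.
move=> h1 h2.
by apply: rnorm_eq0; apply/eqP; rewrite -sqrf_eq0 eq_le sqr_ge0 andbT; lra.
Qed.

Lemma spectral_split s t x : borelT s -> borelT t -> H x ->
  F s x = F (s `&` t) x + F (s `\` t) x.
Proof.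
move=> bs bt Hx; rewrite -spectralU ?setDE -?setIUr ?setUv ?setIT//.
- exact: borelTI.
- by rewrite -setDE; exact: borelTD.
- by rewrite setIACA setICr setI0.
Qed.

(** Split [F t x] along [s], and [F s] along [t]. *)
Lemma spectral_mul s t x : borelT s -> borelT t -> H x -> F s (F t x) = F (s `&` t) x.
Proof.
move=> bs bt Hx.
have bI := borelTI bs bt; have b1 := borelTD bt bs; have b2 := borelTD bs bt.
have HI := spectral_in bI Hx.
rewrite (spectral_split bt bs Hx) (setIC t s) spectralD//; last exact: spectral_in.
rewrite (spectral_disjoint bs b1)//; last by rewrite setDE setICA setICr setI0.
rewrite addr0 (spectral_split bs bt HI) spectral_idem//.
rewrite (spectral_disjoint b2 bI) ?addr0//.
by rewrite setDE setIACA setICl setI0.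
Qed.

Lemma spectral_measure_ex x : H x ->
  exists m : {finite_measure set (@borelC R) -> \bar R},
    forall s, m s = (rnorm (F (s `&` unit_circle) x) ^+ 2)%:E.
Proof.
move=> Hx; pose nu (s : set (@borelC R)) := (rnorm (F (s `&` unit_circle) x) ^+ 2)%:E.
have nu0 : nu set0 = 0%E by rewrite /nu set0I spectral0// rnorm0 expr0n.
have nu_ge0 s : (0 <= nu s)%E by rewrite /nu lee_fin sqr_ge0.
have nu_sa : semi_sigma_additive nu.
  move=> A mA tA _.
  have bA n : borelT (A n `&` unit_circle) by exact: borelT_trace.
  have tA' : trivIset setT (fun n => A n `&` unit_circle).
    by move=> i j _ _ [z [[Ai _] [Aj _]]]; apply: tA => //; exists z.
  have := spectral_additive bA tA' Hx; rewrite -setI_bigcupl => h.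
  rewrite /nu; under eq_fun do rewrite sumEFin.
  by apply: cvg_EFin; [exact: nearW|exact: h].
pose mx := isMeasure.Build _ (@borelC R) R nu nu0 nu_ge0 nu_sa.
pose m : {measure set (@borelC R) -> \bar R} := HB.pack nu mx.
have fin : fin_num_fun m by [].
pose mf := Measure_isFinite.Build _ (@borelC R) R m fin.
pose m' : {finite_measure set (@borelC R) -> \bar R} := HB.pack (m : _ -> _) mf m.
by exists m'.
Qed.

End SpectralMeasure.

Section Density.
Context {R : realType}.
Local Open Scope ereal_scope.

(** By hypothesis [h] is the Radon-Nikodym derivative of [nu] on [D]. *)
Lemma integral_density d (T : measurableType d)
    (nu mu : {finite_measure set T -> \bar R}) (D : set T) (h g : T -> \bar R) :
  measurable D -> mu.-integrable D h -> nu.-integrable D g ->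
  (forall s, measurable s -> nu s = \int[mu]_(x in s `&` D) h x) ->
  \int[nu]_(x in D) g x = \int[mu]_(x in D) (g x * h x).
Proof.
move=> mD ih ig nuE.
have mh := measurable_int _ ih; have mg := measurable_int _ ig.
have numu : nu `<< mu.
  apply/null_content_dominatesP => s ms s0.
  rewrite nuE// null_set_integral//; first exact: measurableI.
    by apply: measurable_funS mh => //; exact: subIsetr.
  by apply: (subset_measure0 _ _ (@subIsetl _ s D)) => //; exact: measurableI.
rewrite -(Radon_Nikodym_change_of_variables numu mD ig).
apply: ae_eq_integral => //.
- apply: emeasurable_funM => //; apply: measurable_funTS.
  exact: measurable_int (Radon_Nikodym_integrable _).
- exact: emeasurable_funM.
apply: ae_eqe_mul2l; apply: integral_ae_eq => //.
  by apply: (integrableS measurableT) => //; exact: Radon_Nikodym_integrable.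
move=> s sD ms; rewrite -Radon_Nikodym_integral//.
by rewrite [LHS]nuE// (setIidl sD).
Qed.

End Density.

Section CircleIntegral.
Context {R : realType} {K : hilbertType R}.
Import HBNNSimple.
Implicit Types (g : R[i] -> R) (m : {finite_measure set (@borelC R) -> \bar R}).

(** The integral is defined by simple functions, and only involves the values of the
    set function on measurable sets. *)
Lemma circle_integral_measure (mu : set R[i] -> K -> K) x g
    (m : {measure set (@borelC R) -> \bar R}) :
  (forall s, measurable s -> m s = quadratic_measure mu x s) ->
  circle_integral mu x g =
  (\int[m]_(z in (unit_circle : set (@borelC R))) (g z)%:E)%E.
Proof.
move=> mE; rewrite /circle_integral /integral.
have eqs (h : {nnsfun (@borelC R) >-> R}) :
    sintegral (quadratic_measure mu x : set (@borelC R) -> \bar R) h = sintegral m h.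
  by apply: eq_fsbigr => r _; rewrite mE.
by congr (ereal_sup _ - ereal_sup _)%E; apply: eq_imagel => h _; exact: eqs.
Qed.

Definition circle_bounded g :=
  measurable_fun setT (g : @borelC R -> R) /\
  exists C : R, forall z, unit_circle z -> `|g z| <= C.

Lemma circle_boundedD g h : circle_bounded g -> circle_bounded h ->
  circle_bounded (fun z => g z + h z).
Proof.
move=> [mg [C hC]] [mh [C' hC']]; split; first exact: measurable_funD.
by exists (C + C') => v Dv; apply: le_trans (ler_normD _ _) _; rewrite lerD ?hC ?hC'.
Qed.

Lemma circle_boundedZ (r : R) g : circle_bounded g -> circle_bounded (fun z => r * g z).
Proof.
move=> [mg [C hC]]; split; first by apply: measurable_funM => //; exact: measurable_cst.
by exists (`|r| * C) => v Dv; rewrite normrM ler_wpM2l// hC.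
Qed.

Lemma circle_bounded_cst (r : R) : circle_bounded (fun=> r).
Proof. by split; [exact: measurable_cst | exists `|r|]. Qed.

Lemma circle_bounded_Re : circle_bounded (@complex.Re R).
Proof.
split; first exact: measurable_Re.
by exists 1 => z /circleE <-; exact: le_Re_cabs.
Qed.

Lemma circle_bounded_Im : circle_bounded (@complex.Im R).
Proof.
split; first exact: measurable_Im.
by exists 1 => z /circleE <-; exact: le_Im_cabs.
Qed.

Lemma circle_integrable m (s : set (@borelC R)) g : measurable s -> s `<=` unit_circle ->
  circle_bounded g -> m.-integrable s (EFin \o g).
Proof.
move=> ms sT [mg [C hC]]; apply: measurable_bounded_integrable => //.
- by rewrite -ge0_fin_numE ?fin_num_measure.
- exact: measurable_funTS.
exists C; split; first exact: num_real.
by move=> M CM z /sT/hC h; exact: le_trans h (ltW CM).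
Qed.

(** On the circle the squared distance to [w] is affine in the real and imaginary
    parts, so that its integral is known from the integrals of these. *)
Lemma sqr_distE (z w : R[i]) : unit_circle z -> cabs (z - w) ^+ 2 =
  1 + cabs w ^+ 2 +
  ((- 2 * complex.Re w) * complex.Re z + (- 2 * complex.Im w) * complex.Im z).
Proof.
move=> /circleE z1; have := cabs_sqr z; rewrite z1 !cabs_sqr expr1n.
by case: z w {z1} => [a b] [c d] /=; lra.
Qed.

Lemma circle_bounded_dist w : circle_bounded (fun z => cabs (z - w) ^+ 2).
Proof.
split; first by apply: measurable_funX; exact: measurable_cabsB.
exists ((1 + cabs w) ^+ 2) => z /circleE z1.
rewrite ger0_norm ?sqr_ge0// ler_pXn2r ?nnegrE ?cabs_ge0 ?addr_ge0 ?cabs_ge0//.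
by apply: le_trans (cabsD _ _) _; rewrite z1 cabsN.
Qed.

Lemma circle_bounded_invdist w : cabs w < 1 ->
  circle_bounded (fun z => (cabs (z - w) ^+ 2)^-1).
Proof.
move=> w1; split.
  have -> : (fun z : @borelC R => (cabs (z - w) ^+ 2)^-1) =
      (fun z => (cabs (z - w) ^+ 2) `^ (- 1)).
    by apply/funext => z; rewrite powR_inv1// sqr_ge0.
  apply: (measurableT_comp (measurable_powR (- 1))).
  by apply: measurable_funX; exact: measurable_cabsB.
exists ((1 - cabs w) ^+ 2)^-1 => z /circleE z1.
have h : 1 - cabs w <= cabs (z - w).
  by have := cabsD (z - w) w; rewrite subrK z1; lra.
have p : 0 < 1 - cabs w by lra.
rewrite ger0_norm ?invr_ge0 ?sqr_ge0// lef_pV2 ?posrE ?exprn_gt0//; last by lra.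
by rewrite ler_pXn2r ?nnegrE ?cabs_ge0// ltW.
Qed.

End CircleIntegral.

Section PoissonIdentity.
Context {R : realType} {K : hilbertType R}.
Variables (H : set K) (U : K -> K) (F : set R[i] -> K -> K).
Hypotheses (cH : closed_subspace H) (HU : unitary_on H U).
Hypothesis FU : spectral_measure_of H U F.
Implicit Types (s t : set R[i]) (x y : K) (g : R[i] -> R).

Local Notation circle := (unit_circle : set (@borelC R)).

Let U_linear : linear_on H U. Proof. by case: HU => [[]]. Qed.
Let U_in x : H x -> H (U x). Proof. by move=> Hx; have [_ h] := HU; rewrite -h; exists x. Qed.
Let U_norm x : H x -> rnorm (U x) = rnorm x. Proof. by case: HU => [[_ h] _] /h. Qed.
Let UD x y : H x -> H y -> U (x + y) = U x + U y.
Proof. by move=> Hx Hy; rewrite -[x]scale1r U_linear// !scale1r. Qed.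
Let U0 : U 0 = 0.
Proof. by apply: rnorm_eq0; rewrite U_norm ?rnorm0//; case: cH. Qed.
Let UZ a x : H x -> U (a *: x) = a *: U x.
Proof.
by move=> Hx; have [H0 _ _] := cH; rewrite -[_ *: x]addr0 U_linear// U0 addr0.
Qed.

Definition spectral_measure x (m : {finite_measure set (@borelC R) -> \bar R}) :=
  forall s : set (@borelC R), m s = (rnorm (F (s `&` unit_circle) x) ^+ 2)%:E.

Lemma spectral_measure_quadratic x m : H x -> spectral_measure x m ->
  forall s : set (@borelC R), measurable s -> m s = quadratic_measure F x s.
Proof.
by move=> Hx mE s ms; rewrite mE /quadratic_measure (spectral_quad FU (borelT_trace ms) Hx).
Qed.

Lemma spectral_measure_circle x m : H x -> spectral_measure x m -> m circle = (rnorm x ^+ 2)%:E.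
Proof. by move=> Hx ->; rewrite setIid (spectral_circle FU). Qed.

Lemma inner_spectral x m : H x -> spectral_measure x m -> inner (U x) x =
  (\int[m]_(z in circle) complex.Re z)%R +i* (\int[m]_(z in circle) complex.Im z)%R.
Proof.
move=> Hx /(spectral_measure_quadratic Hx) mE; case: FU => _ _ _ ->//.
by rewrite !(circle_integral_measure _ mE).
Qed.

(** The hypothesis makes the scalar spectral measure of [x + y] the sum of those of
    [x] and [y]. *)
Lemma inner_spectralD x y : H x -> H y ->
  (forall s, borelT s -> inner (F s x) (F s y) = 0) ->
  inner (U (x + y)) (x + y) = inner (U x) x + inner (U y) y.
Proof.
move=> Hx Hy xy; have Hxy := closed_subspaceD cH Hx Hy.
have [m1 m1E] := spectral_measure_ex FU Hx.
have [m2 m2E] := spectral_measure_ex FU Hy.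
have [m mE] := spectral_measure_ex FU Hxy.
have int g : circle_bounded g -> \int[m]_(z in circle) g z =
    \int[m1]_(z in circle) g z + \int[m2]_(z in circle) g z.
  move=> bg; have ig m' := circle_integrable m' measurable_circle (@subset_refl _ _) bg.
  have fin (m' : {finite_measure set (@borelC R) -> \bar R}) :
      (\int[m']_(z in circle) (g z)%:E)%E \is a fin_num.
    by have := integrable_fin_num measurable_circle (ig m').
  rewrite /Rintegral -fineD ?fin//; apply: (congr1 fine).
  transitivity (\int[measure_add m1 m2]_(z in circle) (g z)%:E)%E; last first.
    by have := integral_measure_add measurable_circle (ig m1) (ig m2).
  apply: eq_measure_integral => s ms _; rewrite /measure_add /= /msum.
  rewrite !big_ord_recl big_ord0 /= addr0 mE m1E m2E -EFinD; congr EFin.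
  by rewrite (spectralD cH FU) ?pythagoras//; [apply: xy|]; exact: borelT_trace.
rewrite (inner_spectral Hx m1E) (inner_spectral Hy m2E) (inner_spectral Hxy mE).
by rewrite !int; [|exact: circle_bounded_Im|exact: circle_bounded_Re].
Qed.

(** Apply [inner_spectralD] to [F s x] and [a *: F t y], with [a = 1] and
    [a = 'i]. *)
Lemma inner_disjoint s t x y : borelT s -> borelT t -> s `&` t = set0 -> H x -> H y ->
  inner (U (F s x)) (F t y) = 0.
Proof.
move=> bs bt st Hx Hy; set p := F s x; set q := F t y.
have Hp : H p := spectral_in FU bs Hx; have Hq : H q := spectral_in FU bt Hy.
have ort (a : R[i]) r : borelT r -> inner (F r p) (F r (a *: q)) = 0.
  move=> br; have brs := borelTI br bs; have brt := borelTI br bt.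
  rewrite (spectralZ cH FU)// innerZr /p /q !(spectral_mul cH FU)//.
  rewrite (spectral_sym FU)//; last exact: (spectral_in FU brt Hy).
  rewrite (spectral_mul cH FU)// setIACA st setI0 (spectral0 FU)//.
  by rewrite inner0r mulr0.
have key a : Num.conj a * inner (U p) q + a * inner (U q) p = 0.
  have Haq : H (a *: q) := closed_subspaceZ a cH Hq.
  have := inner_spectralD Hp Haq (ort a).
  rewrite UD// UZ// !innerDl !innerDr !innerZl !innerZr.
  move=> h; apply: (@addrI _ (inner (U p) p + a * (Num.conj a * inner (U q) q))).
  by rewrite addr0 -[RHS]h; ring.
have h1 := key 1; have h2 := key 'i.
rewrite rmorph1 !mul1r in h1; rewrite conjCi mulNr -mulrN -mulrDr in h2.
have {}h2 : - inner (U p) q + inner (U q) p = 0.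
  by apply/eqP; move/eqP: h2; rewrite mulf_eq0 (negbTE (neq0Ci _)).
have h3 : inner (U p) q *+ 2 = 0.
  rewrite mulr2n -{1}[inner (U p) q]opprK; have -> : - inner (U p) q = - inner (U q) p.
    by apply/eqP; rewrite -subr_eq0 opprK h2.
  by rewrite opprK addrC h1.
by apply/eqP; move/eqP: h3; rewrite mulrn_eq0.
Qed.

(** [U] maps the range of [F s] to the complement of the range of [F t], for [t] the
    complement of [s], and conversely. *)
Lemma spectral_commute s x : borelT s -> H x -> F s (U x) = U (F s x).
Proof.
move=> bs Hx; pose t := unit_circle `\` s.
have bt : borelT t := borelTD (borelT_circle (R := R)) bs.
have ts : t `&` s = set0 by rewrite /t setDE -setIA setICl setI0.
have vanish r r' y : borelT r -> borelT r' -> r `&` r' = set0 -> H y -> F r (U (F r' y)) = 0.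
  move=> br br' rr' Hy; have Hr := spectral_in FU br' Hy.
  apply: inner_eq0; rewrite (spectral_sym FU)//; [|exact: U_in|by apply: (spectral_in FU)=> //; exact: U_in].
  rewrite (spectral_idem FU)//; last exact: U_in.
  by apply: inner_disjoint => //; [rewrite setIC|exact: U_in].
have split y : H y -> y = F s y + F t y.
  move=> Hy; rewrite -(spectralU cH FU)//; last by rewrite setIC.
  by rewrite /t setDUK ?(spectral_circle FU)//; case: bs.
have Hs := spectral_in FU bs Hx; have Ht := spectral_in FU bt Hx.
have Us : F s (U (F s x)) = U (F s x).
  by rewrite [RHS](split _ (U_in Hs)) (vanish t s)// addr0.
rewrite {1}(split _ Hx) UD// (spectralD cH FU)//; [|exact: U_in..].
by rewrite (vanish s t) ?addr0 // setIC.
Qed.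

Lemma shift_in w x : H x -> H (U x - w *: x).
Proof.
by move=> Hx; apply: closed_subspaceB => //; [exact: U_in | exact: closed_subspaceZ].
Qed.

(** Expand the square and integrate [sqr_distE]. *)
Lemma rnorm_shift w x m : H x -> spectral_measure x m ->
  rnorm (U x - w *: x) ^+ 2 = \int[m]_(z in circle) (cabs (z - w) ^+ 2).
Proof.
move=> Hx mE; have mT := @measurable_circle R.
have ig g : circle_bounded g -> m.-integrable circle (EFin \o g).
  by apply: circle_integrable.
have bR : circle_bounded (fun z : R[i] => (- 2 * complex.Re w) * complex.Re z).
  exact: circle_boundedZ (circle_bounded_Re (R := R)).
have bI : circle_bounded (fun z : R[i] => (- 2 * complex.Im w) * complex.Im z).
  exact: circle_boundedZ (circle_bounded_Im (R := R)).
transitivity (\int[m]_(z in circle) ((1 + cabs w ^+ 2) +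
  ((- 2 * complex.Re w) * complex.Re z + (- 2 * complex.Im w) * complex.Im z))); last first.
  by apply: eq_Rintegral => z; rewrite inE => zT; rewrite sqr_distE.
rewrite RintegralD//; [|exact: (ig _ (circle_bounded_cst _))|exact: (ig _ (circle_boundedD bR bI))].
have -> : \int[m]_(z in circle) (1 + cabs w ^+ 2) = (1 + cabs w ^+ 2) * rnorm x ^+ 2.
  by rewrite (Rintegral_cst _ mT); congr (_ * _); exact: (congr1 fine (spectral_measure_circle Hx mE)).
rewrite RintegralD//; [|exact: (ig _ bR)|exact: (ig _ bI)].
rewrite !RintegralZl//; [|exact: (ig _ circle_bounded_Im)|exact: (ig _ circle_bounded_Re)].
rewrite rnormB_sqr U_norm// rnormZ exprMn innerZr (inner_spectral Hx mE).
set p := Rintegral _ _ _; set q := Rintegral _ _ _.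
have -> : complex.Re (Num.conj w * (p +i* q)) = complex.Re w * p + complex.Im w * q.
  by case: w {bR bI} => [c d] /=; ring.
ring.
Qed.

(** By [spectral_commute], this is [rnorm_shift] at the vector [F s x]. *)
Lemma spectral_density w x m m' : H x -> spectral_measure x m ->
  spectral_measure (U x - w *: x) m' -> forall s : set (@borelC R), measurable s ->
  m' s = (\int[m]_(z in s `&` circle) (cabs (z - w) ^+ 2)%:E)%E.
Proof.
move=> Hx mE m'E s ms; have bs := borelT_trace ms; have mT := @measurable_circle R.
have bd := circle_bounded_dist w.
set y := F (s `&` unit_circle) x; have Hy : H y := spectral_in FU bs Hx.
have [n nE] := spectral_measure_ex FU Hy.
have Fw : F (s `&` unit_circle) (U x - w *: x) = U y - w *: y.
  rewrite (spectralB cH FU)//; [|exact: U_in|exact: closed_subspaceZ].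
  by rewrite spectral_commute// (spectralZ cH FU).
rewrite m'E Fw (rnorm_shift w Hy nE) /Rintegral fineK; last first.
  have ib := circle_integrable n mT (@subset_refl _ _) bd.
  by have := integrable_fin_num mT ib.
have cE : circle = (circle `\` s) `|` (s `&` circle) :> set (@borelC R).
  by rewrite setDE setIC -setIUl setUC setUv setTI.
have ms1 : measurable (circle `\` s : set (@borelC R)) by exact: measurableD.
have ms2 : measurable (s `&` circle : set (@borelC R)) by exact: measurableI.
rewrite [in LHS]cE ge0_integral_setU//=; last 3 first.
- by apply: measurable_funTS; apply/measurable_EFinP; case: bd.
- by move=> z _; rewrite lee_fin sqr_ge0.
- by apply/disj_setPS => z [[_ ?] []].
rewrite null_set_integral ?add0e//.
- apply: eq_measure_integral => r mr rs.
  transitivity ((rnorm (F (r `&` unit_circle) y) ^+ 2)%:E); first exact: nE.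
  transitivity ((rnorm (F (r `&` unit_circle) x) ^+ 2)%:E); last exact/esym/mE.
  rewrite /y (spectral_mul cH FU)//; last exact: borelT_trace.
  by rewrite setIACA setIid (setIidl (_ : r `<=` s))// => z /rs[].
- by apply: measurable_funTS; apply/measurable_EFinP; case: bd.
transitivity ((rnorm (F ((circle `\` s) `&` unit_circle) y) ^+ 2)%:E); first exact: nE.
rewrite /y (spectral_mul cH FU)//; last exact: borelT_trace.
rewrite (_ : _ `&` _ = set0) ?(spectral0 FU)// ?rnorm0 ?expr0n//.
by rewrite -subset0 => z [[[_ ?] _] []].
Qed.

(** The Poisson kernel is [(1 - |w|^2)] over the density of the scalar spectral
    measure of [U x - w *: x] with respect to that of [x]. *)
Lemma poisson_identity w x : unit_disk w -> H x ->
  poisson_form F w (U x - w *: x) = ((1 - cabs w ^+ 2) * rnorm x ^+ 2)%:E.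
Proof.
move=> /unit_diskE w1 Hx; have Hw := shift_in w Hx; have mT := @measurable_circle R.
have [m mE] := spectral_measure_ex FU Hx.
have [m' m'E] := spectral_measure_ex FU Hw.
rewrite /poisson_form (circle_integral_measure _ (spectral_measure_quadratic Hw m'E)).
have bg : circle_bounded (fun z : R[i] => (1 - cabs w ^+ 2) * (cabs (z - w) ^+ 2)^-1).
  exact/circle_boundedZ/circle_bounded_invdist.
rewrite (integral_density mT _ _ (spectral_density Hx mE m'E)); last 2 first.
- exact/circle_integrable/circle_bounded_dist.
- exact: (circle_integrable m' mT (@subset_refl _ _) bg).
transitivity (\int[m]_(z in circle) (1 - cabs w ^+ 2)%:E)%E.
  apply: eq_integral => z; rewrite inE => /circleE z1.
  rewrite -EFinM; congr EFin; rewrite -[rnorm _]/(cabs w) -[rnorm _]/(cabs (z - w)).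
  rewrite divfK// expf_neq0// gt_eqF//.
  by have := cabsD (z - w) w; rewrite subrK z1; lra.
by rewrite integral_cst// EFinM; congr (_ * _)%E; exact: spectral_measure_circle Hx mE.
Qed.

End PoissonIdentity.

(** * The Dirichlet space of the model *)

Section ShiftModel.
Context {R : realType} {K : hilbertType R}.
Variables (S U : K -> K) (D : set K) (delta : R) (F : set R[i] -> K -> K).
Hypotheses (B : brownian_data S D delta) (S_analytic : analytic_operator S).
Hypothesis Delta_proj : forall x, Delta S x = (delta ^+ 2)%:C *: orthoproj D x.
Hypothesis HU : unitary_on D U.
Hypothesis U_compression : forall d, D d -> U d = compression S D d.
Hypothesis FU : spectral_measure_of D U F.
Implicit Types (x y z d k : K) (w : R[i]) (s : set R[i]) (a b : nat -> K).

Local Notation P := (orthoproj D).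
Local Notation E := (nullspace (adj S)).
Local Notation A := (compression S D).
Local Notation J := (graph_map S delta).
Local Notation L := (dual_adj S D delta).
Local Notation mu := (fun s x => orthoproj E (F s (Delta S x))).

Let bS : blin S := bd_lin B.
Let cD : closed_subspace D := bd_sub B.
Let d0 : 0 < delta := bd_pos B.
Let bP : blin P := blin_proj cD.
Let cE : closed_subspace E := closed_subspace_null (blin_adj bS).
Let PD x : D (P x) := orthoproj_in cD x.
Let FD s x : borelT s -> D (F s (P x)).
Proof. by move=> bs; exact: (spectral_in FU bs (PD x)). Qed.
Let bA : blin A := blin_compression B.

Let U_norm d : D d -> rnorm (U d) = rnorm d.
Proof. by case: HU => [[_ h] _] /h. Qed.

Let Delta_F s x : borelT s -> F s (Delta S x) = (delta ^+ 2)%:C *: F s (P x).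
Proof. by move=> bs; rewrite Delta_proj (spectralZ cD FU)//. Qed.

Lemma blin_spectral_proj s : borelT s -> blin (fun x => F s (P x)).
Proof.
move=> bs; split.
  by move=> c x y; rewrite (blinD bP) (blinZ bP) (spectral_linear cD FU).
exists 1; split=> // x; rewrite mul1r.
exact: le_trans (spectral_le FU bs (PD x)) (orthoproj_le cD x).
Qed.

(** The graph map carries the spectral measure from [D] to the kernel of the
    adjoint. *)
Lemma dirichlet_measureE s x : borelT s ->
  mu s x = (ratio delta * delta ^+ 2)%:C *: J (F s (P x)).
Proof.
move=> bs; rewrite /= Delta_F// (blinZ (blin_proj cE)) (proj_ker B); last exact: FD.
by rewrite scalerA -rmorphM mulrC.
Qed.

Lemma inner_dirichlet_measure s x y : borelT s -> E y ->
  inner (mu s x) y = (delta ^+ 2)%:C * inner (F s (P x)) (P y).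
Proof.
move=> bs Ey; rewrite /= (orthoproj_inner cE)// Delta_F// innerZl; congr (_ * _).
by rewrite (orthoproj_innerr cD)//; exact: FD.
Qed.

Lemma dirichlet_measure_positive : positive_operator_measure E mu.
Proof.
split=> [s bs|s x bs Ex|T bT tT x y Ex Ey].
- have lin c x y : mu s (c *: x + y) = c *: mu s x + mu s y.
    rewrite !dirichlet_measureE// (blinD bP) (blinZ bP).
    rewrite (spectral_linear cD FU)// (blinD (blin_graph_map B)) (blinZ (blin_graph_map B)).
    by rewrite scalerDr !scalerA mulrC.
  split; first by move=> c x y _ _; exact: lin.
    by move=> x _; exact: (orthoproj_in cE).
  exists (delta ^+ 2) => x _; apply: le_trans (orthoproj_le cE _) _.
  rewrite Delta_F// rnormZ cabsR ger0_norm ?sqr_ge0// ler_wpM2l ?sqr_ge0//.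
  exact: le_trans (spectral_le FU bs (PD x)) (orthoproj_le cD x).
- rewrite inner_dirichlet_measure// (spectral_quad FU)//.
  by rewrite -rmorphM lecR mulr_ge0 ?sqr_ge0.
have bU : borelT (\bigcup_k T k).
  split=> [z [n _]|]; first by case: (bT n) => h _ ?; exact: h.
  by apply: (@bigcupT_measurable _ (@borelC R)) => n; case: (bT n).
have sumE n : \sum_(0 <= k < n) inner (mu (T k) x) y =
    (delta ^+ 2)%:C * \sum_(0 <= k < n) inner (F (T k) (P x)) (P y).
  by rewrite mulr_sumr; apply: eq_bigr => k _; exact: inner_dirichlet_measure.
rewrite (funext sumE) inner_dirichlet_measure//.
case: FU => _ _ h _; have := h T bT tT _ _ (PD x) (PD y).
  exact: (@cvgZl_tmp R[i] R[i]^o).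
Qed.

Lemma scaled_measureE s x : borelT s ->
  ((1 + delta ^+ 2) * delta ^- 4)%:C *: mu s x = J (F s (P x)).
Proof.
move=> bs; rewrite /= dirichlet_measureE// scalerA -rmorphM /=.
rewrite (_ : _ * _ = 1) ?scale1r// /ratio.
have h1 : delta != 0 by rewrite gt_eqF.
have h2 : 1 + delta ^+ 2 != 0 by rewrite gt_eqF// ltr_pwDl// sqr_ge0.
by field; rewrite h1 h2.
Qed.

(** The product on the graph is a multiple of that on [D], so that the projection
    [F s] on [D] induces a projection on the graph. *)
Lemma scaled_measure_projection s : borelT s ->
  orthogonal_projection_on E (fun x => ((1 + delta ^+ 2) * delta ^- 4)%:C *: mu s x).
Proof.
move=> bs; have bG := blin_sub (blin_spectral_proj bs) bP.
have [Z0 Zl Zc] := closed_subspace_null bG; have [E0 El Ec] := cE.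
exists (E `&` nullspace (fun x => F s (P x) - P x)); split; last 1 first.
- move=> x Ex; rewrite scaled_measureE//; apply/esym/orthoproj_unique.
  + by split; [|move=> c u v [Eu Zu] [Ev Zv]; split; [exact: El|exact: Zl]|exact: closedI].
  + split; first by apply: (graph_map_ker B); exact: FD.
    by rewrite /nullspace /= (proj_graph_map B) ?(spectral_idem FU) ?subrr//; exact: FD.
  move=> m [Em]; rewrite /nullspace /= => /eqP; rewrite subr_eq0 => /eqP Fm.
  have -> : inner x m = inner (J (P x)) m by rewrite (graph_map_proj B).
  rewrite !(inner_graph_map B _ Em); congr (_ * _).
  rewrite -(orthoproj_innerr cD m (FD x bs)) (spectral_sym FU)// Fm.
  by rewrite (orthoproj_innerr cD).
- by split; [|move=> c u v [Eu Zu] [Ev Zv]; split; [exact: El|exact: Zl]|exact: closedI].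
- by move=> a [].
Qed.

Lemma range_ker : E = [set - ((delta^-1)%:C *:
    ((delta^-1)%:C *: (S (adj S d) - P (S (adj S d))))) + d | d in D].
Proof.
rewrite (ker_graph B); apply: eq_imagel => d Dd.
rewrite (bd_adjK B Dd) /graph_map scalerA -rmorphM /= -invfM -expr2.
by rewrite scalerBr opprB rmorphD rmorph1 scalerDl scale1r [RHS]addrC addrA.
Qed.

Section DirichletNorm.
Variable a : nat -> K.

Definition rotated_sum n : K := \sum_(0 <= m < n.+1) m.+1%:R *: iter m A (P (a m.+1)).

(** The Taylor coefficients of the function [h] with [(U - z) h(z) = P f'(z)], if
    [a] are those of [f]: the compression acts on [D] as [U], and its inverse there
    as the adjoint of [S]. *)
Definition resolvent_coef n : K := iter n.+1 (adj S) (rotated_sum n).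

Let D_rotated_sum n : D (rotated_sum n).
Proof.
apply: closed_subspace_sum => // m.
by apply: (closed_subspaceZ _ cD); exact: (iter_compression_in B).
Qed.

Let D_iter_adj n d : D d -> D (iter n (adj S) d).
Proof. by move=> Dd; elim: n => //= n; exact: (bd_adj B). Qed.

Lemma resolvent_coef_in n : D (resolvent_coef n).
Proof. exact: D_iter_adj. Qed.

(** The two vectors differ by a power of the unitary part. *)
Lemma deviation_resolvent n :
  deviation S D a n = rnorm (resolvent_coef n) ^+ 2 / (n.+1%:R * n.+2%:R).
Proof.
rewrite /deviation; congr (_ ^+ 2 / _).
have -> : \sum_(0 <= m < n.+1) m.+1%:R *: iter m.+1 A (P (a m.+1)) = A (rotated_sum n).
  by rewrite (blin_sum bA); apply: eq_bigr => m _; rewrite (blinZ bA).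
rewrite (compression_iso B)// -{1}(iter_compression_adj B n.+1 (D_rotated_sum n)).
by rewrite (iter_compression_iso B)//; exact: D_iter_adj.
Qed.

Lemma resolvent_coef0 : U (resolvent_coef 0) = P (dcoef a 0).
Proof.
rewrite U_compression; last exact: resolvent_coef_in.
rewrite [LHS](bd_adjK B (D_rotated_sum 0)) /rotated_sum big_nat1 /=.
by rewrite /dcoef (blinZ bP).
Qed.

Lemma resolvent_coefS n :
  U (resolvent_coef n.+1) = P (dcoef a n.+1) + resolvent_coef n.
Proof.
rewrite U_compression; last exact: resolvent_coef_in.
rewrite {1}/resolvent_coef [iter n.+2 _ _]iterS.
rewrite [LHS](bd_adjK B (D_iter_adj _ (D_rotated_sum _))) /rotated_sum big_nat_recr//= -/(rotated_sum n).
have bI := blin_iter n.+1 (blin_adj bS).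
rewrite -iterS (blinD bI) addrC; congr (_ + _).
by rewrite (blinZ bI) [iter n.+1 (adj S) _](iter_adj_compression B) /dcoef ?(blinZ bP).
Qed.

Hypothesis abel_a : abel a.

(** By [resolvent_coefS], the norms grow by at most those of the coefficients of the
    derivative. *)
Lemma abel_resolvent : abel resolvent_coef.
Proof.
move=> r r0 r1; have ab := abel_dcoef abel_a.
have [C hC] := abel_summable ab (ltW r0) r1; exists C => n.
apply: le_trans (hC n.+1); elim: n => [|n ih].
  rewrite big_nat1 expr0 !mulr1.
  rewrite -U_norm; last exact: resolvent_coef_in.
  by rewrite resolvent_coef0 (orthoproj_le cD).
rewrite big_nat_recr//=; have rn : 0 <= r ^+ n.+1 by rewrite exprn_ge0 ?ltW.
rewrite -U_norm; last exact: resolvent_coef_in.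
rewrite resolvent_coefS; apply: le_trans (ler_wpM2r rn (rnormD _ _)) _.
rewrite mulrDl [leLHS]addrC; apply: lerD; last by apply: ler_wpM2r => //; exact: orthoproj_le.
apply: le_trans ih; rewrite ler_wpM2l ?rnorm_ge0// exprS ler_piMl ?exprn_ge0 ?ltW//.
Qed.

Lemma resolvent_identity w (h g : K) :
  series (fun n => w ^+ n *: resolvent_coef n) @ \oo --> h ->
  series (fun n => w ^+ n *: dcoef a n) @ \oo --> g -> D h /\ P g = U h - w *: h.
Proof.
move=> hh hg; have Dh : D h.
  apply: (closed_seq _ _ hh); first by case: cD.
  move=> n; apply: closed_subspace_sum => // m.
  by apply: (closed_subspaceZ _ cD); exact: resolvent_coef_in.
split=> //; have stepE N : A (series (fun n => w ^+ n *: resolvent_coef n) N.+1) =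
    P (series (fun n => w ^+ n *: dcoef a n) N.+1) +
    w *: series (fun n => w ^+ n *: resolvent_coef n) N.
  elim: N => [|N ih].
    rewrite /series /= !big_nat1 big_geq// scaler0 addr0 (blinZ bA) (blinZ bP).
    by rewrite -U_compression ?resolvent_coef0//; exact: resolvent_coef_in.
  rewrite [in LHS]/series [in X in P X]/series [in X in _ *: X]/series /=.
  rewrite big_nat_recr//= [in X in P X]big_nat_recr//= [in X in w *: X]big_nat_recr//=.
  rewrite (blinD bA) (blinD bP) [A (\sum_(_ <= _ < _) _)]ih (blinZ bA) (blinZ bP).
  rewrite -U_compression; last exact: resolvent_coef_in.
  by rewrite resolvent_coefS !scalerDr scalerA -exprS [LHS]addrACA.
pose u N := series (fun n => w ^+ n *: resolvent_coef n) N.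
pose v N := series (fun n => w ^+ n *: dcoef a n) N.
have c1 : (fun N => A (u (1 + N)%N)) @ \oo --> A h by exact: cvg_shift (blin_cvg bA hh).
have c2 : (fun N => P (v (1 + N)%N)) @ \oo --> P g by exact: cvg_shift (blin_cvg bP hg).
have c3 : (fun N => w *: u N) @ \oo --> w *: h by exact: cvgZl_tmp.
have {c3}c2 := cvgD c2 c3.
rewrite U_compression//; apply/eqP; rewrite -subr_eq opprK; apply/eqP.
move: c1; rewrite (_ : (fun N => A (u (1 + N)%N)) = (fun N => P (v (1 + N)%N) + w *: u N)).
  by move=> c1; exact: cvg_uniqK (c2 _) c1.
by apply/funext => N; exact: stepE.
Qed.

Variable f : R[i] -> K.
Hypothesis fa : power_series a f.
Hypothesis Ea : forall n, E (a n).

Lemma poisson_dirichlet w y : E y -> poisson_form mu w y = poisson_form F w (delta%:C *: P y).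
Proof.
move=> Ey; have Dy : D (delta%:C *: P y) by exact: closed_subspaceZ.
have [m mE] := spectral_measure_ex FU Dy.
rewrite /poisson_form (circle_integral_measure _ (spectral_measure_quadratic FU Dy mE)).
apply: circle_integral_measure => s ms; apply: etrans (mE s) _; rewrite /quadratic_measure; congr EFin.
have bs := borelT_trace ms; rewrite inner_dirichlet_measure// (spectral_quad FU)//.
rewrite (spectralZ cD FU)// rnormZ cabsR exprMn real_normK ?num_real//.
by rewrite -rmorphM.
Qed.

(** By [poisson_identity], the Poisson form at [f'(z)], which only involves
    [P f'(z) = (U - z) h(z)], is [delta ^+ 2 * (1 - |z|^2)] times the squared norm of
    [h(z)], and the coefficients of [h] are those of [deviation_resolvent]. *)
Lemma dirichlet_normE : dirichlet_norm2 mu f =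
  (\sum_(0 <= n <oo) (rnorm (a n) ^+ 2)%:E +
   \sum_(0 <= n <oo) (delta ^+ 2 * deviation S D a n)%:E)%E.
Proof.
rewrite /dirichlet_norm2 (coefficientsE fa); congr (_ + _)%E.
have /choice[h hh] : forall w, exists l : K, unit_disk w ->
    series (fun n => w ^+ n *: resolvent_coef n) @ \oo --> l.
  move=> w; have [Dw|nDw] := pselect (unit_disk w); last by exists 0.
  by have [l hl] := abel_cvg abel_resolvent ((unit_diskE w).1 Dw); exists l.
have hd : power_series (fun n => delta%:C *: resolvent_coef n) (fun w => delta%:C *: h w).
  move=> w Dw; rewrite (_ : series _ = (fun N => delta%:C *:
      series (fun n => w ^+ n *: resolvent_coef n) N)).
    by apply: cvgZl_tmp; exact: hh.
  apply/funext => N.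
  by rewrite /series /= scaler_sumr; apply: eq_bigr => n _; rewrite !scalerA mulrC.
transitivity ((pi^-1)%:E * \int[(lebesgue_measure \x lebesgue_measure)%E]_(v in
    @plane_point R @^-1` unit_disk)
    ((1 - cabs (plane_point v) ^+ 2) * rnorm (delta%:C *: h (plane_point v)) ^+ 2)%:E)%E.
  congr (_ * _)%E; apply: eq_integral => v; rewrite inE => Dv.
  have Dv' : unit_disk (plane_point v) by [].
  have [l -> hl] := power_series_derive abel_a fa Dv'.
  have [Dh Pl] := resolvent_identity (hh _ Dv') hl.
  rewrite poisson_dirichlet.
    rewrite Pl scalerBr scalerA [delta%:C * _]mulrC -scalerA.
    have -> : delta%:C *: U (h (plane_point v)) = U (delta%:C *: h (plane_point v)).
      rewrite !U_compression ?(blinZ bA)//.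
      exact: closed_subspaceZ.
    by rewrite (poisson_identity cD HU FU)//; exact: closed_subspaceZ.
  apply: (closed_seq _ _ hl); first by case: cE.
  move=> n; apply: closed_subspace_sum => // m.
  by apply: (closed_subspaceZ _ cE); apply: (closed_subspaceZ _ cE).
rewrite (disk_norm_power_series hd); apply: eq_eseriesr => n _; congr EFin.
rewrite deviation_resolvent rnormZ cabsR exprMn real_normK ?num_real//.
by rewrite mulrA.
Qed.

End DirichletNorm.

Let bL : blin L := blin_L B.

(** The Taylor coefficients of [Theta S k]. *)
Definition model_coef k n : K := orthoproj E (iter n L k).

Lemma model_coef_in k n : E (model_coef k n).
Proof. exact: (orthoproj_in cE). Qed.

Lemma rnorm_iter_L n k : rnorm (iter n L k) <= rnorm k.
Proof.
elim: n => //= n; apply: le_trans; set x := iter n L k.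
rewrite -(ler_pXn2r (ltn0Sn 1)) ?nnegrE ?rnorm_ge0//.
have h1 := sqr_ge0 (rnorm (orthoproj E x)).
have h2 := mulr_ge0 (sqr_ge0 delta) (sqr_ge0 (rnorm (P (L x)))).
by rewrite [leRHS](rnorm_split B x); lra.
Qed.

Lemma abel_model_coef k : abel (model_coef k).
Proof.
apply: (abel_bounded (C := rnorm k)) => n.
exact: le_trans (orthoproj_le cE _) (rnorm_iter_L n k).
Qed.

Lemma Theta_disk k : power_series (model_coef k) (Theta S k).
Proof.
move=> w Dw; rewrite /Theta /patch mem_set// (adj_cauchy_dual B).
have [l hl] := abel_cvg (@abel_model_coef k) ((unit_diskE w).1 Dw).
by rewrite (cvg_lim (@norm_hausdorff _ _) hl).
Qed.

Lemma Theta_out k w : ~ unit_disk w -> Theta S k w = 0.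
Proof. by move=> nDw; rewrite /Theta /patch memNset. Qed.

Lemma eq_Theta k f : power_series (model_coef k) f ->
  (forall w, ~ unit_disk w -> f w = 0) -> Theta S k = f.
Proof.
move=> hf f0; apply/funext => w; have [Dw|nDw] := pselect (unit_disk w).
  exact: cvg_uniqK (@Theta_disk k w Dw) (hf w Dw).
by rewrite Theta_out// f0.
Qed.

Lemma Theta_linear : linear (Theta S).
Proof.
move=> c x y; apply: eq_Theta => [w Dw|w nDw]; last first.
  by rewrite -[LHS]/(c *: Theta S x w + Theta S y w) !Theta_out// scaler0 addr0.
rewrite (_ : series _ = (fun N => c *: series (fun n => w ^+ n *: model_coef x n) N +
    series (fun n => w ^+ n *: model_coef y n) N)).
  by apply: cvgD; [apply: cvgZl_tmp|]; exact: Theta_disk.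
apply/funext => N; rewrite /series /= scaler_sumr -big_split /=; apply: eq_bigr => n _.
have bn := blin_iter n bL; have bE := blin_proj cE.
rewrite /model_coef (blinD bn) (blinZ bn) (blinD bE) (blinZ bE).
by rewrite scalerDr !scalerA mulrC.
Qed.

Lemma Theta_shift k : Theta S (S k) = forward_shift (Theta S k).
Proof.
apply: eq_Theta => [w Dw|w nDw]; last by rewrite /forward_shift Theta_out// scaler0.
rewrite -(cvg_shiftS (series _)).
rewrite (_ : (fun N => _) = (fun N => w *: series (fun n => w ^+ n *: model_coef k n) N)).
  by apply: cvgZl_tmp; exact: Theta_disk.
apply/funext => N; rewrite /series /= big_nat_recl//=.
rewrite {1}/model_coef /= -(SL B) (LS B) subrr scaler0 add0r scaler_sumr.
apply: eq_bigr => n _; rewrite scalerA -exprS; congr (_ *: _).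
by rewrite /model_coef iterSr (LS B).
Qed.

Lemma eseries_EFin (u : nat -> R) (l : R) : series u @ \oo --> l ->
  (\sum_(0 <= n <oo) (u n)%:E)%E = l%:E.
Proof.
move=> ul; apply/cvg_lim => //; under eq_fun do rewrite sumEFin.
exact: cvg_EFin_seq.
Qed.

Lemma Theta_norm k : dirichlet_norm2 mu (Theta S k) = (rnorm k ^+ 2)%:E.
Proof.
rewrite (dirichlet_normE (@abel_model_coef k) (@Theta_disk k) (@model_coef_in k)).
have [p [q [hp hq <-]]] := norm_identity B S_analytic k.
rewrite (eseries_EFin hp) (eseries_EFin (l := delta ^+ 2 * q)) -?EFinD//.
rewrite (_ : series _ = (fun N => delta ^+ 2 * series (deviation S D (model_coef k)) N)).
  by apply: cvgMr.
by apply/funext => N; rewrite /series /= mulr_sumr.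
Qed.

Lemma partial_sum_le_eseries (u : nat -> R) (M : R) : (forall n, 0 <= u n) ->
  (\sum_(0 <= n <oo) (u n)%:E <= M%:E)%E -> forall N, \sum_(0 <= n < N) u n <= M.
Proof.
move=> u0 uM N; rewrite -lee_fin -sumEFin; apply: le_trans uM.
by apply: nneseries_lim_ge => n _ _; rewrite lee_fin.
Qed.

(** Finiteness of the norm in the form [dirichlet_normE] is the hypothesis of
    [realization]. *)
Lemma range_Theta : dirichlet_space E mu = range (Theta S).
Proof.
apply/seteqP; split=> [f [[a [Ea fa]] f0 fin]|_ [k _ <-]]; last first.
  split; [|exact: Theta_out|by rewrite Theta_norm ltry].
  by exists (model_coef k); split; [exact: model_coef_in | exact: Theta_disk].
have dev0 n : 0 <= deviation S D a n by rewrite /deviation divr_ge0 ?sqr_ge0 ?mulr_ge0.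
have s1 : (0 <= \sum_(0 <= n <oo) (rnorm (a n) ^+ 2)%:E)%E.
  by apply: nneseries_ge0 => n _ _; rewrite lee_fin sqr_ge0.
have s2 : (0 <= \sum_(0 <= n <oo) (delta ^+ 2 * deviation S D a n)%:E)%E.
  by apply: nneseries_ge0 => n _ _; rewrite lee_fin mulr_ge0 ?sqr_ge0.
move: fin; rewrite (dirichlet_normE (power_series_abel fa) fa Ea) => fin.
pose T := fine (\sum_(0 <= n <oo) (rnorm (a n) ^+ 2)%:E +
   \sum_(0 <= n <oo) (delta ^+ 2 * deviation S D a n)%:E)%E.
have TE : T%:E = (\sum_(0 <= n <oo) (rnorm (a n) ^+ 2)%:E +
   \sum_(0 <= n <oo) (delta ^+ 2 * deviation S D a n)%:E)%E.
  by rewrite /T fineK// ge0_fin_numE ?adde_ge0.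
have h1 : forall N, \sum_(0 <= n < N) rnorm (a n) ^+ 2 <= T.
  apply: partial_sum_le_eseries => [n|]; first exact: sqr_ge0.
  by rewrite TE leeDl.
have h2 N : \sum_(0 <= n < N) deviation S D a n <= T / delta ^+ 2.
  rewrite ler_pdivlMr ?exprn_gt0// mulrC mulr_sumr.
  apply: (@partial_sum_le_eseries (fun n => delta ^+ 2 * deviation S D a n)).
    by move=> n; rewrite mulr_ge0 ?sqr_ge0.
  by rewrite TE leeDr.
have [k hk] := realization B Ea h1 h2.
exists k => //; apply: eq_Theta => //.
by have -> : model_coef k = a by apply/funext.
Qed.

Lemma Theta_equivalence : equivalent_to_shift E mu S.
Proof.
exists (Theta S); last exact: Theta_shift.
by split; [exact: Theta_linear | rewrite range_Theta | exact: Theta_norm].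
Qed.

End ShiftModel.

(** * The trivial space *)

Section TrivialSpace.
Context {R : realType} {K : hilbertType R}.
Hypothesis K0 : forall x : K, x = 0.
Implicit Types (E : set K) (mu : set R[i] -> K -> K) (T : K -> K).

Let KE (x y : K) : x = y. Proof. by rewrite (K0 x) (K0 y). Qed.
Let inner0 (x y : K) : inner x y = 0. Proof. by rewrite (K0 x) inner0l. Qed.

Lemma trivial_operator_measure E mu : positive_operator_measure E mu.
Proof.
split=> [s _|s x _ _|T _ _ x y _ _]; last 2 first.
- by rewrite inner0.
- rewrite inner0 (_ : (fun n : nat => _) = (fun _ : nat => 0 : R[i]^o)); first exact: cvg_cst.
  by apply/funext => n; rewrite big1.
split=> [c x y _ _|x Ex|]; [exact: KE | by rewrite (KE (mu s x) x) |].
by exists 0 => x _; rewrite (K0 (mu s x)) rnorm0 mul0r.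
Qed.

Lemma trivial_dirichlet_norm mu f : dirichlet_norm2 mu f = 0%E.
Proof.
rewrite /dirichlet_norm2 eseries0 => [|n _ _]; last by rewrite (K0 (coefficients f n)) rnorm0 expr0n.
rewrite add0e; under eq_integral => v _.
  rewrite /poisson_form (@circle_integral_measure _ _ _ _ _ mzero) => [|s _]; last first.
    by rewrite /quadratic_measure inner0.
  rewrite integral_measure_zero; over.
by rewrite integral0 mule0.
Qed.

Lemma trivial_dirichlet_space E mu T : E 0 -> dirichlet_space E mu = range (Theta T).
Proof.
move=> E0; apply/seteqP; split=> f _; first by exists 0 => //; apply/funext => w; exact: KE.
split=> [|w _|]; [|exact: K0|by rewrite trivial_dirichlet_norm].
exists (fun=> 0); split=> // w _; rewrite (K0 (f w)) (_ : series _ = fun=> 0); first exact: cvg_cst.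
by apply/funext => n; exact: K0.
Qed.

Lemma trivial_equivalence E mu T : E 0 -> equivalent_to_shift E mu T.
Proof.
move=> E0; exists (Theta T) => [|k]; last by apply/funext => w; exact: KE.
split=> [c x y||k]; first by apply/funext => w; exact: KE.
  by rewrite (trivial_dirichlet_space mu T E0).
by rewrite trivial_dirichlet_norm (K0 k) rnorm0 expr0n.
Qed.

End TrivialSpace.

(** * Analytic Brownian unitaries as shifts *)

Lemma cov_ge0 (R : realType) (K : hilbertType R) (S : K -> K) : 0 <= cov S.
Proof. exact: sqrtr_ge0. Qed.

Theorem theorem2p3 (R : realType) (K : hilbertType R)
    (S : {linear K -> K}) (S_continuous : continuous S)
    (S_brownian : brownian_unitary S) (S_analytic : analytic_operator S)
    (U : K -> K) (U_unitary : unitary_on (range (Delta S)) U)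
    (U_adj : forall d, range (Delta S) d ->
       adj_on (range (Delta S)) U d = adj S d)
    (F : set R[i] -> K -> K)
    (F_spectral : spectral_measure_of (range (Delta S)) U F) :
  let E := nullspace (adj S) in
  let mu := fun (s : set R[i]) (x : K) => orthoproj E (F s (Delta S x)) in
  let delta := cov S in
  let E0 := fun x : K => (delta^-1)%:C *: orthoproj (nullspace (Delta S)) (S x) in
  [/\ positive_operator_measure E mu,
      dirichlet_space E mu = range (Theta S),
      equivalent_to_shift E mu S,
      E = [set - ((delta^-1)%:C *: E0 (adj_on (range (Delta S)) U d)) + d
             | d in range (Delta S)] &
      forall s : set R[i], borelT s ->
        orthogonal_projection_on E
          (fun x => ((1 + delta ^+ 2) * delta ^- 4)%:C *: mu s x)].
Proof.
move=> E mu delta E0; have bS := continuous_blin S_continuous.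
have [d0|dn0] := eqVneq (cov S) 0.
  have K0 := brownian_trivial bS S_brownian S_analytic d0.
  have KE (x y : K) : x = y by rewrite (K0 x) (K0 y).
  have cE : closed_subspace E := closed_subspace_null (blin_adj bS).
  have Ez : E 0 by case: cE.
  split; [exact: trivial_operator_measure | exact: trivial_dirichlet_space |
          exact: trivial_equivalence | |].
  - apply/seteqP; split=> [x _|_ [x _ <-]]; last by rewrite (K0 (_ + _)).
    by exists (Delta S 0); [exists 0 | exact: KE].
  - by move=> s _; exists E; split=> // x _; exact: KE.
have d0 : 0 < cov S by rewrite lt_def dn0 cov_ge0.
have B := brownian_dataP bS S_brownian d0 U_unitary U_adj.
have rD := range_Delta bS S_brownian d0.
rewrite /mu /E0; move: (U_unitary) (U_adj) (F_spectral); rewrite rD.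
set D := closure (range (Delta S)) in B *; move=> UD UadjD FD.
have DS x : Delta S x = (delta ^+ 2)%:C *: orthoproj D x.
  exact: (Delta_scalar bS S_brownian).
have UE d : D d -> U d = compression S D d.
  by move=> Dd; exact: (U_proj bS S_brownian d0 U_unitary U_adj Dd).
split.
- exact: (dirichlet_measure_positive B DS FD).
- exact: (range_Theta B S_analytic DS UD UE FD).
- exact: (Theta_equivalence B S_analytic DS UD UE FD).
- rewrite /E (range_ker B); apply: eq_imagel => d Dd.
  by rewrite UadjD// (proj_null bS).
- exact: (scaled_measure_projection B DS FD).
Qed.
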